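(* Let $0<c_1<c_2$ and $0<c_3<c_4$, and suppose $c_3<g^*(\omega)<c_4$ for all $\omega\in\Omega$. Let $f[\tau]=\frac12 l^2$ be the loss function associated with a source–test pair $(\phi,\psi)$, and let $\nabla f[\tau]=\frac{\delta f}{\delta\tau}$ be its Fréchet derivative with respect to the relaxation time, given by the formula in the context. Fix $\tau$ with $c_1<\tau(\omega)<c_2$ on $\Omega$. Then $\nabla f$ is Lipschitz at $\tau$: there exists a constant $C>0$ such that, for all sufficiently small perturbations $\tilde\tau=\tilde\tau(\omega)$ (with $\tau+\tilde\tau$ still taking values between $c_1$ and $c_2$), $$\|\nabla f[\tau+\tilde\tau]-\nabla f[\tau]\|_2\le C\|\tilde\tau\|_2 .$$
   Context: Variables: $t\in[0,T_f]$ ($T_f$ the final time), $x\in(0,1)$, $\mu\in[-1,1]$, and phonon frequency $\omega\in\Omega$, with $\Omega\subset[0,\infty)$ a bounded interval. The group velocity $v(\omega)>0$ and the function $g^*(\omega)>0$ are given and do not depend on $\tau$. For a relaxation time $\tau(\omega)>0$ put $h^*(\omega)=g^*(\omega)/\tau(\omega)$. The norm is $\|\tilde\tau\|_2=(\int_\Omega\tilde\tau^2\,d\omega)^{1/2}$. Averages: $\langle\cdot\rangle$ with subscripts denotes integration over the listed variables (the others being kept as free variables), with the normalized measures $\frac12 d\mu$ on $[-1,1]$ and $d\omega/|\Omega|$ on $\Omega$, and with $dt$ on $(0,T_f)$ and $dx$ on $(0,1)$. A subscript $x=0$ means evaluation at $x=0$; a subscript $\mu>0$ means that the $\mu$-integral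 is restricted to $\mu>0$. Collision operator: $\mathcal L[h]=\dfrac{\langle h\rangle_{\mu,\omega}}{\langle h^*\rangle_\omega}h^*-h$. Source–test pair: $\phi(t,\mu,\omega)=\phi_{\varepsilon_1}(t-t_0)\phi_{\varepsilon_2}(\mu-\mu_0)\phi_{\varepsilon_3}(\omega-\omega_0)$ and $\psi(t)=\phi_{\varepsilon_4}(t-t_R)$, where $\phi_\varepsilon$ denotes a narrow centred Gaussian profile with variance $\varepsilon$; both are bounded and independent of $\tau$. Forward problem for $h(t,x,\mu,\omega)$: $$\partial_t h+\mu v(\omega)\partial_x h=\frac1{\tau(\omega)}\mathcal L[h],\quad 0<x<1;\qquad h(t=0,x,\mu,\omega)=0;$$ $$h(t\neq0,x=0,\mu,\omega)=\frac{\phi}{\tau}\ \ (\mu>0);\qquad h(t,x=1,-\mu,\omega)=h(t,x=1,\mu,\omega)\ \ (\mu>0).$$ Mismatch and loss: $l=\left\langle\frac{\langle h\rangle_{x=0,\mu,\omega}}{\langle h^*\rangle_\omega}\psi\right\rangle_t-\mathrm d$ with $\mathrm d\in\mathbb R$ a fixed datum, and $f[\tau]=\frac12l^2$. Adjoint problem for $p(t,x,\mu,\omega)$: $$\partial_t p+\mu v(\omega)\partial_x p=-\frac1{\tau(\omega)}\mathcal L[p],\quad 0<x<1;\qquad p(t=T_f,x,\mu,\omega)=0;$$ $$p(t,x=0,\mu,\omega)=l\,\frac{h^*}{\mu v\tau\langle h^*\rangle_\omega}\psi(t)\ \ (\mu<0);\qquad p(t,x=1,-\mu,\omega)=p(t,x=1,\mu,\omega)\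 \ (\mu<0).$$ Gradient formula (with $h,p,h^*,l$ computed for the given $\tau$): $$\begin{aligned} \nabla f[\tau](\omega)=&-\frac{l}{\tau^2\langle h^*\rangle_\omega}\langle \phi\,\psi\rangle_{t,x=0,\mu>0}+\frac{l}{\langle h^*\rangle_\omega^2}\frac{h^*}{\tau}\langle h\,\psi\rangle_{t,x=0,\mu,\omega}+\frac{1}{\tau h^*}\langle \mu v p\,\phi\rangle_{t,x=0,\mu>0}\\ &+\frac{1}{\tau h^*}\langle \mathcal L[h]\,p\rangle_{t,x,\mu}-\frac{1}{\tau\langle h^*\rangle_\omega}\left\langle \frac{h^*}{\langle h^*\rangle_\omega}\langle h\rangle_{\mu,\omega}\langle p\rangle_{\mu,\omega}-\langle h\rangle_{\mu,\omega}\,p\right\rangle_{t,x,\mu}. \end{aligned}$$ *)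

(* Defs.v *)
From HB Require Import structures.
From mathcomp Require Import all_boot all_order all_algebra.
From mathcomp Require Import all_classical all_reals all_analysis.
Set Implicit Arguments.
Unset Strict Implicit.
Unset Printing Implicit Defensive.
Import Order.TTheory GRing.Theory Num.Theory.
Import numFieldNormedType.Exports.
Local Open Scope classical_set_scope.
Local Open Scope ring_scope.

(* Phase-space functions are curried, with arguments in the order
   (t, x, mu, omega); functions of (mu, omega) take mu first. *)

Section phonon.
Context {R : realType}.

Definition gauss (eps x : R) : R := normal_pdf 0 (Num.sqrt eps) x.

Definition source (eps1 eps2 eps3 t0 mu0 om0 t mu om : R) : R :=
  gauss eps1 (t - t0) * gauss eps2 (mu - mu0) * gauss eps3 (om - om0).

Definition test (eps4 tR t : R) : R := gauss eps4 (t - tR).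

Section averages.
Variables (Tf : R) (Om : set R).

Definition avg_t (f : R -> R) : R :=
  \int[lebesgue_measure]_(t in `]0, Tf[) f t.

Definition avg_x (f : R -> R) : R :=
  \int[lebesgue_measure]_(x in `]0, 1[) f x.

Definition avg_mu (f : R -> R) : R :=
  2^-1 * \int[lebesgue_measure]_(mu in `[-1, 1]) f mu.

(* Restricted to mu > 0, but with the weight 1/2 of the full mu-range. *)
Definition avg_mu_pos (f : R -> R) : R :=
  2^-1 * \int[lebesgue_measure]_(mu in `]0, 1]) f mu.

Definition avg_om (f : R -> R) : R :=
  (fine (lebesgue_measure Om))^-1 * \int[lebesgue_measure]_(om in Om) f om.

Definition avg_mu_om (f : R -> R -> R) : R :=
  avg_om (fun om => avg_mu (fun mu => f mu om)).

(* Extended-real valued, so that a function that is not square integrable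
   has norm +oo. *)
Definition norm2 (f : R -> R) : \bar R :=
  Lnorm (@lebesgue_measure R) 2%:E (EFin \o (f \_ Om)).

End averages.

Definition hstar (g tau : R -> R) (om : R) : R := g om / tau om.

(* The operator L, acting on the (mu, omega)-section of a phase-space function
   at a given (t, x). *)
Definition collision (Om : set R) (g tau : R -> R) (f : R -> R -> R)
    (mu om : R) : R :=
  avg_mu_om Om f / avg_om Om (hstar g tau) * hstar g tau om - f mu om.

Section transport.
Variables (Tf : R) (Om : set R) (v : R -> R).

Definition in_phase (t x mu om : R) : Prop :=
  [/\ 0 <= t <= Tf, 0 <= x <= 1, -1 <= mu <= 1 & Om om].

Definition phase : set ((R * R) * (R * R)) :=
  [set z | in_phase z.1.1 z.1.2 z.2.1 z.2.2].

Definition uncurry4 (f : R -> R -> R -> R -> R) (z : (R * R) * (R * R)) : R :=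
  f z.1.1 z.1.2 z.2.1 z.2.2.

Definition leb2 := ((@lebesgue_measure R) \x (@lebesgue_measure R))%E.

(* d_t f + mu v d_x f = S for 0 < x < 1, integrated along the characteristics
   s |-> (s, x + mu v (s - t1)), up to and including the end points on the
   boundary of the slab.  The source is only required to be integrable along
   characteristics: solutions of the problems below have jumps, so that the
   derivatives d_t f and d_x f need not exist separately. *)
Definition transport_eq (f S : R -> R -> R -> R -> R) : Prop :=
  forall t1 t2 x mu om,
    0 <= t1 -> t1 < t2 -> t2 <= Tf -> -1 <= mu <= 1 -> Om om ->
    let X s := x + mu * v om * (s - t1) in
    (forall s, t1 < s < t2 -> 0 < X s < 1) ->
    (@lebesgue_measure R).-integrable `]t1, t2[
      (fun s => (S s (X s) mu om)%:E) /\
    f t2 (X t2) mu om - f t1 x mu om =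
      \int[lebesgue_measure]_(s in `]t1, t2[) S s (X s) mu om.

(* The average over (mu, omega), hence L[f], is a genuine integral at every
   point of the open slab. *)
Definition averageable (f : R -> R -> R -> R -> R) : Prop :=
  forall t x, 0 <= t <= Tf -> 0 < x < 1 ->
    leb2.-integrable (`[-1, 1] `*` Om) (fun z => (f t x z.1 z.2)%:E).

End transport.

Section problems.
Variables (Tf : R) (Om : set R) (v g : R -> R).
Variables (phi : R -> R -> R -> R) (psi : R -> R) (d : R).
Variable tau : R -> R.

Record forward_solution (h : R -> R -> R -> R -> R) : Prop := ForwardSolution {
  forward_measurable : measurable_fun (phase Tf Om) (uncurry4 h) ;
  (* the data are bounded, and so is h *)
  forward_bounded : exists M : R, forall t x mu om,
    in_phase Tf Om t x mu om -> `|h t x mu om| <= M ;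
  forward_averageable : averageable Tf Om h ;
  forward_eq : transport_eq Tf Om v h
    (fun t x mu om => (tau om)^-1 * collision Om g tau (h t x) mu om) ;
  forward_init : forall x mu om, 0 <= x <= 1 -> -1 <= mu <= 1 -> Om om ->
    h 0 x mu om = 0 ;
  forward_inflow : forall t mu om, 0 < t <= Tf -> 0 < mu <= 1 -> Om om ->
    h t 0 mu om = phi t mu om / tau om ;
  forward_reflection : forall t mu om, 0 <= t <= Tf -> 0 < mu <= 1 -> Om om ->
    h t 1 (- mu) om = h t 1 mu om
}.

Definition mismatch (h : R -> R -> R -> R -> R) : R :=
  avg_t Tf (fun t => avg_mu_om Om (h t 0) / avg_om Om (hstar g tau) * psi t)
  - d.

(* The inflow datum behaves like 1/mu as mu -> 0, so p is not bounded but only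
   integrable.  At the corner t = Tf, x = 0 the final condition prevails over
   the inflow condition, just as the initial condition does for h at t = 0. *)
Record adjoint_solution (l : R) (p : R -> R -> R -> R -> R) : Prop :=
  AdjointSolution {
  adjoint_integrable : (leb2 \x leb2)%E.-integrable (phase Tf Om)
    (EFin \o uncurry4 p) ;
  adjoint_averageable : averageable Tf Om p ;
  adjoint_eq : transport_eq Tf Om v p
    (fun t x mu om => - ((tau om)^-1 * collision Om g tau (p t x) mu om)) ;
  adjoint_final : forall x mu om, 0 <= x <= 1 -> -1 <= mu <= 1 -> Om om ->
    p Tf x mu om = 0 ;
  adjoint_inflow : forall t mu om, 0 <= t < Tf -> -1 <= mu < 0 -> Om om ->
    p t 0 mu om =
      l * (hstar g tau om / (mu * v om * tau om * avg_om Om (hstar g tau)))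
        * psi t ;
  adjoint_reflection : forall t mu om, 0 <= t <= Tf -> -1 <= mu < 0 -> Om om ->
    p t 1 (- mu) om = p t 1 mu om
}.

(* Formula for the derivative of f[tau] = l^2 / 2 with respect to tau,
   represented as a function of omega through the pairing <., .>_omega; h and p
   are the forward and adjoint solutions for tau. *)
Definition gradient (h p : R -> R -> R -> R -> R) (om : R) : R :=
  let l := mismatch h in
  let hs := hstar g tau in
  let hsbar := avg_om Om hs in
  - (l / (tau om ^+ 2 * hsbar)
      * avg_t Tf (fun t => avg_mu_pos (fun mu => phi t mu om * psi t)))
  + l / hsbar ^+ 2 * (hs om / tau om)
      * avg_t Tf (fun t => avg_mu_om Om (fun mu om' => h t 0 mu om' * psi t))
  + (tau om * hs om)^-1
      * avg_t Tf (fun t => avg_mu_pos (fun mu =>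
          mu * v om * p t 0 mu om * phi t mu om))
  + (tau om * hs om)^-1
      * avg_t Tf (fun t => avg_x (fun x => avg_mu (fun mu =>
          collision Om g tau (h t x) mu om * p t x mu om)))
  - (tau om * hsbar)^-1
      * avg_t Tf (fun t => avg_x (fun x => avg_mu (fun mu =>
          hs om / hsbar * avg_mu_om Om (h t x) * avg_mu_om Om (p t x)
          - avg_mu_om Om (h t x) * p t x mu om))).

End problems.

Definition admissible (Om : set R) (c1 c2 : R) (tau : R -> R) : Prop :=
  measurable_fun Om tau /\ forall om, Om om -> c1 < tau om < c2.

End phonon.

(* Main.v *)
Require Import Defs.
From HB Require Import structures.
From mathcomp Require Import all_boot all_order all_algebra.
From mathcomp Require Import all_classical all_reals all_analysis.
From mathcomp Require Import measurable_realfun.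
From mathcomp Require Import ring lra.
Set Implicit Arguments.
Unset Strict Implicit.
Unset Printing Implicit Defensive.
Import Order.TTheory GRing.Theory Num.Theory.
Import numFieldNormedType.Exports.
Local Open Scope classical_set_scope.
Local Open Scope ring_scope.

(** The gradient at a frequency [omega] is built from [tau] and [g], the mismatch,
    averages of the forward solution [h], and pairings of the adjoint solution [p]
    with bounded functions.  Each ingredient is bounded, and for two relaxation
    times [tau'] and [tau] it differs at almost every [omega] by at most a constant
    times
    [dist tau' tau omega = |tau' - tau|(omega) + \int_Om |tau' - tau|].
    These two properties are stable under sums, products and inverses
    ([lipD], [lipM], [lipV]), whence [gradient_lip].  Squaring and integrating over
    [Om], and bounding the integral in [dist] by the Cauchy--Schwarz inequality,
    gives the estimate in the square norm, without any smallness condition.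

    The difference of two solutions solves the transport equation again, with the
    inflow datum and an exterior source bounded by [dist]; so everything rests on
    stability estimates that are pointwise in [omega], the frequencies being coupled
    only by the mean over directions and frequencies.

    The forward solution is bounded ([forward_estimate]): following a characteristic
    back to the initial time or to the inflow face [x = 0], after at most one
    reflection, and inserting the weight [exp (- lam t)] with [lam] large, the source
    terms that depend on the solution are absorbed by the left-hand side.

    The inflow datum of the adjoint problem is not bounded, since it behaves like
    [1 / mu]; but its flux is, as [mu v p] is bounded on the inflow face.  So [p] is
    estimated in [L^1] in [t], [x] and [mu], for almost every [omega]
    ([adjoint_estimate]).  Integrating the representation along characteristics with
    the weight [exp (lam t)] bounds the weighted mass and the weighted outgoing flux
    at [x = 0] ([slab_mass], [slab_outflux], [mass_flux_le]); the mass carries a factor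
    [1 / lam], by which the collision terms are absorbed.  The mass controls the
    pairings over the slab ([pairing_lip]), and the flux controls the pairing with the
    source on the boundary ([flux_pairing_lip]). *)

(** * Integrals of nonnegative functions *)

Section nonnegative_integrals.
Local Open Scope ereal_scope.
Context d (T : measurableType d) (R : realType).
Variable mu : {measure set T -> \bar R}.

(** Monotonicity of the integral of nonnegative functions; as the integral is
    the supremum of the integrals of the smaller simple functions, neither
    function nor the domain needs to be measurable. *)
Lemma le_integral_ge0 (D : set T) (f1 f2 : T -> \bar R) :
  (forall x, D x -> 0 <= f1 x) -> (forall x, D x -> f1 x <= f2 x) ->
  \int[mu]_(x in D) f1 x <= \int[mu]_(x in D) f2 x.
Proof.
move=> f10 f12.
rewrite !ge0_integralE//; last by move=> x Dx; exact: le_trans (f10 _ Dx) (f12 _ Dx).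
apply: ereal_sup_le => _ [h hf <-]; exists h => //= x.
apply: le_trans (hf x) _; rewrite !patchE; case: ifPn => // xD.
by apply: f12; rewrite inE in xD.
Qed.

(** The same for an inequality that holds almost everywhere: off the exceptional
    set nothing changes, and on it the larger function may be set to [+oo]. *)
Lemma le_integral_ge0_ae (D : set T) (f1 f2 : T -> \bar R) :
  measurable D -> measurable_fun D f2 ->
  (forall x, D x -> 0 <= f1 x) -> (forall x, D x -> 0 <= f2 x) ->
  {ae mu, forall x, D x -> f1 x <= f2 x} ->
  \int[mu]_(x in D) f1 x <= \int[mu]_(x in D) f2 x.
Proof.
move=> mD mf2 f10 f20 [N [mN N0 subN]].
pose g x := if x \in N then +oo else f2 x.
have mg : measurable_fun D g.
  apply: measurable_fun_if => //.
  - apply: (measurable_fun_bool true); rewrite (_ : _ @^-1` _ = N).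
      exact: measurableI.
    by apply/seteqP; split=> x; rewrite /preimage/=; [exact: set_mem|exact: mem_set].
  - by apply: measurable_funS mf2 => //; exact: subIsetl.
have g0 x : D x -> 0 <= g x by move=> Dx; rewrite /g; case: ifPn => // _; exact: f20.
apply: (@le_trans _ _ (\int[mu]_(x in D) g x)).
  apply: le_integral_ge0 => // x Dx; rewrite /g; case: ifPn; first by rewrite leey.
  move=> xN; apply: contrapT => h; move/negP: xN; apply; rewrite inE.
  by apply: subN => /= /(_ Dx).
rewrite (@ae_eq_integral _ _ _ mu D f2 g)//.
exists N; split => // x /= /not_implyP[Dx gx]; apply: contrapT => xN; apply: gx.
by rewrite /g memNset.
Qed.

(** Finiteness almost everywhere of a nonnegative function with finite integral. *)
Lemma ae_lty (D : set T) (f : T -> \bar R) :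
  measurable D -> measurable_fun D f -> (forall x, D x -> 0 <= f x) ->
  \int[mu]_(x in D) f x < +oo -> {ae mu, forall x, D x -> f x < +oo}.
Proof.
move=> mD mf f0 foo.
have : mu.-integrable D f.
  apply/integrableP; split => //; apply: le_lt_trans foo.
  by apply: le_integral_ge0 => // x Dx; rewrite gee0_abs// f0.
move/integrable_ae => /(_ mD); apply: filterS => x h Dx.
by have := h Dx; rewrite ge0_fin_numE// f0.
Qed.

Lemma ae_mono (P Q : T -> Prop) : {ae mu, forall x, P x} ->
  (forall x, P x -> Q x) -> {ae mu, forall x, Q x}.
Proof. by move=> aP PQ; apply: filterS aP. Qed.

Lemma ae_mono2 (P Q S : T -> Prop) : {ae mu, forall x, P x} ->
  {ae mu, forall x, Q x} -> (forall x, P x -> Q x -> S x) -> {ae mu, forall x, S x}.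
Proof. by move=> aP aQ PQS; apply: filterS2 aP aQ. Qed.

End nonnegative_integrals.

Section parametric_integrals.
Local Open Scope ereal_scope.
Context d1 d2 (T1 : measurableType d1) (T2 : measurableType d2) (R : realType).
Variable m2 : {sigma_finite_measure set T2 -> \bar R}.
Variable D : set T2.
Hypothesis mD : measurable D.

Lemma measurable_integral_param (F : T1 * T2 -> \bar R) :
  measurable_fun setT F -> (forall z, 0 <= F z) ->
  measurable_fun setT (fun x => \int[m2]_(y in D) F (x, y)).
Proof.
move=> mF F0.
rewrite (_ : (fun x => _) = fubini_F m2 (F \_ (setT `*` D))).
  apply: measurable_fun_fubini_tonelli_F.
    apply/(measurable_restrictT _ _).1 => //; first exact: measurableX.
    exact: measurable_funTS.
  by move=> z; apply: erestrict_ge0.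
apply/funext => x; rewrite /fubini_F [LHS]integral_mkcond; apply: eq_integral => y _.
by rewrite !patchE; congr (if _ then _ else _); apply/idP/idP; rewrite !inE /=; tauto.
Qed.

Lemma measurable_Rintegral_param (F : T1 * T2 -> R) :
  measurable_fun setT F ->
  measurable_fun setT (fun x => \int[m2]_(y in D) F (x, y))%R.
Proof.
move=> mF; apply: (measurableT_comp (@fine_measurable R setT measurableT)).
have mF' : measurable_fun setT (EFin \o F) by exact/measurable_EFinP.
have mp := @measurable_integral_param ((EFin \o F)^\+)%E (measurable_funepos mF') (fun=> funepos_ge0 _ _).
have mn := @measurable_integral_param ((EFin \o F)^\-)%E (measurable_funeneg mF') (fun=> funeneg_ge0 _ _).
rewrite (_ : (fun x => _) = (fun x => \int[m2]_(y in D) ((EFin \o F)^\+ (x, y)) -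
   \int[m2]_(y in D) ((EFin \o F)^\- (x, y)))); last by apply/funext => x /=; rewrite [LHS]integralE; congr (_ - _); apply: eq_integral => y _; rewrite ?funeposE ?funenegE.
exact: emeasurable_funB mp mn.
Qed.

End parametric_integrals.

(** Tonelli's theorem on a rectangle. *)
Lemma tonelli_in d1 d2 (T1 : measurableType d1) (T2 : measurableType d2)
    (R : realType) (m1 : {sigma_finite_measure set T1 -> \bar R})
    (m2 : {sigma_finite_measure set T2 -> \bar R}) (D1 : set T1) (D2 : set T2)
    (F : T1 * T2 -> \bar R) :
  measurable D1 -> measurable D2 ->
  measurable_fun setT F -> (forall z, 0 <= F z)%E ->
  (\int[m1]_(x in D1) \int[m2]_(y in D2) F (x, y) =
   \int[m2]_(y in D2) \int[m1]_(x in D1) F (x, y))%E.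
Proof.
move=> mD1 mD2 mF F0.
pose G := F \_ (D1 `*` D2).
have mG : measurable_fun setT G.
  apply/(measurable_restrictT _ _).1 => //; first exact: measurableX.
  exact: measurable_funTS.
have G0 z : (0 <= G z)%E by apply: erestrict_ge0.
have := @fubini_tonelli _ _ _ _ R m1 m2 G mG G0.
have -> : (\int[m1]_x \int[m2]_y G (x, y) = \int[m1]_(x in D1) \int[m2]_(y in D2) F (x, y))%E.
  rewrite [RHS]integral_mkcond; apply: eq_integral => x _.
  rewrite patchE; case: ifPn => xD.
    rewrite [RHS]integral_mkcond; apply: eq_integral => y _; rewrite /G !patchE.
    by congr (if _ then _ else _); apply/idP/idP; rewrite !inE in xD *; rewrite /=; tauto.
  rewrite integral0_eq// => y _; rewrite /G patchE memNset// => -[/= xD1 _].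
  by move/negP: xD; rewrite inE.
move=> ->.
rewrite [RHS]integral_mkcond; apply: eq_integral => y _.
rewrite patchE; case: ifPn => xD.
  rewrite [RHS]integral_mkcond; apply: eq_integral => x _; rewrite /G !patchE.
  by congr (if _ then _ else _); apply/idP/idP; rewrite !inE in xD *; rewrite /=; tauto.
rewrite integral0_eq// => x _; rewrite /G patchE memNset// => -[/= _ xD1].
by move/negP: xD; rewrite inE.
Qed.

Section lebesgue_line.
Context {R : realType}.
Local Notation leb := (@lebesgue_measure R).

(** Affine change of variables for nonnegative functions, by the uniqueness of
    Lebesgue measure. *)
Lemma integral_affine (a b : R) (f : R -> \bar R) : a != 0 ->
  measurable_fun setT f -> (forall x, 0 <= f x)%E ->
  (\int[leb]_x f x = `|a|%:E * \int[leb]_x f (a * x + b)%R)%E.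
Proof.
move=> a0 mf f0.
have a1 : 0 < `|a| by rewrite normr_gt0.
pose phi := (fun x : measurableTypeR R => (a * x + b : measurableTypeR R)).
have mphi : measurable_fun setT phi.
  by apply: measurable_funD => //; exact: measurable_funM.
pose k : {nonneg R} := NngNum (ltW a1).
pose m1 : {measure set (measurableTypeR R) -> \bar R} :=
  measure_function_pushforward__canonical__measure_function_Measure leb mphi.
pose m' : {measure set (measurableTypeR R) -> \bar R} := mscale k m1.
have E : forall A, measurable A -> leb A = m' A.
  apply: lebesgue_measure_unique => _ [[u w] _ <-].
  rewrite /m' /= /mscale /= /pushforward /=.
  rewrite lebesgue_measure_itv/= lte_fin.
  have [a_gt0|a_lt0] := ltP 0 a.
    have -> : phi @^-1` `]u, w] = `](u - b) / a, (w - b) / a]%classic.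
      apply/seteqP; split=> x /=; rewrite /phi !in_itv/= ltr_pdivrMr// ler_pdivlMr// mulrC ltrBlDr lerBrDr; done.
    rewrite lebesgue_measure_itv/= lte_fin ltr_pM2r ?invr_gt0// ltrD2r.
    case: ifPn => uw; last by rewrite mule0.
    rewrite -!EFinD -EFinM gtr0_norm//; congr EFin; field.
    exact: lt0r_neq0.
  have {}a_lt0 : a < 0 by rewrite lt_neqAle a0.
  have -> : phi @^-1` `]u, w] = `[(w - b) / a, (u - b) / a[%classic.
    apply/seteqP; split=> x /=; rewrite /phi !in_itv/= ler_ndivrMr// ltr_ndivlMr// mulrC ltrBlDr lerBrDr => /andP[-> ->]//.
  rewrite lebesgue_measure_itv/= lte_fin ltr_nM2r ?invr_lt0// ltrD2r.
  case: ifPn => uw; last by rewrite mule0.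
  rewrite -!EFinD -EFinM ltr0_norm//; congr EFin; field.
  by rewrite lt_eqF.
rewrite (eq_measure_integral m')//=; last by move=> A mA _; exact: E.
rewrite ge0_integral_mscale//; congr (_ * _)%E.
exact: (@ge0_integral_pushforward _ _ _ _ R phi mphi leb setT f).
Qed.

Lemma integral_shift (b : R) (f : R -> \bar R) :
  measurable_fun setT f -> (forall x, 0 <= f x)%E ->
  (\int[leb]_x f (x + b)%R = \int[leb]_x f x)%E.
Proof.
move=> mf f0; rewrite (@integral_affine 1 b f)// ?oner_eq0// normr1 mul1e.
by apply: eq_integral => x _; rewrite mul1r.
Qed.

Lemma integral_expR (lam s t : R) : 0 < lam -> s < t ->
  (\int[leb]_(x in `]s, t[) (expR (lam * x))%:E =
   ((expR (lam * t) - expR (lam * s)) / lam)%:E)%E.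
Proof.
move=> lam0 st.
have dF (x : R) : is_derive x (1 : R) (fun t : R => expR (lam * t) / lam)
    (expR (lam * x)).
  apply: is_derive_eq.
  rewrite /GRing.scale /=; field.
  exact: lt0r_neq0.
have cexp : continuous (fun x : R => expR (lam * x)).
  move=> x; apply: continuous_comp; last exact: continuous_expR.
  by apply: mulrl_continuous.
have cF : continuous (fun t : R => expR (lam * t) / lam).
  by move=> x; apply: differentiable_continuous; apply/derivable1_diffP; have [] := dF x.
rewrite -(@integral_itv_bndoo _ s t _ true false); last first.
  apply/measurable_EFinP; apply: measurable_funTS.
  exact: continuous_measurable_fun.
rewrite (@continuous_FTC2 _ _ (fun t : R => expR (lam * t) / lam))//.
- by rewrite -EFinB mulrBl.
- exact: continuous_subspaceT.
- split.
  + by move=> x _; have [] := dF x.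
  + by apply: cvg_at_right_filter; exact: cF.
  + by apply: cvg_at_left_filter; exact: cF.
- by move=> x _; rewrite derive1E; have [_ ->] := dF x.
Qed.

End lebesgue_line.

(** * Weighted estimates along characteristics in a slab *)

(** Measurability of functions built from the coordinates by ring operations
    and pairing. *)
Ltac mfun := repeat first
  [ assumption | exact: measurable_cst | exact: measurable_id
  | exact: measurable_fst | exact: measurable_snd
  | apply: measurable_fun_pair | apply: measurable_funB
  | apply: measurable_funD | apply: measurable_funM ].

Section weight.
Context {R : realType}.

(** Integration against [exp (lam t)] over an interval gains a factor [1 / lam],
    which is small for large [lam]. *)
Definition weight (lam t : R) : \bar R := (expR (lam * t))%:E.

Lemma weight_ge0 (lam t : R) : (0 <= weight lam t)%E.
Proof. by rewrite lee_fin expR_ge0. Qed.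

Lemma weight_ge1 (lam t : R) : 0 <= lam -> 0 <= t -> (1 <= weight lam t)%E.
Proof. by move=> l0 t0; rewrite lee_fin -expR0 ler_expR mulr_ge0. Qed.

Lemma weight_le (lam s t : R) : 0 <= lam -> s <= t -> (weight lam s <= weight lam t)%E.
Proof. by move=> l0 st; rewrite lee_fin ler_expR ler_wpM2l. Qed.

Lemma measurable_weight (lam : R) : measurable_fun setT (weight lam).
Proof.
apply/measurable_EFinP; apply: measurableT_comp; first exact: measurable_expR.
by mfun.
Qed.

End weight.
#[global] Hint Extern 0 (is_true (@Order.le _ _ _ (weight _ _))) => exact: weight_ge0 : core.
#[global] Hint Extern 0 (@measurable_fun _ _ _ _ _ (weight _)) => exact: measurable_weight : core.

Section slab.
Context {R : realType}.
Local Notation leb := (@lebesgue_measure R).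
Local Open Scope ereal_scope.
(** The characteristics have velocity [c] and leave the slab through [x = 1];
    [b] is a bound on that face, [s] a bound of the source, both counted on the
    open time interval (for [s], on the open slab) only. *)
Variables (T c lam : R).
Hypotheses (c0 : (0 < c)%R) (lam0 : (0 < lam)%R).
Variables (b : R -> \bar R) (s : R * R -> \bar R).
Hypotheses (mb : measurable_fun setT b) (b0 : forall t, 0 <= b t).
Hypotheses (ms : measurable_fun setT s) (s0 : forall z, 0 <= s z).

Let I : set R := `]0%R, T[.
Let J : set R := `]0%R, 1%R[.
Let w := weight lam.
Let bI := b \_ I.
Let sIJ := s \_ (I `*` J).
Let sigma u := \int[leb]_(x in J) s (u, x).

Let mI : measurable I. Proof. exact: measurable_itv. Qed.
Let mJ : measurable J. Proof. exact: measurable_itv. Qed.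

Let w0 t : 0 <= w t. Proof. exact: weight_ge0. Qed.
Let mw : measurable_fun setT w. Proof. exact: measurable_weight. Qed.

Let mbI : measurable_fun setT bI.
Proof. by apply/(measurable_restrictT _ _).1 => //; exact: measurable_funTS. Qed.
Let bI0 t : 0 <= bI t. Proof. by apply: erestrict_ge0. Qed.

Let msIJ : measurable_fun setT sIJ.
Proof.
apply/(measurable_restrictT _ _).1; first exact: measurableX.
exact: measurable_funTS.
Qed.
Let sIJ0 z : 0 <= sIJ z. Proof. by apply: erestrict_ge0. Qed.

Let msigma : measurable_fun setT sigma.
Proof. exact: measurable_integral_param. Qed.
Let sigma0 u : 0 <= sigma u. Proof. exact: integral_ge0. Qed.

Let integral_sIJ u : I u -> \int[leb]_x sIJ (u, x) = sigma u.
Proof.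
move=> Iu; rewrite /sigma [RHS]integral_mkcond; apply: eq_integral => x _.
rewrite /sIJ !patchE; congr (if _ then _ else _).
by apply/idP/idP; rewrite !inE; [case|].
Qed.

Let k u := c%:E * b u + sigma u.
Let k0 u : 0 <= k u.
Proof. by rewrite adde_ge0// mule_ge0// lee_fin ltW. Qed.
Let mk : measurable_fun setT k.
Proof. by apply: emeasurable_funD => //; exact: measurable_funeM. Qed.

Let integral_wk : \int[leb]_(u in I) (w u * k u) =
  c%:E * \int[leb]_(t in I) (w t * b t) + \int[leb]_(t in I) (w t * sigma t).
Proof.
rewrite -ge0_integralZl//; last 3 first.
- by apply: measurable_funTS; exact: emeasurable_funM.
- by move=> x _; rewrite mule_ge0.
- by rewrite lee_fin ltW.
rewrite -ge0_integralD//; last 4 first.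
- by move=> x _; rewrite mule_ge0 ?mule_ge0// lee_fin ltW.
- by apply: measurable_funTS; apply: measurable_funeM; exact: emeasurable_funM.
- by move=> x _; rewrite mule_ge0.
- by apply: measurable_funTS; exact: emeasurable_funM.
apply: eq_integral => u _; by rewrite /k ge0_muleDr// ?mule_ge0 ?lee_fin ?(ltW c0)// muleCA.
Qed.

(** The characteristic through [(t, x)] reaches [x = 1] at the time
    [t + (1 - x) / c]; when that is after [T] the term with [b] vanishes, which
    expresses a vanishing final value. *)
Variable f : R -> R -> \bar R.
Hypothesis f0 : forall t x, 0 <= f t x.
Hypothesis f_le : forall t x, (0 < t < T)%R -> (0 <= x < 1)%R ->
  f t x <= bI (t + (1 - x) / c)%R +
           \int[leb]_(u in `]t, T[) sIJ (u, (x + c * (u - t))%R).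

Let mchar (t : R) : measurable_fun setT
  (fun z : R * R => sIJ (z.2, (z.1 + c * (z.2 - t))%R)).
Proof. by apply: measurableT_comp => //; mfun. Qed.

Let mexit (t : R) : measurable_fun setT (fun x : R => bI (t + (1 - x) / c)%R).
Proof. by apply: measurableT_comp => //; mfun. Qed.

Let slice_mass t : I t ->
  \int[leb]_(x in J) f t x <= \int[leb]_(u in `]t, T[) k u.
Proof.
rewrite /I/= in_itv/= => It.
apply: (@le_trans _ _ (\int[leb]_(x in J) (bI (t + (1 - x) / c)%R +
    \int[leb]_(u in `]t, T[) sIJ (u, (x + c * (u - t))%R)))).
  apply: le_integral_ge0 => // x; rewrite /J/= in_itv/= => /andP[/ltW x0 x1].
  by apply: f_le; rewrite // x0.
rewrite ge0_integralD//; last 3 first.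
- by apply: measurable_funTS; exact: mexit.
- by move=> x _; exact: integral_ge0.
- apply: measurable_funTS.
  apply: (@measurable_integral_param _ _ _ _ R leb _ _
    (fun z : R * R => sIJ (z.2, (z.1 + c * (z.2 - t))%R))) => //.
  exact: mchar.
rewrite /k [leRHS]ge0_integralD//; last 3 first.
- by move=> x _; rewrite mule_ge0// lee_fin ltW.
- by apply: measurable_funTS; exact: measurable_funeM.
- exact: measurable_funTS.
apply: leeD.
- rewrite ge0_integralZl//; [|exact: measurable_funTS|by rewrite lee_fin ltW].
  pose g := b \_ `]t, T[.
  have mg : measurable_fun setT g.
    by apply/(measurable_restrictT _ _).1 => //; exact: measurable_funTS.
  have g0 x : 0 <= g x by apply: erestrict_ge0.
  rewrite [in leRHS]integral_mkcond -/g.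
  rewrite (@integral_affine R (- c^-1)%R (t + c^-1)%R g)//; last first.
    by rewrite oppr_eq0 invr_eq0 lt0r_neq0.
  rewrite normrN normfV gtr0_norm// muleA -EFinM divff ?lt0r_neq0// mul1e.
  rewrite [leLHS]integral_mkcond; apply: le_integral_ge0 => x _.
    by apply: erestrict_ge0.
  rewrite patchE; case: ifPn => // xJ.
  move: xJ; rewrite inE /J/= in_itv/= => /andP[x0 x1].
  have -> : (- c^-1 * x + (t + c^-1) = t + (1 - x) / c)%R by field; exact: lt0r_neq0.
  rewrite /bI /g !patchE; case: ifPn => [|_]; last by case: ifPn.
  rewrite inE /I/= in_itv/= => /andP[h1 h2].
  rewrite mem_set//= in_itv/= h2 andbT ltrDl divr_gt0// subr_gt0//.
- rewrite (@tonelli_in _ _ _ _ R leb leb J `]t, T[ (fun z : R * R => sIJ (z.2, (z.1 + c * (z.2 - t))%R)))//=; last exact: mchar.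
  apply: le_integral_ge0 => u; first by move=> _; exact: integral_ge0.
  rewrite /= in_itv/= => /andP[tu uT].
  rewrite -integral_sIJ; last first.
    by rewrite /I/= in_itv/= uT andbT (lt_trans _ tu)//; case/andP: It.
  rewrite -(@integral_shift R (c * (u - t))%R (fun x => sIJ (u, x)))//; last first.
    by apply: measurableT_comp => //; mfun.
  by rewrite [leLHS]integral_mkcond; apply: le_integral_ge0 => x _;
    [apply: erestrict_ge0|rewrite patchE; case: ifPn].
Qed.

Let integral_w u : (0 < u)%R ->
  \int[leb]_(t in `]0%R, u[) w t <= (lam^-1)%:E * w u.
Proof.
move=> u0; rewrite integral_expR// -EFinM lee_fin mulrC ler_wpM2l ?invr_ge0 ?(ltW lam0)//.
by rewrite lerBlDr lerDl expR_ge0.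
Qed.

(** Conservation along characteristics, integrated over the slab with the
    exponential weight: what is in the slab at time [t] leaves it later through
    [x = 1] or is produced by the source later, and exchanging the order of the
    two time integrals gains [1 / lam]. *)
Lemma slab_mass :
  \int[leb]_(t in I) (w t * \int[leb]_(x in J) f t x) <=
  (lam^-1)%:E * (c%:E * \int[leb]_(t in I) (w t * b t) +
                 \int[leb]_(t in I) (w t * \int[leb]_(x in J) s (t, x))).
Proof.
rewrite -integral_wk.
pose F := fun z : R * R => w z.1 * (if (z.1 < z.2)%R then k z.2 else 0).
have mF : measurable_fun setT F.
  apply: emeasurable_funM.
    by apply: measurableT_comp => //; exact: measurable_weight.
  apply: measurable_fun_ifT => //; first by apply: measurable_fun_ltr; mfun.
  by apply: measurableT_comp => //; mfun.
have F0 z : 0 <= F z by rewrite /F; case: ifP => _; rewrite ?mule0// mule_ge0.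
apply: (@le_trans _ _ (\int[leb]_(t in I) \int[leb]_(u in I) F (t, u))).
  apply: le_integral_ge0 => t It; first by rewrite mule_ge0// integral_ge0.
  rewrite /F/= ge0_integralZl//; last 2 first.
  - apply: measurable_funTS; apply: measurable_fun_ifT => //.
    by apply: measurable_fun_ltr; mfun.
  - by move=> u _; case: ifP => _.
  apply: lee_wpmul2l => //; apply: (le_trans (slice_mass It)).
  rewrite [leLHS]integral_mkcond [leRHS]integral_mkcond.
  apply: le_integral_ge0 => u _; first by apply: erestrict_ge0.
  rewrite !patchE; case: ifPn; last by case: ifPn => //; case: ifPn.
  rewrite !inE/= in_itv/= => /andP[tu uT].
  move: It; rewrite /I/= in_itv/= => /andP[t1 _].
  by rewrite mem_set/= ?in_itv/= ?uT ?(lt_trans t1 tu)// tu.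
rewrite (@tonelli_in _ _ _ _ R leb leb I I F)// -ge0_integralZl//; last 3 first.
- by apply: measurable_funTS; apply: emeasurable_funM => //; exact: measurable_weight.
- by move=> u _; rewrite mule_ge0.
- by rewrite lee_fin invr_ge0 ltW.
apply: le_integral_ge0 => u; first by move=> _; exact: integral_ge0.
rewrite /I/= in_itv/= => /andP[u0 uT].
rewrite muleA muleC; apply: (@le_trans _ _ (k u * \int[leb]_(t in `]0%R, u[) w t)).
  rewrite -ge0_integralZl//; last exact: measurable_funTS.
  rewrite [leLHS]integral_mkcond [leRHS]integral_mkcond.
  apply: le_integral_ge0 => t _; first by apply: erestrict_ge0.
  rewrite !patchE; case: ifPn => [|_]; last by case: ifPn => // _; rewrite mule_ge0.
  rewrite inE/= in_itv/= => /andP[t1 t2]; rewrite /F/=; case: ifPn => tu.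
    by rewrite mem_set/= ?in_itv/= ?t1// muleC.
  by rewrite mule0; case: ifPn => // _; rewrite mule_ge0.
by apply: lee_wpmul2l => //; exact: integral_w.
Qed.

(** The same on the face [x = 0], where no integration in time is left over to
    gain the factor [1 / lam]. *)
Lemma slab_outflux :
  c%:E * \int[leb]_(t in I) (w t * f t 0%R) <=
  c%:E * \int[leb]_(t in I) (w t * b t) +
         \int[leb]_(t in I) (w t * \int[leb]_(x in J) s (t, x)).
Proof.
pose F := fun z : R * R =>
  w z.1 * (if (z.1 < z.2)%R then sIJ (z.2, (c * (z.2 - z.1))%R) else 0).
have mF : measurable_fun setT F.
  apply: emeasurable_funM.
    by apply: measurableT_comp => //; exact: measurable_weight.
  apply: measurable_fun_ifT => //; first by apply: measurable_fun_ltr; mfun.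
  by apply: (measurableT_comp msIJ); mfun.
have F0 z : 0 <= F z by rewrite /F; case: ifP => _; rewrite ?mule0// mule_ge0.
have mwb : measurable_fun setT (fun t => w t * b t).
  by apply: emeasurable_funM => //; exact: measurable_weight.
pose G : R -> \bar R := (fun t => w t * b t) \_ I.
have mG : measurable_fun setT G.
  by apply/(measurable_restrictT _ _).1 => //; exact: measurable_funTS.
have G0 t : 0 <= G t by apply: erestrict_ge0 => u _; rewrite mule_ge0.
have c00 : 0 <= c%:E by rewrite lee_fin ltW.
have mGs : measurable_fun setT (fun t : R => G (t + c^-1)%R).
  by apply: measurableT_comp => //; mfun.
have mFi : measurable_fun setT (fun t : R => \int[leb]_(u in I) F (t, u)).
  exact: measurable_integral_param.
apply: (@le_trans _ _ (c%:E * (\int[leb]_(t in I) (G (t + c^-1)%R +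
     \int[leb]_(u in I) F (t, u))))).
  apply: lee_wpmul2l => //; apply: le_integral_ge0 => t It.
    by rewrite mule_ge0.
  move: (It); rewrite /I/= in_itv/= => /andP[t1 t2].
  apply: (@le_trans _ _ (w t * (bI (t + (1 - 0) / c)%R +
     \int[leb]_(u in `]t, T[) sIJ (u, (0 + c * (u - t))%R)))).
    by apply: lee_wpmul2l => //; apply: f_le; rewrite ?t1 ?t2// lexx ltr01.
  rewrite ge0_muleDr//; last exact: integral_ge0.
  rewrite subr0 mul1r; apply: leeD.
    rewrite /G /bI !patchE; case: ifPn; last by rewrite mule0.
    move=> _; apply: lee_wpmul2r => //; apply: weight_le; first exact: ltW.
    by rewrite lerDl invr_ge0 ltW.
  rewrite /F/= ge0_integralZl//; last 2 first.
  - apply: measurable_funTS; apply: measurable_fun_ifT => //.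
      by apply: measurable_fun_ltr; mfun.
    by apply: measurableT_comp => //; mfun.
  - by move=> u _; case: ifP => _.
  apply: lee_wpmul2l => //.
  rewrite [leLHS]integral_mkcond [leRHS]integral_mkcond.
  apply: le_integral_ge0 => u _; first by apply: erestrict_ge0.
  rewrite !patchE; case: ifPn; last by case: ifPn => //; case: ifPn.
  rewrite !inE/= in_itv/= => /andP[tu uT].
  by rewrite mem_set/= ?in_itv/= ?uT ?(lt_trans t1 tu)// tu add0r.
rewrite ge0_integralD//; last 3 first.
- exact: measurable_funTS.
- by move=> t _; exact: integral_ge0.
- exact: measurable_funTS.
rewrite ge0_muleDr//; try by apply: integral_ge0 => t _ //; exact: integral_ge0.
apply: leeD.
  apply: lee_wpmul2l => //; rewrite [leRHS]integral_mkcond -/G.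
  rewrite -(@integral_shift R c^-1 G)// [leLHS]integral_mkcond.
  apply: le_integral_ge0 => t _; first by apply: erestrict_ge0.
  by rewrite patchE; case: ifPn.
rewrite (@tonelli_in _ _ _ _ R leb leb I I F mI mI mF F0).
have mFj : measurable_fun I (fun u : R => \int[leb]_(t in I) F (t, u)).
  apply: measurable_funTS.
  apply: (@measurable_integral_param _ _ _ _ R leb _ mI (fun z => F (z.2, z.1))) => //.
  by apply: measurableT_comp => //; mfun.
have Fj0 u : I u -> 0 <= \int[leb]_(t in I) F (t, u) by move=> _; exact: integral_ge0.
rewrite -(ge0_integralZl leb mI mFj Fj0 c00).
apply: le_integral_ge0 => u Iu; first by rewrite mule_ge0// integral_ge0.
rewrite -/(sigma u) -(integral_sIJ Iu).
have msu : measurable_fun setT (fun x => sIJ (u, x)).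
  by apply: measurableT_comp => //; mfun.
rewrite (@integral_affine R (- c)%R (c * u)%R (fun x => sIJ (u, x)))//; last first.
  by rewrite oppr_eq0 lt0r_neq0.
rewrite normrN gtr0_norm// [leRHS]muleCA; apply: lee_wpmul2l => //.
rewrite -ge0_integralZl//; last by apply: measurableT_comp => //; mfun.
rewrite [leLHS]integral_mkcond; apply: le_integral_ge0 => t _.
  by apply: erestrict_ge0.
rewrite patchE; case: ifPn => [|_]; last by rewrite mule_ge0.
rewrite inE/= => It; rewrite /F/=; case: ifPn => tu; last by rewrite mule0 mule_ge0.
have -> : (- c * t + c * u = c * (u - t))%R by ring.
by apply: lee_wpmul2r => //; apply: weight_le; exact: ltW.
Qed.

End slab.

(** * Forward problem: estimates at every point *)

(** A bounded family that satisfies [F <= A + M / 2] as soon as it satisfies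
    [F <= M] is bounded by [2 * A]. *)
Lemma absorb_half (R : realType) (T : Type) (P : T -> Prop) (F : T -> R) (A : R) :
  0 <= A -> (exists M, forall z, P z -> F z <= M) ->
  (forall M, 0 <= M -> (forall z, P z -> F z <= M) ->
     forall z, P z -> F z <= A + M / 2) ->
  forall z, P z -> F z <= 2 * A.
Proof.
move=> A0 [M FM] improve z0 Pz0.
pose E := [set F z | z in [set z | P z]].
have supE : has_sup E.
  by split; [exists (F z0), z0|exists M => _ [z Pz <-]; exact: FM].
pose s := sup E.
have Fs z : P z -> F z <= s by move=> Pz; apply: ub_le_sup; [case: supE|exists z].
have [s0|s0] := leP s 0.
  by rewrite (le_trans (Fs _ Pz0))// (le_trans s0)// mulr_ge0.
have : s <= A + s / 2.
  by apply: ge_sup; [case: supE|move=> _ [z Pz <-]; apply: (improve s) => //; exact: ltW].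
by have := Fs _ Pz0; lra.
Qed.

(** No measurability is needed to bound an integral: the positive and the
    negative part are bounded separately. *)
Lemma normr_Rintegral_le d (T : measurableType d) (R : realType)
    (mu : {measure set T -> \bar R}) (D : set T) (F : T -> R) (g : T -> \bar R) :
  (forall x, D x -> (`|F x|%:E <= g x)%E) ->
  ((`|\int[mu]_(x in D) F x|)%:E <= \int[mu]_(x in D) g x)%E.
Proof.
move=> Fg.
set B := (\int[mu]_(x in D) g x)%E.
have B0 : (0 <= B)%E by apply: integral_ge0 => x /Fg; apply: le_trans; rewrite lee_fin.
rewrite /Rintegral integralE.
set a := (\int[mu]_(x in D) _)%E; set b := (\int[mu]_(x in D) _)%E.
have a0 : (0 <= a)%E by apply: integral_ge0 => x _; exact: funepos_ge0.
have b0 : (0 <= b)%E by apply: integral_ge0 => x _; exact: funeneg_ge0.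
have aB : (a <= B)%E.
  apply: le_integral_ge0 => x Dx; first exact: funepos_ge0.
  apply: le_trans (Fg _ Dx); rewrite funeposE -EFin_max lee_fin ge_max normr_ge0.
  by rewrite ler_norm.
have bB : (b <= B)%E.
  apply: le_integral_ge0 => x Dx; first exact: funeneg_ge0.
  apply: le_trans (Fg _ Dx); rewrite funenegE -EFinN -EFin_max lee_fin ge_max normr_ge0.
  by rewrite -normrN ler_norm.
move: B0 aB bB a0 b0; case: B => [B| |]//; last by move=> *; rewrite leey.
case: a => // a; case: b => // b /=; rewrite !lee_fin => *.
by rewrite ler_norml; lra.
Qed.

Section averages.
Context {R : realType}.
Local Notation leb := (@lebesgue_measure R).
Variable Om : set R.
Hypothesis mOm : measurable Om.
Hypothesis Om_gt0 : (0 < leb Om)%E.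
Hypothesis Om_lty : (leb Om < +oo)%E.

Lemma vol_gt0 : 0 < fine (leb Om).
Proof. by rewrite fine_gt0// Om_gt0. Qed.

Lemma volE : leb Om = (fine (leb Om))%:E.
Proof. by rewrite fineK// ge0_fin_numE. Qed.

(** The value at [mu = 0], where characteristics do not move, is irrelevant. *)
Lemma normr_avg_mu_le (F : R -> R) (B : R) : 0 <= B ->
  (forall mu, -1 <= mu <= 1 -> mu != 0 -> `|F mu| <= B) -> `|avg_mu F| <= B.
Proof.
move=> B0 FB; rewrite /avg_mu normrM gtr0_norm ?invr_gt0//.
suff : (`|\int[leb]_(mu in `[-1, 1]) F mu|%:E <= (2 * B)%:E)%E.
  by rewrite lee_fin; lra.
pose g (x : R) : \bar R := if x == 0 then +oo%E else B%:E.
apply: (@le_trans _ _ (\int[leb]_(mu in `[(-1)%R, 1%R]) g mu)%E).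
  apply: normr_Rintegral_le => x; rewrite /= in_itv/= => x1; rewrite /g.
  by case: ifPn => [_|x0]; [rewrite leey|rewrite lee_fin; exact: FB].
rewrite (@ae_eq_integral _ _ _ leb _ (cst B%:E))//.
- rewrite integral_cst//= lebesgue_measure_itv/= lte_fin gtrN// -EFinD -EFinM lee_fin.
  lra.
- apply: measurable_funTS; apply: measurable_fun_ifT => //.
  exact: measurable_fun_eqr.
- exists [set 0]; split => //; first exact: lebesgue_measure_set1.
  move=> x /= /not_implyP[_]; rewrite /g; case: ifPn => [/eqP//|_].
  by move=> /(_ erefl).
Qed.

Lemma normr_avg_om_le (F G : R -> R) : leb.-integrable Om (EFin \o G) ->
  (forall om, Om om -> `|F om| <= G om) -> `|avg_om Om F| <= avg_om Om G.
Proof.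
move=> iG FG; rewrite /avg_om normrM ger0_norm ?invr_ge0 ?(ltW vol_gt0)//.
rewrite ler_wpM2l ?invr_ge0 ?(ltW vol_gt0)// -lee_fin.
rewrite fineK; last exact: integrable_fin_num.
by apply: normr_Rintegral_le => om Oom; rewrite lee_fin FG.
Qed.

Lemma avg_om_ge0 (G : R -> R) : (forall om, Om om -> 0 <= G om) -> 0 <= avg_om Om G.
Proof.
by move=> G0; rewrite mulr_ge0 ?invr_ge0 ?(ltW vol_gt0)//; exact: Rintegral_ge0.
Qed.

Lemma normr_avg_mu_om_le (F : R -> R -> R) (G : R -> R) :
  leb.-integrable Om (EFin \o G) -> (forall om, Om om -> 0 <= G om) ->
  (forall mu om, -1 <= mu <= 1 -> mu != 0 -> Om om -> `|F mu om| <= G om) ->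
  `|avg_mu_om Om F| <= avg_om Om G.
Proof.
move=> iG G0 FG; apply: normr_avg_om_le => // om Oom.
by apply: normr_avg_mu_le => [|mu mu1 mu0]; [exact: G0|exact: FG].
Qed.

Lemma integrable_scale (a : R) (G : R -> R) : leb.-integrable Om (EFin \o G) ->
  leb.-integrable Om (EFin \o (fun om => a * G om)).
Proof.
move=> iG; rewrite (_ : EFin \o _ = (fun om => a%:E * (G om)%:E)%E).
  exact: integrableZl.
by apply/funext => om; rewrite /= EFinM.
Qed.

Lemma avg_omZ (G : R -> R) (a : R) : leb.-integrable Om (EFin \o G) ->
  avg_om Om (fun om => a * G om) = a * avg_om Om G.
Proof. by move=> iG; rewrite /avg_om RintegralZl// mulrCA. Qed.

Lemma avg_omD (F G : R -> R) :
  leb.-integrable Om (EFin \o F) -> leb.-integrable Om (EFin \o G) ->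
  avg_om Om (fun om => F om + G om) = avg_om Om F + avg_om Om G.
Proof. by move=> iF iG; rewrite /avg_om RintegralD// mulrDr. Qed.

Lemma avg_om_cst (a : R) : avg_om Om (fun=> a) = a.
Proof.
by rewrite /avg_om Rintegral_cst// mulrCA mulVf ?mulr1// lt0r_neq0// vol_gt0.
Qed.

Lemma integrable_cst (a : R) : leb.-integrable Om (EFin \o (fun=> a)).
Proof.
apply/integrableP; split; first exact/measurable_EFinP.
by rewrite integral_cst//= volE ltry.
Qed.

End averages.

(** Increment along a characteristic whose source is bounded by
    [K exp (lam s) + r]. *)
Lemma transport_increment (R : realType) (Tf : R) (Om : set R) (v : R -> R)
    (f S : R -> R -> R -> R -> R) (lam K r t1 t2 x1 x2 mu om : R) :
  transport_eq Tf Om v f S -> 0 < lam -> 0 <= K -> 0 <= r ->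
  0 <= t1 -> t1 < t2 -> t2 <= Tf -> -1 <= mu <= 1 -> Om om ->
  x2 = x1 + mu * v om * (t2 - t1) ->
  (forall s, t1 < s < t2 -> 0 < x1 + mu * v om * (s - t1) < 1) ->
  (forall s x, t1 < s < t2 -> 0 < x < 1 ->
     `|S s x mu om| <= K * expR (lam * s) + r) ->
  `|f t2 x2 mu om - f t1 x1 mu om| <=
    (K * expR (lam * t2) / lam + r * t2) - (K * expR (lam * t1) / lam + r * t1).
Proof.
move=> tr lam0 K0 r0 t1_0 t12 t2T mu1 Oom -> Xin SK.
have [_ ->] := tr t1 t2 x1 mu om t1_0 t12 t2T mu1 Oom Xin.
rewrite -lee_fin.
apply: (le_trans (@normr_Rintegral_le _ _ R lebesgue_measure _ _
  (fun s => (K * expR (lam * s))%:E + r%:E)%E _)).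
  move=> s; rewrite /= in_itv/= => st.
  by rewrite -EFinD lee_fin; apply: SK => //; exact: Xin.
have mexp : measurable_fun setT (fun s : R => (expR (lam * s))%:E).
  apply/measurable_EFinP; apply: measurableT_comp; first exact: measurable_expR.
  exact: measurable_funM.
have mKexp : measurable_fun setT (fun s : R => (K * expR (lam * s))%:E).
  under eq_fun do rewrite EFinM; exact: measurable_funeM.
rewrite ge0_integralD//; last 2 first.
- by move=> s _; rewrite lee_fin mulr_ge0// expR_ge0.
- exact: measurable_funTS.
under eq_integral do rewrite EFinM /=.
rewrite ge0_integralZl//; last exact: measurable_funTS.
rewrite integral_expR// integral_cst//= lebesgue_measure_itv/= lte_fin t12.
rewrite -EFinB -!EFinM -EFinD lee_fin le_eqVlt; apply/orP; left; apply/eqP.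
by field; exact: lt0r_neq0.
Qed.

Section forward_estimate.
Context {R : realType}.
Local Notation leb := (@lebesgue_measure R).
Variables (Tf : R) (Om : set R) (v : R -> R).
Hypothesis Tf0 : 0 < Tf.
Hypothesis v_gt0 : forall om, Om om -> 0 < v om.

Section path.
Variables (f S : R -> R -> R -> R -> R).
Hypothesis f_eq : transport_eq Tf Om v f S.
Hypothesis f_init : forall x mu om, 0 <= x <= 1 -> -1 <= mu <= 1 -> Om om ->
  f 0 x mu om = 0.
Hypothesis f_refl : forall t mu om, 0 <= t <= Tf -> 0 < mu <= 1 -> Om om ->
  f t 1 (- mu) om = f t 1 mu om.

Variables (mu om : R).
Hypotheses (mu_gt0 : 0 < mu) (mu_le1 : mu <= 1) (Oom : Om om).
Variables (lam K r B : R).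
Hypotheses (lam0 : 0 < lam) (K0 : 0 <= K) (r0 : 0 <= r) (B0 : 0 <= B).
Hypothesis f_in : forall t, 0 < t <= Tf -> `|f t 0 mu om| <= B.
Hypothesis S_le : forall s x nu, 0 < s < Tf -> 0 < x < 1 -> nu = mu \/ nu = - mu ->
  `|S s x nu om| <= K * expR (lam * s) + r.

Let c := mu * v om.
Let c0 : 0 < c. Proof. by rewrite mulr_gt0// v_gt0. Qed.
Let e t := K * expR (lam * t) / lam + r * t.
Let e0 t : 0 <= t -> 0 <= e t.
Proof.
by move=> t0; rewrite addr_ge0 ?mulr_ge0// ?invr_ge0 ?expR_ge0 ?(ltW lam0).
Qed.

Let path_incoming t x : 0 <= t <= Tf -> 0 <= x <= 1 -> `|f t x mu om| <= B + e t.
Proof.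
move=> /andP[t0 tT] /andP[x0 x1].
have mu1 : -1 <= mu <= 1 by move: mu_gt0 mu_le1; lra.
have [->|/eqP tn0] := eqVneq t 0; first by rewrite f_init ?x0// normr0 addr_ge0// e0.
have {tn0}tp : 0 < t by rewrite lt_neqAle eq_sym; apply/andP; split => //; apply/eqP.
have [->|xn0] := eqVneq x 0.
  by apply: (le_trans (f_in _)); [rewrite tp|rewrite lerDl e0].
have xp : 0 < x by rewrite lt_neqAle eq_sym xn0.
have ct : 0 < c * t by rewrite mulr_gt0.
have [h|h] := leP (c * t) x.
- have := @transport_increment R Tf Om v f S lam K r 0 t (x - c * t) x mu om
    f_eq lam0 K0 r0 (lexx _) tp tT mu1 Oom.
  rewrite (f_init (x := x - c * t))//; last by lra.
  move=> H; rewrite -[f _ _ _ _]subr0; apply: (le_trans (H _ _ _)).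
  + by rewrite /c; ring.
  + move=> s /andP[s0 st]; have : 0 < c * s < c * t by rewrite mulr_gt0//= ltr_pM2l.
    by rewrite -/c subr0; lra.
  + by move=> s y /andP[s0 st] y01; apply: S_le => //; [rewrite s0 (lt_le_trans st)|left].
  + have := e0 (lexx 0); rewrite /e; move: B0; lra.
- pose t1 := t - x / c.
  have t1p : 0 < t1 by rewrite /t1 subr_gt0 ltr_pdivrMr// mulrC.
  have t1t : t1 < t by rewrite /t1 ltrBlDr ltrDl divr_gt0.
  have ct1 : c * t1 = c * t - x by rewrite /t1 mulrBr mulrCA divff ?mulr1// lt0r_neq0.
  clearbody t1.
  have := @transport_increment R Tf Om v f S lam K r t1 t 0 x mu om
    f_eq lam0 K0 r0 (ltW t1p) t1t tT mu1 Oom.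
  move=> H; have {}H : `|f t x mu om - f t1 0 mu om| <= e t - e t1.
    apply: H.
    + by rewrite -/c mulrBr ct1; ring.
    + move=> s /andP[s0 st]; have : c * t1 < c * s < c * t by rewrite !ltr_pM2l// s0.
      by rewrite -/c mulrBr ct1; lra.
    + by move=> s y /andP[s0 st] y01; apply: S_le => //; [rewrite (lt_trans t1p)// (lt_le_trans st)|left].
  have := f_in (t := t1); rewrite t1p (le_trans (ltW t1t))// => /(_ isT).
  have := e0 (ltW t1p); move: H; rewrite !ler_norml; lra.
Qed.

(** A characteristic traced back from a point with [mu < 0] reaches the face
    [x = 1], is reflected there, and then reaches the face [x = 0], unless it
    meets the initial time before. *)
Lemma path_estimate t x nu : 0 <= t <= Tf -> 0 <= x <= 1 ->
  nu = mu \/ nu = - mu -> `|f t x nu om| <= B + (K * expR (lam * t) / lam + r * t).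
Proof.
move=> tT x01 [->|->]; first exact: path_incoming.
rewrite -/(e t); move: tT x01 => /andP[t0 tT] /andP[x0 x1].
have mu1 : -1 <= - mu <= 1 by move: mu_gt0 mu_le1; lra.
have [->|/eqP tn0] := eqVneq t 0; first by rewrite f_init ?x0// normr0 addr_ge0// e0.
have {tn0}tp : 0 < t by rewrite lt_neqAle eq_sym; apply/andP; split => //; apply/eqP.
have [->|xn1] := eqVneq x 1.
  by rewrite f_refl ?t0 ?mu_gt0//; apply: path_incoming; rewrite ?t0 ?tT ?ler01 ?lexx.
have xl : x < 1 by rewrite lt_neqAle xn1.
have ct : 0 < c * t by rewrite mulr_gt0.
have [h|h] := leP (c * t) (1 - x).
- have := @transport_increment R Tf Om v f S lam K r 0 t (x + c * t) x (- mu) om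
    f_eq lam0 K0 r0 (lexx _) tp tT mu1 Oom.
  rewrite (f_init (x := x + c * t))//; last by lra.
  move=> H; rewrite -[f _ _ _ _]subr0; apply: (le_trans (H _ _ _)).
  + by rewrite /c; ring.
  + move=> s /andP[s0 st]; have : 0 < c * s < c * t by rewrite mulr_gt0//= ltr_pM2l.
    by rewrite mulNr -/c subr0; lra.
  + by move=> s y /andP[s0 st] y01; apply: S_le => //; [rewrite s0 (lt_le_trans st)|right].
  + have := e0 (lexx 0); rewrite /e; move: B0; lra.
- pose t1 := t - (1 - x) / c.
  have t1p : 0 < t1 by rewrite /t1 subr_gt0 ltr_pdivrMr// mulrC.
  have t1t : t1 < t by rewrite /t1 ltrBlDr ltrDl divr_gt0// subr_gt0.
  have ct1 : c * t1 = c * t - (1 - x) by rewrite /t1 mulrBr mulrCA divff ?mulr1// lt0r_neq0.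
  clearbody t1.
  have := @transport_increment R Tf Om v f S lam K r t1 t 1 x (- mu) om
    f_eq lam0 K0 r0 (ltW t1p) t1t tT mu1 Oom.
  move=> H; have {}H : `|f t x (- mu) om - f t1 1 (- mu) om| <= e t - e t1.
    apply: H.
    + by rewrite mulNr -/c mulNr mulrBr ct1; ring.
    + move=> s /andP[s0 st]; have : c * t1 < c * s < c * t by rewrite !ltr_pM2l// s0.
      by rewrite mulNr -/c mulNr mulrBr ct1; lra.
    + by move=> s y /andP[s0 st] y01; apply: S_le => //; [rewrite (lt_trans t1p)// (lt_le_trans st)|right].
  move: H; rewrite f_refl ?mu_gt0 ?(ltW t1p) ?(le_trans (ltW t1t))// => H.
  have := @path_incoming t1 1; rewrite ?(ltW t1p) ?(le_trans (ltW t1t))// ler01 lexx => /(_ isT isT).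
  move: H; rewrite !ler_norml; lra.
Qed.

End path.

Hypothesis mOm : measurable Om.
Hypothesis Om_gt0 : (0 < leb Om)%E.
Hypothesis Om_lty : (leb Om < +oo)%E.

(** Stability of the forward problem, pointwise in [omega]: a bounded solution
    with inflow datum and exterior source bounded by [rho] is bounded by a
    multiple of [rho] plus its average.  With the weight [exp (- lam t)] and
    [lam] large, the solution at one pair of opposite directions absorbs its own
    contribution to the source, and then the mean absorbs its contribution. *)
Lemma forward_estimate (a k : R) : 0 <= a -> 0 <= k ->
  exists2 C, 0 < C &
  forall (f S : R -> R -> R -> R -> R) (rho : R -> R),
  transport_eq Tf Om v f S ->
  (forall x mu om, 0 <= x <= 1 -> -1 <= mu <= 1 -> Om om -> f 0 x mu om = 0) ->
  (forall t mu om, 0 <= t <= Tf -> 0 < mu <= 1 -> Om om ->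
    f t 1 (- mu) om = f t 1 mu om) ->
  (exists M, forall t x mu om, in_phase Tf Om t x mu om -> `|f t x mu om| <= M) ->
  (forall t mu om, 0 < t <= Tf -> 0 < mu <= 1 -> Om om -> `|f t 0 mu om| <= rho om) ->
  (forall t x mu om, 0 < t < Tf -> 0 < x < 1 -> -1 <= mu <= 1 -> mu != 0 -> Om om ->
    `|S t x mu om| <= a * `|f t x mu om| + k * `|avg_mu_om Om (f t x)| + rho om) ->
  leb.-integrable Om (EFin \o rho) -> (forall om, Om om -> 0 <= rho om) ->
  forall t x mu om, in_phase Tf Om t x mu om -> mu != 0 ->
    `|f t x mu om| <= C * (rho om + avg_om Om rho).
Proof.
have Tf_gt0 := Tf0.
move=> a0 k0; pose lam := 2 * a + 4 * k + 1.
have lam0 : 0 < lam by rewrite /lam; lra.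
have lam_a : a / lam <= 1 / 2 by rewrite ler_pdivrMr// /lam; lra.
have lam_k : 2 * k / lam <= 1 / 2 by rewrite ler_pdivrMr// /lam; lra.
clearbody lam.
have expp (s : R) : 0 < expR (lam * s) by exact: expR_gt0.
exists (2 * (1 + Tf) * expR (lam * Tf)).
  by rewrite mulr_gt0// mulr_gt0//; lra.
move=> f S rho f_eq f_init f_refl [M0 fM0] f_in S_le irho rho0.
have avg_rho0 : 0 <= avg_om Om rho by exact: avg_om_ge0.
pose G om := (1 + Tf) * rho om.
have G0 om : Om om -> 0 <= G om by move=> /rho0 ?; rewrite mulr_ge0//; lra.
(* weighted bound at one frequency, given a weighted bound of the average *)
have bound_om M : 0 <= M ->
    (forall z : R * R, 0 < z.1 < Tf /\ 0 < z.2 < 1 ->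
       expR (- (lam * z.1)) * `|avg_mu_om Om (f z.1 z.2)| <= M) ->
    forall t x mu om, in_phase Tf Om t x mu om -> mu != 0 ->
      expR (- (lam * t)) * `|f t x mu om| <= 2 * (G om + k * M / lam).
  move=> M_0 hM t x mu om [tT x01 mu1 Oom] mu0.
  pose m := `|mu|.
  have m0 : 0 < m by rewrite normr_gt0.
  have m1 : m <= 1 by rewrite ler_norml.
  have muE : mu = m \/ mu = - m.
    by rewrite /m; case: (ler0P mu) => ?; [right; rewrite opprK|left].
  have absE (y : R) : `|y| = m -> y != 0 /\ -1 <= y <= 1.
    by move=> ym; rewrite -normr_gt0 ym -ler_norml ym.
  have pm_abs nu : nu = m \/ nu = - m -> nu != 0 /\ -1 <= nu <= 1.
    by case=> ->; apply: absE; rewrite ?normrN gtr0_norm.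
  pose P (z : R * R * R) := [/\ 0 <= z.1.1 <= Tf, 0 <= z.1.2 <= 1 & z.2 = m \/ z.2 = - m].
  apply: (@absorb_half R (R * R * R) P
    (fun z => expR (- (lam * z.1.1)) * `|f z.1.1 z.1.2 z.2 om|) _ _ _ _ (t, x, mu)) => //.
  - by rewrite addr_ge0// ?G0// mulr_ge0// ?invr_ge0 ?(ltW lam0)// mulr_ge0.
  - exists M0 => -[[t' x'] nu] [/= t'T x'1 hnu].
    have [nu0 nu1] := pm_abs _ hnu.
    have fM : `|f t' x' nu om| <= M0 by apply: fM0.
    apply: le_trans fM; rewrite -[leRHS]mul1r ler_wpM2r// -[leRHS]expR0 ler_expR.
    by rewrite oppr_le0 mulr_ge0 ?(ltW lam0)//; case/andP: t'T.
  - move=> W W0 hW [[t' x'] nu] [/= t'T x'1 hnu].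
    have unweight (s y : R) : expR (- (lam * s)) * `|y| <= W -> `|y| <= W * expR (lam * s).
      by rewrite expRN mulrC ler_pdivrMr.
    have := @path_estimate f S f_eq f_init f_refl m om m0 m1 Oom lam
      (a * W + k * M) (rho om) (rho om) lam0 _ (rho0 _ Oom) (rho0 _ Oom) _ _ t' x' nu t'T x'1 hnu.
    move=> H; have {H} : `|f t' x' nu om| <= rho om +
       ((a * W + k * M) * expR (lam * t') / lam + rho om * t').
      apply: H.
      + by rewrite addr_ge0// mulr_ge0.
      + by move=> s sT; apply: f_in => //; rewrite m0.
      + move=> s y nu' sT y1 hnu'; have [nu'0 nu'1] := pm_abs _ hnu'.
        apply: (le_trans (S_le _ _ _ _ sT y1 nu'1 nu'0 Oom)).
        rewrite lerD2r mulrDl -!mulrA; apply: lerD; apply: ler_wpM2l => //.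
          apply: unweight; apply: (hW (s, y, nu')); split => //=.
            by case/andP: sT => /ltW -> /ltW ->.
          by case/andP: y1 => /ltW -> /ltW ->.
        have := hM (s, y) (conj sT y1); rewrite /= expRN mulrC ler_pdivrMr//.
    move=> H; rewrite expRN mulrC ler_pdivrMr//; apply: (le_trans H).
    have et : 1 <= expR (lam * t').
      by rewrite -expR0 ler_expR mulr_ge0 ?(ltW lam0)//; case/andP: t'T.
    have -> : (a * W + k * M) * expR (lam * t') / lam =
        (a / lam) * W * expR (lam * t') + k * M / lam * expR (lam * t').
      by field; exact: lt0r_neq0.
    have h1 : (a / lam) * W * expR (lam * t') <= W / 2 * expR (lam * t').
      by rewrite ler_pM2r// mulrC ler_wpM2l//; lra.
    have h2 : rho om + rho om * t' <= G om.
      by rewrite /G mulrDl mul1r lerD2l mulrC ler_wpM2r ?rho0//; case/andP: t'T.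
    have h3 : G om <= G om * expR (lam * t') by rewrite -[leLHS]mulr1 ler_wpM2l// G0.
    rewrite !mulrDl; lra.
have avgG : avg_om Om G = (1 + Tf) * avg_om Om rho by exact: avg_omZ.
have avgG0 : 0 <= avg_om Om G by rewrite avgG mulr_ge0//; lra.
have iG (b d : R) : leb.-integrable Om (EFin \o (fun om => b * G om + d)).
  have -> : EFin \o (fun om => b * G om + d) =
     ((fun om => (b * (1 + Tf))%:E * (rho om)%:E) \+ (EFin \o (fun=> d)))%E.
    by apply/funext => om /=; rewrite -EFinM -EFinD /G mulrA.
  apply: integrableD => //; first exact: integrableZl.
  exact: integrable_cst.
(* averaging this bound improves the bound [M] of the mean *)
have avg_bound M : 0 <= M ->
    (forall z : R * R, 0 < z.1 < Tf /\ 0 < z.2 < 1 ->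
       expR (- (lam * z.1)) * `|avg_mu_om Om (f z.1 z.2)| <= M) ->
    forall z : R * R, 0 < z.1 < Tf /\ 0 < z.2 < 1 ->
       expR (- (lam * z.1)) * `|avg_mu_om Om (f z.1 z.2)| <= 2 * avg_om Om G + M / 2.
  move=> M_0 hM [t x] [/= /andP[t0 tT] /andP[x0 x1]].
  rewrite expRN mulrC ler_pdivrMr//.
  have B0 : 0 <= 2 * (k * M / lam) by rewrite mulr_ge0// mulr_ge0// ?invr_ge0 ?(ltW lam0)// mulr_ge0.
  pose H om := expR (lam * t) * (2 * G om + 2 * (k * M / lam)).
  have HE : H = fun om => (expR (lam * t) * 2) * G om + expR (lam * t) * (2 * (k * M / lam)).
    by apply/funext => om; rewrite /H mulrDr mulrA.
  apply: (le_trans (@normr_avg_mu_om_le R Om mOm Om_gt0 Om_lty (f t x) H _ _ _)).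
  - by rewrite HE; exact: iG.
  - move=> om Oom; rewrite /H mulr_ge0 ?expR_ge0// addr_ge0// mulr_ge0// G0//.
  - move=> mu om mu1 mu0 Oom.
    have := bound_om M M_0 hM t x mu om; rewrite expRN mulrC ler_pdivrMr// /H => h.
    rewrite mulrC -mulrDr; apply: h => //.
    by split => //; rewrite ?ltW.
  - have -> : avg_om Om H = expR (lam * t) * (2 * avg_om Om G + 2 * (k * M / lam)).
      rewrite /H; transitivity (expR (lam * t) * avg_om Om (fun om => 2 * G om + 2 * (k * M / lam))).
        by apply: avg_omZ => //; exact: iG.
      congr (_ * _); rewrite avg_omD//; last exact: integrable_cst.
        by rewrite avg_omZ// ?avg_om_cst//; have := iG 1 0; under [X in integrable _ _ X]eq_fun do rewrite /= mul1r addr0.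
      by have := iG 2 0; under [X in integrable _ _ X]eq_fun do rewrite /= addr0.
    rewrite mulrC ler_pM2r// lerD2l.
    have -> : 2 * (k * M / lam) = (2 * k / lam) * M by field; exact: lt0r_neq0.
    by rewrite mulrC ler_wpM2l//; lra.
have avg_final : forall z : R * R, 0 < z.1 < Tf /\ 0 < z.2 < 1 ->
       expR (- (lam * z.1)) * `|avg_mu_om Om (f z.1 z.2)| <= 2 * (2 * avg_om Om G).
  apply: absorb_half => //; first by rewrite mulr_ge0.
  exists `|M0| => -[t x] [/= /andP[t0 tT] /andP[x0 x1]].
  apply: (@le_trans _ _ (1 * `|avg_mu_om Om (f t x)|)).
    rewrite ler_wpM2r// -expR0 ler_expR oppr_le0 mulr_ge0 ?(ltW lam0) ?ltW//.
  rewrite mul1r -[leRHS](avg_om_cst mOm Om_gt0 Om_lty).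
  apply: normr_avg_mu_om_le => //; first exact: integrable_cst.
  move=> mu om mu1 mu0 Oom; apply: le_trans (ler_norm _); apply: fM0.
  by split => //; rewrite ?ltW.
move=> t x mu om ph mu0.
have M0' : 0 <= 2 * (2 * avg_om Om G) by rewrite mulr_ge0// mulr_ge0.
have := bound_om _ M0' avg_final t x mu om ph mu0.
rewrite expRN mulrC ler_pdivrMr// => H.
case: ph => /andP[t0 tT] _ _ Oom.
apply: (le_trans H).
have -> : k * (2 * (2 * avg_om Om G)) / lam = 2 * (2 * k / lam) * avg_om Om G.
  by field; exact: lt0r_neq0.
have h1 : 2 * (2 * k / lam) * avg_om Om G <= avg_om Om G.
  by rewrite -[leRHS]mul1r ler_wpM2r//; lra.
apply: (@le_trans _ _ (2 * (G om + avg_om Om G) * expR (lam * t))).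
  by rewrite ler_pM2r//; lra.
have h2 : expR (lam * t) <= expR (lam * Tf) by rewrite ler_expR ler_pM2l.
apply: (@le_trans _ _ (2 * (G om + avg_om Om G) * expR (lam * Tf))).
  by rewrite ler_wpM2l// mulr_ge0// addr_ge0// G0.
by rewrite avgG /G le_eqVlt; apply/orP; left; apply/eqP; ring.
Qed.

End forward_estimate.

(** * Adjoint problem: integral estimates at almost every frequency *)

Lemma integral_mirror (R : realType) (g : R -> \bar R) :
  measurable_fun setT g -> (forall x, 0 <= g x)%E ->
  (\int[lebesgue_measure]_(x in `]0%R, 1%R[) g (1 - x)%R =
   \int[lebesgue_measure]_(x in `]0%R, 1%R[) g x)%E.
Proof.
move=> mg g0.
rewrite [LHS]integral_mkcond [RHS]integral_mkcond.
have mgJ : measurable_fun setT (g \_ (`]0, 1[ : set R)).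
  by apply/(measurable_restrictT _ _).1 => //; exact: measurable_funTS.
rewrite [RHS](@integral_affine R (-1) 1) ?oppr_eq0 ?oner_eq0//; last first.
  by move=> x; apply: erestrict_ge0.
rewrite normrN1 mul1e; apply: eq_integral => x _; rewrite !patchE mulN1r addrC.
congr (if _ then _ else _).
by apply/idP/idP; rewrite !inE/= !in_itv/= => /andP[? ?]; apply/andP; split; lra.
Qed.

Lemma integral_symmetric (R : realType) (g : R -> \bar R) :
  measurable_fun setT g -> (forall x, 0 <= g x)%E ->
  (\int[lebesgue_measure]_(x in `]0%R, 1%R]) (g x + g (- x)%R) =
   \int[lebesgue_measure]_(x in `[(-1)%R, 1%R]) g x)%E.
Proof.
move=> mg g0.
have mgN : measurable_fun setT (fun x : R => g (- x)).
  apply: (measurableT_comp mg); exact: oppr_measurable.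
rewrite ge0_integralD//; try exact: measurable_funTS.
have -> : (\int[lebesgue_measure]_(x in `]0%R, 1%R]) g (- x)%R =
           \int[lebesgue_measure]_(x in `[(-1)%R, 0%R[) g x)%E.
  rewrite [LHS]integral_mkcond [RHS]integral_mkcond.
  have mgJ : measurable_fun setT (g \_ (`[-1, 0[ : set R)).
    by apply/(measurable_restrictT _ _).1 => //; exact: measurable_funTS.
  rewrite [RHS](@integral_affine R (-1) 0) ?oppr_eq0 ?oner_eq0//; last first.
    by move=> x; apply: erestrict_ge0.
  rewrite normrN1 mul1e; apply: eq_integral => x _; rewrite !patchE mulN1r addr0.
  congr (if _ then _ else _).
  by apply/idP/idP; rewrite !inE/= !in_itv/= => /andP[? ?]; apply/andP; split; lra.
rewrite (@integral_itv_bndo_bndc R _ 0 g); last exact: measurable_funTS.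
rewrite addeC -ge0_integral_setU//.
- by rewrite -itv_bndbnd_setU// bnd_simp ?lerN10 ?ler01.
- exact: measurable_funTS.
- apply/disj_setPS => x [] /=; rewrite !in_itv/= => /andP[_ x0] /andP[x0' _].
  by move: x0'; rewrite ltNge x0.
Qed.

Section slab_integral.
Context {R : realType}.
Local Notation leb := (@lebesgue_measure R).
Local Open Scope ereal_scope.
Variables (Tf lam : R).

(** Integration over the open slab with an exponential weight in time. *)
Definition slab_int (h : R * R -> \bar R) : \bar R :=
  \int[leb]_(t in `]0%R, Tf[) (weight lam t * \int[leb]_(x in `]0%R, 1%R[) h (t, x)).

Lemma slab_int_ge0 h : (forall z, 0 <= h z) -> 0 <= slab_int h.
Proof. by move=> h0; apply: integral_ge0 => t _; rewrite mule_ge0// integral_ge0. Qed.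

Let minner h : measurable_fun setT h -> (forall z, 0 <= h z) ->
  measurable_fun setT (fun t : R => \int[leb]_(x in `]0%R, 1%R[) h (t, x)).
Proof. by move=> mh h0; apply: measurable_integral_param. Qed.

Let mweighted h : measurable_fun setT h -> (forall z, 0 <= h z) ->
  measurable_fun setT
    (fun t : R => weight lam t * \int[leb]_(x in `]0%R, 1%R[) h (t, x)).
Proof. by move=> mh h0; apply: emeasurable_funM; [exact: measurable_weight|exact: minner]. Qed.

Let msection (h : R * R -> \bar R) (t : R) : measurable_fun setT h ->
  measurable_fun setT (fun x => h (t, x)).
Proof. by move=> mh; apply: (measurableT_comp mh); mfun. Qed.

Lemma slab_intD h1 h2 : measurable_fun setT h1 -> (forall z, 0 <= h1 z) ->
  measurable_fun setT h2 -> (forall z, 0 <= h2 z) ->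
  slab_int (fun z => h1 z + h2 z) = slab_int h1 + slab_int h2.
Proof.
move=> mh1 h10 mh2 h20; rewrite /slab_int -ge0_integralD//; last 4 first.
- by move=> t _; rewrite mule_ge0// integral_ge0.
- by apply: measurable_funTS; exact: mweighted.
- by move=> t _; rewrite mule_ge0// integral_ge0.
- by apply: measurable_funTS; exact: mweighted.
apply: eq_integral => t _; rewrite -ge0_muleDr ?integral_ge0//; congr (_ * _).
by rewrite ge0_integralD//; apply: measurable_funTS; exact: msection.
Qed.

Lemma slab_intZ (a : R) h : (0 <= a)%R -> measurable_fun setT h ->
  (forall z, 0 <= h z) -> slab_int (fun z => a%:E * h z) = a%:E * slab_int h.
Proof.
move=> a0 mh h0; rewrite /slab_int -ge0_integralZl//; last 2 first.
- by apply: measurable_funTS; exact: mweighted.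
- by move=> t _; rewrite mule_ge0// integral_ge0.
apply: eq_integral => t _; rewrite muleCA; congr (_ * _).
by rewrite ge0_integralZl// ?lee_fin//; apply: measurable_funTS; exact: msection.
Qed.

Lemma measurable_slab_int d (T : measurableType d) (g : (R * R) * T -> \bar R) :
  measurable_fun setT g -> (forall z, 0 <= g z) ->
  measurable_fun setT (fun y => slab_int (fun z => g (z, y))).
Proof.
move=> mg g0; rewrite /slab_int.
apply: (@measurable_integral_param _ _ _ _ R leb _ _ (fun z : T * R =>
  weight lam z.2 * \int[leb]_(x in `]0%R, 1%R[) g ((z.2, x), z.1))) => //; last first.
  by move=> z; rewrite mule_ge0// integral_ge0.
apply: emeasurable_funM.
  by apply: (measurableT_comp (measurable_weight lam)); mfun.
apply: (@measurable_integral_param _ _ _ _ R leb _ _ (fun z : (T * R) * R =>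
  g ((z.1.2, z.2), z.1.1))) => //.
apply: (measurableT_comp mg); apply: measurable_fun_pair.
  by apply: measurable_fun_pair; [exact: measurableT_comp|mfun].
exact: measurableT_comp.
Qed.

Lemma slab_int_integral d (T : measurableType d)
    (m : {sigma_finite_measure set T -> \bar R}) (D : set T)
    (g : (R * R) * T -> \bar R) : measurable D ->
  measurable_fun setT g -> (forall z, 0 <= g z) ->
  slab_int (fun z => \int[m]_(y in D) g (z, y)) =
  \int[m]_(y in D) slab_int (fun z => g (z, y)).
Proof.
move=> mD mg g0; rewrite /slab_int.
have mg1 : measurable_fun setT (fun z : (R * T) * R => g ((z.1.1, z.2), z.1.2)).
  apply: (measurableT_comp mg); apply: measurable_fun_pair.
    by apply: measurable_fun_pair; [exact: measurableT_comp|mfun].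
  exact: measurableT_comp.
have mg2 : measurable_fun setT (fun z : R * T =>
    \int[leb]_(x in `]0%R, 1%R[) g ((z.1, x), z.2)).
  exact: (@measurable_integral_param _ _ _ _ R leb _ _ (fun z : (R * T) * R => g ((z.1.1, z.2), z.1.2))).
have mg3 : measurable_fun setT (fun z : R * T => weight lam z.1 *
    \int[leb]_(x in `]0%R, 1%R[) g ((z.1, x), z.2)).
  apply: emeasurable_funM => //.
  by apply: (measurableT_comp (measurable_weight lam)); mfun.
transitivity (\int[leb]_(t in `]0%R, Tf[) \int[m]_(y in D)
    (weight lam t * \int[leb]_(x in `]0%R, 1%R[) g ((t, x), y))).
  apply: eq_integral => t _.
  rewrite ge0_integralZl//; last 2 first.
  - apply: measurable_funTS.
    exact: (measurable_fun_pair2 t mg2).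
  - by move=> y _; exact: integral_ge0.
  congr (_ * _).
  apply: (@tonelli_in _ _ _ _ R leb m _ _ (fun z : R * T => g ((t, z.1), z.2))) => //.
  apply: (measurableT_comp mg); apply: measurable_fun_pair.
    by apply: measurable_fun_pair; mfun.
  by mfun.
apply: (@tonelli_in _ _ _ _ R leb m _ _ (fun z : R * T => weight lam z.1 *
    \int[leb]_(x in `]0%R, 1%R[) g ((z.1, x), z.2))) => //.
by move=> z; rewrite mule_ge0// integral_ge0.
Qed.

Lemma slab_int_mirror h : measurable_fun setT h -> (forall z, 0 <= h z) ->
  slab_int (fun z => h (z.1, 1 - z.2)%R) = slab_int h.
Proof.
move=> mh h0; apply: eq_integral => t _ /=; congr (_ * _).
by rewrite (@integral_mirror R (fun x => h (t, x)))//; exact: msection.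
Qed.

Lemma integral_weight_le (B : R) : (0 < Tf)%R -> (0 <= B)%R -> (0 < lam)%R ->
  \int[leb]_(t in `]0%R, Tf[) (weight lam t * B%:E) <= (B * (Tf * expR (lam * Tf)))%:E.
Proof.
move=> Tf0 B0 lam0.
apply: (@le_trans _ _ (\int[leb]_(t in `]0%R, Tf[) (expR (lam * Tf) * B)%:E)).
  apply: le_integral_ge0 => t; first by rewrite mule_ge0// lee_fin.
  rewrite /= in_itv/= => /andP[t0 tT]; rewrite EFinM; apply: lee_wpmul2r.
    by rewrite lee_fin.
  by apply: weight_le; exact: ltW.
rewrite integral_cst//= lebesgue_measure_itv/= lte_fin Tf0 -EFinD -EFinM lee_fin.
by rewrite le_eqVlt; apply/orP; left; apply/eqP; ring.
Qed.

End slab_integral.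

Section adjoint_char.
Context {R : realType}.
Local Notation leb := (@lebesgue_measure R).
Variables (Tf : R) (Om : set R) (v : R -> R) (f S : R -> R -> R -> R -> R).
Hypothesis f_eq : transport_eq Tf Om v f S.
Hypothesis f_final : forall x mu om, 0 <= x <= 1 -> -1 <= mu <= 1 -> Om om ->
  f Tf x mu om = 0.
Variables (mu om : R).
Hypotheses (mu_gt0 : 0 < mu) (mu_le1 : mu <= 1) (Oom : Om om) (v_gt0 : 0 < v om).
Let c := mu * v om.
Let c0 : 0 < c. Proof. by rewrite mulr_gt0. Qed.

(** The characteristics of velocity [mu] and of velocity [- mu] are treated
    together, in the coordinate that increases in time along them. *)
Variable fwd : bool.
Let nu := if fwd then mu else - mu.
Let pos y : R := if fwd then y else 1 - y.

Variables (s : R * R -> \bar R) (e : R -> \bar R).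
Hypotheses (s0 : forall z, (0 <= s z)%E) (e0 : forall t, (0 <= e t)%E).
Hypothesis S_le : forall u y, 0 < u < Tf -> 0 < y < 1 ->
  (`|S u (pos y) nu om|%:E <= s (u, y))%E.
Hypothesis e_le : forall u, 0 < u < Tf -> (`|f u (pos 1) nu om|%:E <= e u)%E.

(** The solution at [(t, x)] is bounded by its value where the characteristic
    leaves the slab, or by its final value zero, plus the source collected on the
    way. *)
Lemma adjoint_char t x : 0 < t < Tf -> 0 <= x < 1 ->
  (`|f t (pos x) nu om|%:E <= (e \_ `]0%R, Tf[) (t + (1 - x) / c)%R +
     \int[leb]_(u in `]t, Tf[)
        (s \_ (`]0%R, Tf[ `*` `]0%R, 1%R[)) (u, (x + c * (u - t))%R))%E.
Proof.
move=> /andP[t0 tT] /andP[x0 x1].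
have nu1 : -1 <= nu <= 1 by rewrite /nu; move: mu_gt0 mu_le1; case: fwd; lra.
have posE u : pos x + nu * v om * (u - t) = pos (x + c * (u - t)).
  by rewrite /pos /nu /c; case: fwd; ring.
have pos01 y : 0 <= y <= 1 -> 0 <= pos y <= 1 by rewrite /pos; case: fwd; lra.
have pos01' y : 0 < y < 1 -> 0 < pos y < 1 by rewrite /pos; case: fwd; lra.
have incr t2 : t < t2 -> t2 <= Tf -> c * (t2 - t) <= 1 - x ->
  (`|f t2 (pos (x + c * (t2 - t))) nu om - f t (pos x) nu om|%:E <=
   \int[leb]_(u in `]t, Tf[)
      (s \_ (`]0%R, Tf[ `*` `]0%R, 1%R[)) (u, (x + c * (u - t))%R))%E.
  move=> t12 t2T ct2.
  have inside u : t < u < t2 -> 0 < x + c * (u - t) < 1.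
    move=> /andP[tu ut].
    have : 0 < c * (u - t) < c * (t2 - t).
      by rewrite mulr_gt0// ?subr_gt0// ltr_pM2l// ltrD2r.
    lra.
  have [|_ eq2] := @f_eq t t2 (pos x) nu om (ltW t0) t12 t2T nu1 Oom.
    by move=> u tu; rewrite posE; apply: pos01'; exact: inside.
  rewrite -posE eq2.
  apply: (le_trans (@normr_Rintegral_le _ _ R leb _ _
    (fun u => s (u, x + c * (u - t))%R) _)).
    move=> u; rewrite /= in_itv/= => tu; rewrite posE; apply: S_le; last exact: inside.
    by case/andP: tu => tu ut; rewrite (lt_trans t0 tu) (lt_le_trans ut).
  rewrite [leLHS]integral_mkcond [leRHS]integral_mkcond.
  apply: le_integral_ge0 => u _; first by apply: erestrict_ge0.
  rewrite !patchE; case: ifPn => [|_]; last by case: ifPn => // _; case: ifPn.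
  rewrite inE/= in_itv/= => /andP[tu ut].
  rewrite mem_set/= ?in_itv/= ?tu ?(lt_le_trans ut)// mem_set//=; split=> /=.
    by rewrite in_itv/= (lt_trans t0 tu) (lt_le_trans ut).
  by rewrite in_itv/= inside// tu.
have I0 : (0 <= \int[leb]_(u in `]t, Tf[)
      (s \_ (`]0%R, Tf[ `*` `]0%R, 1%R[)) (u, (x + c * (u - t))%R))%E.
  by apply: integral_ge0 => u _; apply: erestrict_ge0.
have eI0 y : (0 <= (e \_ (`]0%R, Tf[ : set R)) y)%E by apply: erestrict_ge0.
have [te_ge|te_lt] := leP Tf (t + (1 - x) / c).
- have cT : c * (Tf - t) <= 1 - x.
    by rewrite mulrC -ler_pdivlMr//; move: te_ge; lra.
  have := incr Tf tT (lexx _) cT.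
  rewrite f_final//; last first.
    apply: pos01; have : 0 <= c * (Tf - t) by rewrite mulr_ge0 ?(ltW c0)// subr_ge0 ltW.
    by move: cT; lra.
  rewrite sub0r normrN => h; apply: (le_trans h); rewrite -[leLHS]add0e.
  exact: leeD.
- set te := t + (1 - x) / c in te_lt *.
  have tte : t < te by rewrite /te ltrDl divr_gt0// subr_gt0.
  have cte : c * (te - t) = 1 - x.
    by rewrite /te addrAC subrr add0r mulrCA divff ?mulr1// lt0r_neq0.
  have := incr te tte (ltW te_lt); rewrite cte lexx => /(_ isT).
  have -> : x + (1 - x) = 1 by ring.
  have te01 : 0 < te < Tf by rewrite (lt_trans t0 tte).
  have h := e_le te01.
  rewrite patchE mem_set/=; last by rewrite in_itv/=.
  set A := (\int[leb]_(_ in _) _)%E => hA.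
  apply: (@le_trans _ _ (`|f te (pos 1) nu om|%:E +
      `|f te (pos 1) nu om - f t (pos x) nu om|%:E)%E); last exact: leeD.
  rewrite -EFinD lee_fin.
  have := ler_normB (f te (pos 1) nu om) (f te (pos 1) nu om - f t (pos x) nu om).
  by rewrite subKr.
Qed.

End adjoint_char.

Section modulus.
Context {R : realType}.
Local Notation leb := (@lebesgue_measure R).
Variables (Tf : R) (Om : set R).
Hypothesis mOm : measurable Om.

Lemma measurable_phase : measurable (phase Tf Om).
Proof.
rewrite (_ : phase Tf Om = (`[0, Tf] `*` `[0, 1]) `*` (`[-1, 1] `*` Om)).
  by apply: measurableX; apply: measurableX.
apply/seteqP; split => -[[t x] [m om]] /=; rewrite /phase/= /in_phase.
  by case=> *; split; split; rewrite /= ?in_itv.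
by case=> -[/= + +] [/= + +]; rewrite !in_itv/=.
Qed.

(** The modulus of a phase-space function, extended by zero. *)
Definition modulus (f : R -> R -> R -> R -> R) : (R * R) * (R * R) -> \bar R :=
  (fun z => `|uncurry4 f z|%:E) \_ (phase Tf Om).

Lemma modulus_ge0 f z : (0 <= modulus f z)%E.
Proof. by apply: erestrict_ge0. Qed.

Lemma modulusE f t x m om : in_phase Tf Om t x m om ->
  modulus f ((t, x), (m, om)) = `|f t x m om|%:E.
Proof. by move=> h; rewrite /modulus patchE mem_set. Qed.

Lemma measurable_modulus f : measurable_fun (phase Tf Om) (uncurry4 f) ->
  measurable_fun setT (modulus f).
Proof.
move=> mf; apply/(measurable_restrictT _ _).1; first exact: measurable_phase.
by apply/measurable_EFinP; apply: measurableT_comp => //; exact: measurable_phase.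
Qed.

End modulus.
#[global] Hint Extern 0 (is_true (@Order.le _ _ _ (modulus _ _ _ _))) => exact: modulus_ge0 : core.

Section mass.
Context {R : realType}.
Local Notation leb := (@lebesgue_measure R).
Local Open Scope ereal_scope.
Variables (Tf lam : R).
Implicit Types q r s : (R * R) * (R * R) -> \bar R.

(** Weighted integral over [t], [x], [mu], at a given frequency. *)
Definition mass q (om : R) : \bar R :=
  \int[leb]_(mu in `[(-1)%R, 1%R]) slab_int Tf lam (fun z => q (z, (mu, om))).

(** Weighted outgoing flux through the face [x = 0], at a given frequency. *)
Definition flux (v : R -> R) q (om : R) : \bar R :=
  \int[leb]_(mu in `]0%R, 1%R]) ((mu * v om)%:E *
     \int[leb]_(t in `]0%R, Tf[) (weight lam t * q ((t, 0%R), (mu, om)))).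

Section measurable_slice.
Variable q : (R * R) * (R * R) -> \bar R.
Hypotheses (mq : measurable_fun setT q) (q0 : forall z, 0 <= q z).

Lemma measurable_slice (y : R * R) : measurable_fun setT (fun z => q (z, y)).
Proof. exact: measurable_fun_pair1. Qed.

Lemma measurable_slab_slice (om : R) :
  measurable_fun setT (fun m : R => slab_int Tf lam (fun z => q (z, (m, om)))).
Proof.
apply: (@measurable_slab_int R Tf lam _ _ (fun z : (R * R) * R => q (z.1, (z.2, om)))) => //.
by apply: (measurableT_comp mq); mfun.
Qed.

Lemma measurable_mass : measurable_fun setT (mass q).
Proof.
apply: (@measurable_integral_param _ _ _ _ R leb _ _ (fun z : R * R =>
  slab_int Tf lam (fun y => q (y, (z.2, z.1))))) => //; last first.
  by move=> z; exact: slab_int_ge0.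
apply: (@measurable_slab_int R Tf lam _ _ (fun z : (R * R) * (R * R) =>
  q (z.1, (z.2.2, z.2.1)))) => //.
apply: (measurableT_comp mq); apply: measurable_fun_pair; first by mfun.
by apply: measurable_fun_pair; apply: measurableT_comp.
Qed.

Lemma mass_ge0 (om : R) : 0 <= mass q om.
Proof. by apply: integral_ge0 => m _; exact: slab_int_ge0. Qed.

End measurable_slice.

Lemma massD q r om : measurable_fun setT q -> (forall z, 0 <= q z) ->
  measurable_fun setT r -> (forall z, 0 <= r z) ->
  mass (fun z => q z + r z) om = mass q om + mass r om.
Proof.
move=> mq q0 mr r0; rewrite /mass -ge0_integralD//; last 4 first.
- by move=> m _; exact: slab_int_ge0.
- by apply: measurable_funTS; exact: measurable_slab_slice.
- by move=> m _; exact: slab_int_ge0.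
- by apply: measurable_funTS; exact: measurable_slab_slice.
by apply: eq_integral => m _; rewrite slab_intD//; exact: measurable_slice.
Qed.

Lemma massZ (a : R) q om : (0 <= a)%R -> measurable_fun setT q ->
  (forall z, 0 <= q z) -> mass (fun z => a%:E * q z) om = a%:E * mass q om.
Proof.
move=> a0 mq q0; rewrite /mass -ge0_integralZl//; last 2 first.
- by apply: measurable_funTS; exact: measurable_slab_slice.
- by move=> m _; exact: slab_int_ge0.
by apply: eq_integral => m _; rewrite slab_intZ//; exact: measurable_slice.
Qed.

(** Total over directions and frequencies, as a function of [t] and [x]. *)
Definition angular_total (Om : set R) q (y : R * R) : \bar R :=
  \int[leb]_(om in Om) \int[leb]_(m in `[(-1)%R, 1%R]) q (y, (m, om)).

Variable Om : set R.
Hypothesis mOm : measurable Om.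

Lemma angular_total_ge0 q y : (forall z, 0 <= q z) -> 0 <= angular_total Om q y.
Proof. by move=> q0; apply: integral_ge0 => om _; exact: integral_ge0. Qed.

Let minner q : measurable_fun setT q -> (forall z, 0 <= q z) ->
  measurable_fun setT (fun z : (R * R) * R =>
    \int[leb]_(m in `[(-1)%R, 1%R]) q (z.1, (m, z.2))).
Proof.
move=> mq q0; apply: (@measurable_integral_param _ _ _ _ R leb _ _
  (fun z : ((R * R) * R) * R => q (z.1.1, (z.2, z.1.2)))) => //.
apply: (measurableT_comp mq); apply: measurable_fun_pair; first exact: measurableT_comp.
by apply: measurable_fun_pair; [mfun|exact: measurableT_comp].
Qed.

Lemma measurable_angular_total q : measurable_fun setT q -> (forall z, 0 <= q z) ->
  measurable_fun setT (angular_total Om q).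
Proof.
move=> mq q0; apply: (@measurable_integral_param _ _ _ _ R leb _ mOm
  (fun z : (R * R) * R => \int[leb]_(m in `[(-1)%R, 1%R]) q (z.1, (m, z.2)))).
  exact: minner.
by move=> z; exact: integral_ge0.
Qed.

Lemma slab_int_angular_total q : measurable_fun setT q -> (forall z, 0 <= q z) ->
  slab_int Tf lam (angular_total Om q) = \int[leb]_(om in Om) mass q om.
Proof.
move=> mq q0.
apply: (etrans (@slab_int_integral R Tf lam _ _ leb Om (fun z : (R * R) * R =>
  \int[leb]_(m in `[(-1)%R, 1%R]) q (z.1, (m, z.2))) mOm (minner mq q0) _)).
  by move=> z; exact: integral_ge0.
apply: eq_integral => om _.
apply: (@slab_int_integral R Tf lam _ _ leb _ (fun z : (R * R) * R => q (z.1, (z.2, om)))) => //.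
by apply: (measurableT_comp mq); mfun.
Qed.

Lemma mass_angular_total q om : measurable_fun setT q -> (forall z, 0 <= q z) ->
  mass (fun z => angular_total Om q z.1) om = 2%:E * \int[leb]_(om in Om) mass q om.
Proof.
move=> mq q0; rewrite -slab_int_angular_total// /mass.
rewrite (eq_integral (cst (slab_int Tf lam (angular_total Om q))))// integral_cst//= muleC.
rewrite lebesgue_measure_itv/= lte_fin gtrN//; congr (_ * _).
by rewrite -EFinD; congr EFin; ring.
Qed.

End mass.

(** From one direction to the integral over all directions. *)
Lemma integrate_directions (R : realType) (Q Sg F : R -> \bar R) (a X : R) :
  measurable_fun setT Q -> (forall m, 0 <= Q m)%E ->
  measurable_fun setT Sg -> (forall m, 0 <= Sg m)%E ->
  (forall m, 0 < m -> m <= 1 -> (0 <= F m)%E) -> 0 <= a -> 0 <= X ->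
  (forall m, 0 < m -> m <= 1 ->
     (Q m + Q (- m)%R <= a%:E * (X%:E + (Sg m + Sg (- m)%R)) /\
      F m <= X%:E + (Sg m + Sg (- m)%R))%E) ->
  (\int[lebesgue_measure]_(m in `[(-1)%R, 1%R]) Q m <=
      a%:E * (X%:E + \int[lebesgue_measure]_(m in `[(-1)%R, 1%R]) Sg m) /\
   \int[lebesgue_measure]_(m in `]0%R, 1%R]) F m <=
      X%:E + \int[lebesgue_measure]_(m in `[(-1)%R, 1%R]) Sg m)%E.
Proof.
move=> mQ Q0 mS S0 F0 a0 X0 both.
have mSN : measurable_fun setT (fun m : R => Sg (- m)).
  by apply: (measurableT_comp mS); exact: oppr_measurable.
have mSS : measurable_fun setT (fun m : R => Sg m + Sg (- m)%R)%E.
  exact: emeasurable_funD.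
have SS0 (m : R) : (0 <= Sg m + Sg (- m)%R)%E by exact: adde_ge0.
have XE : (\int[lebesgue_measure]_(m in `]0%R, 1%R]) (X%:E + (Sg m + Sg (- m)%R)) =
  X%:E + \int[lebesgue_measure]_(m in `[(-1)%R, 1%R]) Sg m)%E.
  rewrite ge0_integralD//; last exact: measurable_funTS.
  rewrite integral_cst//= lebesgue_measure_itv/= lte_fin ltr01 -EFinD subr0 mule1.
  by rewrite integral_symmetric.
rewrite -XE; split.
  rewrite -ge0_integralZl//; last 2 first.
  - by apply: measurable_funTS; exact: emeasurable_funD.
  - by move=> m _; apply: adde_ge0; rewrite ?lee_fin.
  rewrite -integral_symmetric//; apply: le_integral_ge0 => m.
    by move=> _; exact: adde_ge0.
  by rewrite /= in_itv/= => /andP[m0 m1]; have [] := both m m0 m1.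
apply: le_integral_ge0 => m; rewrite /= in_itv/= => /andP[m0 m1]; first exact: F0.
by have [] := both m m0 m1.
Qed.

(** Elimination of the trace [F1] on the reflecting face. *)
Lemma combine_paths (R : realType) (a X : R) (Qp Qm Sp Sm F0 F1 : \bar R) :
  0 <= a -> 0 <= X -> (0 <= Sp)%E -> (0 <= Sm)%E ->
  (Qm <= a%:E * (X%:E + Sm))%E -> (F1 <= X%:E + Sm)%E ->
  (Qp <= a%:E * (F1 + Sp))%E -> (F0 <= F1 + Sp)%E ->
  (Qp + Qm <= (2 * a)%:E * (X%:E + (Sp + Sm)) /\ F0 <= X%:E + (Sp + Sm))%E.
Proof.
move=> a0 X0 Sp0 Sm0 Qm_le F1_le Qp_le F0_le.
have aE0 : (0 <= a%:E)%E by rewrite lee_fin.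
have sum : (F1 + Sp <= X%:E + (Sp + Sm))%E.
  by rewrite [leRHS]addeCA [leRHS]addeC; apply: leeD.
split; last exact: le_trans sum.
rewrite (_ : 2 * a = a + a)%R; last by ring.
rewrite EFinD ge0_muleDl//; apply: leeD.
  by apply: (le_trans Qp_le); exact: lee_wpmul2l.
apply: (le_trans Qm_le); apply: lee_wpmul2l => //.
by apply: leeD => //; exact: leeDr.
Qed.

Section adjoint_estimate.
Context {R : realType}.
Local Notation leb := (@lebesgue_measure R).
Variables (Tf : R) (Om : set R) (v : R -> R).
Hypothesis Tf0 : 0 < Tf.
Hypothesis mOm : measurable Om.
Hypothesis Om_lty : (leb Om < +oo)%E.
Hypothesis v_gt0 : forall om, Om om -> 0 < v om.

Section one_frequency.
Variables (f S : R -> R -> R -> R -> R).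
Hypothesis f_eq : transport_eq Tf Om v f S.
Hypothesis f_final : forall x mu om, 0 <= x <= 1 -> -1 <= mu <= 1 -> Om om ->
  f Tf x mu om = 0.
Hypothesis f_refl : forall t mu om, 0 <= t <= Tf -> -1 <= mu < 0 -> Om om ->
  f t 1 (- mu) om = f t 1 mu om.
Let q := modulus Tf Om f.
Hypothesis mq : measurable_fun setT q.
Variables (om lam B : R).
Hypotheses (Oom : Om om) (lam0 : 0 < lam) (B0 : 0 <= B).
Hypothesis f_in : forall t mu, 0 <= t < Tf -> -1 <= mu < 0 ->
  `|f t 0 mu om| * (`|mu| * v om) <= B.
Variable s : (R * R) * (R * R) -> \bar R.
Hypotheses (ms : measurable_fun setT s) (s0 : forall z, (0 <= s z)%E).
Hypothesis S_le : forall t x mu, 0 < t < Tf -> 0 < x < 1 -> -1 <= mu <= 1 ->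
  mu != 0 -> (`|S t x mu om|%:E <= s ((t, x), (mu, om)))%E.
Let W := Tf * expR (lam * Tf).
Let Q (mu : R) := slab_int Tf lam (fun z => q (z, (mu, om))).
Let Sg (mu : R) := slab_int Tf lam (fun z => s (z, (mu, om))).
Let trace (x mu : R) := (\int[leb]_(t in `]0%R, Tf[) (weight lam t * q ((t, x), (mu, om))))%E.

Let q0 z : (0 <= q z)%E. Proof. exact: modulus_ge0. Qed.

(** Directions [- mu] leave through [x = 0], where the datum is given.  The datum
    may blow up as [mu] tends to zero, but its flux is bounded. *)
Let path_backward (mu : R) : 0 < mu -> mu <= 1 ->
  (Q (- mu) <= (lam^-1)%:E * ((B * W)%:E + Sg (- mu)) /\
   (mu * v om)%:E * trace 1 (- mu) <= (B * W)%:E + Sg (- mu))%E.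
Proof.
move=> mu_gt0 mu_le1; have v0 := v_gt0 Oom.
have c0 : 0 < mu * v om by rewrite mulr_gt0.
have mu1 : -1 <= - mu <= 1 by move: mu_gt0 mu_le1; lra.
have mun0 : - mu != 0 by rewrite oppr_eq0 lt0r_neq0.
pose s' (z : R * R) := s ((z.1, 1 - z.2), (- mu, om)).
have ms' : measurable_fun setT s'.
  apply: (measurableT_comp ms); apply: measurable_fun_pair; last by mfun.
  by apply: measurable_fun_pair; mfun.
pose e (_ : R) := (B / (mu * v om))%:E.
have e0 t : (0 <= e t)%E by rewrite lee_fin divr_ge0// ltW.
pose f' t x := q ((t, 1 - x), (- mu, om)).
have f'_le t x : 0 < t < Tf -> 0 <= x < 1 ->
  (f' t x <= (e \_ `]0%R, Tf[) (t + (1 - x) / (mu * v om))%R +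
     \int[leb]_(u in `]t, Tf[)
        (s' \_ (`]0%R, Tf[ `*` `]0%R, 1%R[)) (u, (x + mu * v om * (u - t))%R))%E.
  move=> tT x01; rewrite /f' /q modulusE; last first.
    by split => //; [case/andP: tT => /ltW -> /ltW ->|case/andP: x01 => ? ?; apply/andP; split; lra].
  apply: (@adjoint_char R Tf Om v f S f_eq f_final mu om mu_gt0 mu_le1 Oom v0 false s' e) => //.
  - by move=> z; exact: s0.
  - by move=> u y uT y01; apply: S_le => //; case/andP: y01 => ? ?; apply/andP; split; lra.
  - move=> u /andP[u0 uT]; rewrite lee_fin subrr ler_pdivlMr//.
    have := @f_in u (- mu); rewrite normrN (gtr0_norm mu_gt0) => hin; apply: hin.
      by rewrite uT ltW.
    by move: mu_gt0 mu_le1; lra.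
have mass_s' : (\int[leb]_(t in `]0%R, Tf[) (weight lam t *
    \int[leb]_(x in `]0%R, 1%R[) s' (t, x)) = Sg (- mu))%E.
  apply: (@slab_int_mirror R Tf lam (fun z => s (z, (- mu, om)))) => //.
  exact: measurable_slice.
have ce : ((mu * v om)%:E * \int[leb]_(t in `]0%R, Tf[) (weight lam t * e t) <= (B * W)%:E)%E.
  apply: (@le_trans _ _ ((mu * v om)%:E * ((B / (mu * v om)) * W)%:E)%E).
    apply: lee_wpmul2l; first by rewrite lee_fin ltW.
    by apply: integral_weight_le => //; rewrite divr_ge0// ltW.
  by rewrite -EFinM mulrA (mulrC (mu * v om)) divfK// lt0r_neq0.
split.
- have := @slab_mass R Tf _ lam c0 lam0 e s' (measurable_cst _) e0 ms' (fun=> s0 _) f' (fun _ _ => q0 _) f'_le.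
  rewrite mass_s' => h.
  rewrite /Q -slab_int_mirror//; last exact: measurable_slice.
  apply: (le_trans h); apply: lee_wpmul2l; first by rewrite lee_fin invr_ge0 ltW.
  exact: leeD.
- have := @slab_outflux R Tf _ lam c0 lam0 e s' (measurable_cst _) e0 ms' (fun=> s0 _) f' (fun _ _ => q0 _) f'_le.
  rewrite mass_s' /f' subr0 => h; apply: (le_trans h).
  exact: leeD.
Qed.

(** Directions [mu] leave through [x = 1], where the reflection condition
    reduces them to the trace of the direction [- mu]. *)
Let path_forward (mu : R) : 0 < mu -> mu <= 1 ->
  (Q mu <= (lam^-1)%:E * ((mu * v om)%:E * trace 1 (- mu) + Sg mu) /\
   (mu * v om)%:E * trace 0 mu <= (mu * v om)%:E * trace 1 (- mu) + Sg mu)%E.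
Proof.
move=> mu_gt0 mu_le1; have v0 := v_gt0 Oom.
have c0 : 0 < mu * v om by rewrite mulr_gt0.
have mu1 : -1 <= mu <= 1 by move: mu_gt0 mu_le1; lra.
have mun0 : mu != 0 by rewrite lt0r_neq0.
have ms' : measurable_fun setT (fun z => s (z, (mu, om))) by exact: measurable_slice.
pose e (t : R) := q ((t, 1), (- mu, om)).
have me : measurable_fun setT e.
  by apply: (measurableT_comp mq); apply: measurable_fun_pair; mfun.
pose f' t x := q ((t, x), (mu, om)).
have f'_le t x : 0 < t < Tf -> 0 <= x < 1 ->
  (f' t x <= (e \_ `]0%R, Tf[) (t + (1 - x) / (mu * v om))%R +
     \int[leb]_(u in `]t, Tf[)
        ((fun z => s (z, (mu, om))) \_ (`]0%R, Tf[ `*` `]0%R, 1%R[))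
          (u, (x + mu * v om * (u - t))%R))%E.
  move=> tT x01; rewrite /f' /q modulusE; last first.
    by split => //; [case/andP: tT => /ltW -> /ltW ->|case/andP: x01 => -> /ltW ->].
  apply: (@adjoint_char R Tf Om v f S f_eq f_final mu om mu_gt0 mu_le1 Oom v0 true
    (fun z => s (z, (mu, om))) e) => //.
  - by move=> t'; exact: q0.
  - by move=> u y uT y01; exact: S_le.
  - move=> u /andP[/ltW u0 /ltW uT]; rewrite /e /q modulusE; last first.
      by split => //; rewrite ?u0// ?ler01 ?lexx//; move: mu_gt0 mu_le1; lra.
    rewrite -(@f_refl u (- mu)) ?opprK ?u0//.
    by move: mu_gt0 mu_le1; lra.
split.
- have := @slab_mass R Tf _ lam c0 lam0 e _ me (fun=> q0 _) ms' (fun=> s0 _) f' (fun _ _ => q0 _) f'_le.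
  by [].
- have := @slab_outflux R Tf _ lam c0 lam0 e _ me (fun=> q0 _) ms' (fun=> s0 _) f' (fun _ _ => q0 _) f'_le.
  by [].
Qed.

Lemma mass_flux_le :
  (mass Tf lam q om <= (2 * lam^-1)%:E * ((B * W)%:E + mass Tf lam s om) /\
   flux Tf lam v q om <= (B * W)%:E + mass Tf lam s om)%E.
Proof.
apply: integrate_directions.
- exact: measurable_slab_slice.
- by move=> m; exact: slab_int_ge0.
- exact: measurable_slab_slice.
- by move=> m; exact: slab_int_ge0.
- move=> m m0 _; apply: mule_ge0; first by rewrite lee_fin mulr_ge0// ltW// v_gt0.
  by apply: integral_ge0 => t _; exact: mule_ge0.
- by rewrite mulr_ge0// invr_ge0 ltW.
- by rewrite !mulr_ge0// ?expR_ge0// ltW.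
- move=> m m0 m1.
  have [b1 b2] := path_backward m0 m1.
  have [f1 f2] := path_forward m0 m1.
  apply: combine_paths b1 b2 f1 f2.
  + by rewrite invr_ge0 ltW.
  + by rewrite !mulr_ge0// ?expR_ge0// ltW.
  + exact: slab_int_ge0.
  + exact: slab_int_ge0.
Qed.

End one_frequency.

(** Stability of the adjoint problem in [L^1(t, x, mu)], for almost every
    frequency.  [G] bounds the flux of the inflow datum and the mass of the
    exterior source [r]; the conclusion bounds the mass and the outgoing flux of
    the solution by [G] plus its integral. *)
Lemma adjoint_estimate (a k : R) : 0 <= a -> 0 <= k ->
  exists lam C : R, [/\ 0 < lam, 0 < C &
  forall (f S : R -> R -> R -> R -> R) (r : (R * R) * (R * R) -> \bar R) (G : R -> R),
  let q := modulus Tf Om f in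
  transport_eq Tf Om v f S ->
  (forall x mu om, 0 <= x <= 1 -> -1 <= mu <= 1 -> Om om -> f Tf x mu om = 0) ->
  (forall t mu om, 0 <= t <= Tf -> -1 <= mu < 0 -> Om om ->
    f t 1 (- mu) om = f t 1 mu om) ->
  measurable_fun setT q -> (\int[leb]_(om in Om) mass Tf lam q om < +oo)%E ->
  (forall t mu om, 0 <= t < Tf -> -1 <= mu < 0 -> Om om ->
    `|f t 0 mu om| * (`|mu| * v om) <= G om) ->
  measurable_fun setT r -> (forall z, 0 <= r z)%E ->
  (forall t x mu om, 0 < t < Tf -> 0 < x < 1 -> -1 <= mu <= 1 -> mu != 0 -> Om om ->
    (`|S t x mu om|%:E <= a%:E * q ((t, x), (mu, om)) + k%:E * angular_total Om q (t, x) +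
        r ((t, x), (mu, om)))%E) ->
  leb.-integrable Om (EFin \o G) -> (forall om, Om om -> 0 <= G om) ->
  {ae leb, forall om, Om om -> (mass Tf lam r om <= (G om)%:E)%E} ->
  let N := \int[leb]_(om in Om) G om in
  (\int[leb]_(om in Om) mass Tf lam q om <= (C * N)%:E)%E /\
  {ae leb, forall om, Om om -> (mass Tf lam q om <= (C * (G om + N))%:E)%E /\
     (flux Tf lam v q om <= (C * (G om + N))%:E)%E}].
Proof.
move=> a0 k0; pose V := fine (leb Om).
have V0 : 0 <= V by exact: fine_ge0.
have kV0 : 0 <= k * V by rewrite mulr_ge0.
pose lam := 4 * a + 32 * (k * V) + 1.
have lam0 : 0 < lam by rewrite /lam; lra.
have lam1 : 1 <= lam by rewrite /lam; lra.
have lam_a : 2 / lam * a <= 1 / 2.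
  by rewrite mulrAC ler_pdivrMr// /lam; lra.
have lam_k : 2 / lam * (8 * (k * V)) <= 1 / 2.
  by rewrite mulrAC ler_pdivrMr// /lam; lra.
have lamV : 2 / lam <= 2 by rewrite ler_pdivrMr//; lra.
have lamV0 : 0 <= 2 / lam by rewrite divr_ge0// ltW.
clearbody lam.
pose W := Tf * expR (lam * Tf).
have W0 : 0 <= W by rewrite mulr_ge0 ?expR_ge0// ltW.
pose K := 4 * (W + 1).
have K0 : 0 <= K by rewrite /K; lra.
pose C := 2 * K + (K + 32 * (k * K)) + (W + 1 + a * (K + 32 * (k * K)) + 4 * (k * K)) + 1.
have kK0 : 0 <= k * K by rewrite mulr_ge0.
have aK0 : 0 <= a * K by rewrite mulr_ge0.
have akK0 : 0 <= a * (k * K) by rewrite mulr_ge0.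
exists lam, C; split => //.
  by rewrite /C mulrDr; move: W0 K0 kK0 aK0 akK0; lra.
move=> f S r G q f_eq f_final f_refl mq A_lty f_in mr r0 S_le iG G0 r_le N.
have q0 z : (0 <= q z)%E by exact: modulus_ge0.
have N0 : 0 <= N by exact: Rintegral_ge0.
have NE : (\int[leb]_(om in Om) (G om)%:E = N%:E)%E.
  by rewrite /N /Rintegral fineK//; exact: integrable_fin_num.
have mtot : measurable_fun setT (fun z : (R * R) * (R * R) => angular_total Om q z.1).
  by apply: (measurableT_comp (measurable_angular_total mOm mq q0)); mfun.
have tot0 z : (0 <= angular_total Om q z)%E by exact: angular_total_ge0.
pose s z := (a%:E * q z + k%:E * angular_total Om q z.1 + r z)%E.
have [ms s0] : measurable_fun setT s /\ forall z, (0 <= s z)%E.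
  split; last by move=> z; rewrite !adde_ge0// mule_ge0.
  by apply: emeasurable_funD => //; apply: emeasurable_funD; exact: measurable_funeM.
have key om : Om om ->
    (mass Tf lam q om <= (2 * lam^-1)%:E * ((G om * W)%:E + mass Tf lam s om) /\
     flux Tf lam v q om <= (G om * W)%:E + mass Tf lam s om)%E.
  move=> Oom; apply: (@mass_flux_le f S) => //.
  - exact: G0.
  - by move=> t mu tT mu1; exact: f_in.
  - by move=> t x mu tT x1 mu1 mu0; exact: S_le.
have mass_s om : (mass Tf lam s om = a%:E * mass Tf lam q om +
    k%:E * (2%:E * \int[leb]_(om in Om) mass Tf lam q om) + mass Tf lam r om)%E.
  clearbody q; have aq0 z : (0 <= a%:E * q z)%E by exact: mule_ge0.
  have kt0 (z : (R * R) * (R * R)) : (0 <= k%:E * angular_total Om q z.1)%E.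
    exact: mule_ge0.
  rewrite /s massD//; first last.
  - by move=> z; exact: adde_ge0.
  - by apply: emeasurable_funD; exact: measurable_funeM.
  rewrite massD//; try exact: measurable_funeM.
  by rewrite !massZ// mass_angular_total.
clearbody s.
set Ae := (\int[leb]_(om in Om) mass Tf lam q om)%E in A_lty mass_s *.
have Ae0 : (0 <= Ae)%E by apply: integral_ge0 => om _; exact: mass_ge0.
have [A [A0 AE]] : exists A, 0 <= A /\ Ae = A%:E.
  by exists (fine Ae); rewrite fine_ge0// fineK// ge0_fin_numE.
have mmass : measurable_fun setT (mass Tf lam q) by exact: measurable_mass.
clearbody q.
(* almost every frequency has finite mass, which can be absorbed *)
have finite : {ae leb, forall om, Om om -> (mass Tf lam q om < +oo)%E}.
  apply: (@ae_lty _ _ R leb Om (mass Tf lam q) mOm (measurable_funTS mmass) _ A_lty).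
  by move=> om _; exact: mass_ge0.
have absorbed : {ae leb, forall om, Om om ->
    (mass Tf lam q om <= (K * G om + 2 / lam * (8 * (k * A)))%:E)%E /\
    (flux Tf lam v q om <= ((W + 1) * G om + a * fine (mass Tf lam q om) + 2 * (k * A))%:E)%E}.
  apply: (ae_mono2 finite r_le) => om fin rle Oom.
  have := key _ Oom; rewrite mass_s AE.
  have m0 : (0 <= mass Tf lam q om)%E by exact: mass_ge0.
  have r00 : (0 <= mass Tf lam r om)%E by exact: mass_ge0.
  have G00 := G0 _ Oom.
  move: (fin Oom) (rle Oom) m0 r00.
  case: (mass Tf lam q om) => // E _; case: (mass Tf lam r om) => // r' + E0 r'0.
  rewrite !lee_fin in E0 r'0 *. rewrite -!EFinM -!EFinD => r'G [h1 h2].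
  split.
    have e1 : 2 / lam * (a * E) <= E / 2.
      by rewrite mulrA mulrC; apply: (le_trans (ler_wpM2l E0 lam_a)); lra.
    have e2 : 2 / lam * (G om * W + r') <= 2 * (G om * W + G om).
      apply: (@le_trans _ _ (2 / lam * (G om * W + G om))).
        by rewrite ler_wpM2l// lerD2l.
      by rewrite ler_wpM2r// addr_ge0// mulr_ge0.
    have {}h1 : E <= 2 / lam * (a * E) + 2 / lam * (2 * (k * A)) + 2 / lam * (G om * W + r').
      by move: h1; rewrite !mulrDr; lra.
    have -> : K * G om = 4 * (G om * W + G om) by rewrite /K; ring.
    have -> : 2 / lam * (8 * (k * A)) = 2 * (2 / lam * (2 * (k * A))) * 2 by ring.
    have : 0 <= 2 / lam * (2 * (k * A)) by rewrite mulr_ge0// mulr_ge0// mulr_ge0.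
    by move: h1 e1 e2; lra.
  apply: (le_trans h2); rewrite lee_fin /=; move: r'G; nra.
clearbody K W.
(* integrating over the frequencies absorbs the total mass *)
have A_le : A <= 2 * K * N.
  have cst0 : 0 <= 2 / lam * (8 * (k * A)).
    by apply: mulr_ge0 => //; apply: mulr_ge0 => //; apply: mulr_ge0.
  have : (Ae <= \int[leb]_(om in Om) (K%:E * (G om)%:E + (2 / lam * (8 * (k * A)))%:E))%E.
    apply: (@le_integral_ge0_ae _ _ R leb Om (mass Tf lam q) _ mOm).
    - apply: emeasurable_funD; last exact: measurable_cst.
      by apply: measurable_funeM; exact: measurable_int iG.
    - by move=> om _; exact: mass_ge0.
    - by move=> om Oom; have ? := G0 _ Oom; rewrite -EFinM -EFinD lee_fin addr_ge0// mulr_ge0.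
    - by apply: (ae_mono absorbed) => om h /h [h1 _]; rewrite -EFinM -EFinD.
  rewrite ge0_integralD//; last 2 first.
  - by move=> om Oom; rewrite -EFinM lee_fin mulr_ge0// G0.
  - by apply: measurable_funeM; exact: measurable_int iG.
  rewrite ge0_integralZl//; last exact: measurable_int iG.
  rewrite NE integral_cst//= (_ : lebesgue_measure Om = V%:E); last first.
    by rewrite /V fineK// ge0_fin_numE.
  rewrite AE -!EFinM -EFinD lee_fin => h.
  have h2 : 2 / lam * (8 * (k * A)) * V <= A / 2.
    have -> : 2 / lam * (8 * (k * A)) * V = 2 / lam * (8 * (k * V)) * A by ring.
    by rewrite mulrC ler_wpM2l//; lra.
  by move: h h2; lra.
have cst_le : 2 / lam * (8 * (k * A)) <= 32 * (k * K) * N.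
  apply: (@le_trans _ _ (2 * (8 * (k * A)))).
    apply: ler_wpM2r => //; apply: mulr_ge0 => //; exact: mulr_ge0.
  have : k * A <= k * (2 * K * N) by rewrite ler_wpM2l.
  by rewrite (_ : k * (2 * K * N) = 2 * (k * K * N)); [lra|ring].
have kA_le : k * A <= 2 * (k * K) * N.
  by rewrite (_ : 2 * (k * K) * N = k * (2 * K * N)); [rewrite ler_wpM2l|ring].
have KN0 : 0 <= K * N by rewrite mulr_ge0.
have C_mono (c x : R) : c <= C -> 0 <= x -> c * x <= C * x by move=> ? ?; rewrite ler_wpM2r.
split.
  rewrite AE lee_fin; apply: (le_trans A_le); apply: C_mono => //.
  by rewrite /C; move: W0 K0 kK0 aK0 akK0; rewrite (mulrDr a); lra.
apply: (ae_mono absorbed) => om h Oom.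
have G00 := G0 _ Oom.
have [h1 h2] := h Oom.
pose E := K + 32 * (k * K).
have E0 : 0 <= E by rewrite addr_ge0// mulr_ge0.
have aE0 : 0 <= a * E by rewrite mulr_ge0.
have mE : K * G om + 2 / lam * (8 * (k * A)) <= E * (G om + N).
  have : 0 <= 32 * (k * K) * G om by apply: mulr_ge0 => //; exact: mulr_ge0.
  by move: KN0 cst_le; rewrite /E !(mulrDl K) !(mulrDr _ (G om)); lra.
have m0 : (0 <= mass Tf lam q om)%E by exact: mass_ge0.
have m_le : (mass Tf lam q om <= (E * (G om + N))%:E)%E.
  by apply: (le_trans h1); rewrite lee_fin.
split.
  apply: (le_trans m_le); rewrite lee_fin; apply: C_mono; last exact: addr_ge0.
  by rewrite /C -/E; move: aE0 W0 K0 kK0; lra.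
apply: (le_trans h2); rewrite lee_fin.
have fm : fine (mass Tf lam q om) <= E * (G om + N).
  by move: m0 m_le; case: (mass Tf lam q om) => // m' _; rewrite lee_fin.
have afm : a * fine (mass Tf lam q om) <= a * E * (G om + N).
  by rewrite -mulrA ler_wpM2l.
apply: (@le_trans _ _ ((W + 1 + a * E + 4 * (k * K)) * (G om + N))).
  have : 0 <= (W + 1) * N by apply: mulr_ge0 N0; move: W0; lra.
  have : 0 <= 4 * (k * K) * G om by apply: mulr_ge0 => //; exact: mulr_ge0.
  move: afm kA_le; rewrite (mulrDl (W + 1 + a * E)) (mulrDl (W + 1)) (mulrDr (W + 1)).
  by rewrite (mulrDr (4 * (k * K))); lra.
apply: C_mono; last exact: addr_ge0.
by rewrite /C -/E; move: E0 K0 kK0; lra.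
Qed.


End adjoint_estimate.

(** * Iterated integrals *)

Section iterated_integrals.
Context d1 d2 (T1 : measurableType d1) (T2 : measurableType d2) (R : realType).
Variables (m1 : {sigma_finite_measure set T1 -> \bar R}).
Variables (m2 : {sigma_finite_measure set T2 -> \bar R}).
Variables (D1 : set T1) (D2 : set T2).
Hypotheses (mD1 : measurable D1) (mD2 : measurable D2).
Variable F : T1 * T2 -> R.
Hypothesis iF : (m1 \x m2)%E.-integrable (D1 `*` D2) (EFin \o F).

Let Fr := (EFin \o F) \_ (D1 `*` D2).
Let mD : measurable (D1 `*` D2). Proof. exact: measurableX. Qed.
Let iFr : (m1 \x m2)%E.-integrable setT Fr.
Proof. by apply/(integrable_mkcond _ mD). Qed.

Let FrE1 x : D1 x -> fubini_F m2 Fr x = (\int[m2]_(y in D2) (F (x, y))%:E)%E.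
Proof.
move=> Dx; rewrite /fubini_F [RHS]integral_mkcond; apply: eq_integral => y _.
by rewrite /Fr !patchE; congr (if _ then _ else _); apply/idP/idP; rewrite !inE; [case|].
Qed.

Let FrE2 y : D2 y -> fubini_G m1 Fr y = (\int[m1]_(x in D1) (F (x, y))%:E)%E.
Proof.
move=> Dy; rewrite /fubini_G [RHS]integral_mkcond; apply: eq_integral => x _.
by rewrite /Fr !patchE; congr (if _ then _ else _); apply/idP/idP; rewrite !inE; [case|].
Qed.

Let integrable_fine d (T : measurableType d) (m : {measure set T -> \bar R})
    (D : set T) (f : T -> \bar R) : measurable D ->
  m.-integrable D f -> m.-integrable D (fun x => (fine (f x))%:E).
Proof.
move=> mDD /integrableP[mf foo]; apply/integrableP; split.
  apply/measurable_EFinP; apply: measurableT_comp => //.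
apply: le_lt_trans foo; apply: le_integral_ge0 => // x _.
by case: (f x) => [r| |] /=; rewrite ?lexx// normr0 leey.
Qed.

Let integral_fine d (T : measurableType d) (m : {measure set T -> \bar R})
    (D : set T) (f : T -> \bar R) : measurable D ->
  m.-integrable D f -> (\int[m]_(x in D) (fine (f x))%:E = \int[m]_(x in D) f x)%E.
Proof.
move=> mDD fi; have fi' := integrable_fine mDD fi.
apply: ae_eq_integral => //; [exact: measurable_int fi'|exact: measurable_int fi|].
move: (integrable_ae mDD fi); apply: filterS => x h Dx.
by rewrite fineK// h.
Qed.

Let iF1 : m1.-integrable D1 (fun x => \int[m2]_(y in D2) (F (x, y))%:E)%E.
Proof.
apply: (@eq_integrable _ _ _ m1 D1 mD1 (fubini_F m2 Fr)).
  by move=> x; rewrite inE => Dx; rewrite FrE1.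
by apply: integrableS (integrable_fubini_F iFr).
Qed.

Let iF2 : m2.-integrable D2 (fun y => \int[m1]_(x in D1) (F (x, y))%:E)%E.
Proof.
apply: (@eq_integrable _ _ _ m2 D2 mD2 (fubini_G m1 Fr)).
  by move=> y; rewrite inE => Dy; rewrite FrE2.
have iG : m2.-integrable setT (fubini_G m1 Fr).
  have mFr := measurable_int _ iFr.
  apply/integrableP; split; first exact: (measurable_fubini_G iFr).
  apply: le_lt_trans ((integrable21ltyP m1 m2 mFr).1 iFr).
  apply: le_integral_ge0 => // y _; apply: le_abse_integral => //.
  exact: measurable_fun_pair1.
by apply: integrableS iG.
Qed.

Lemma integrable_Rintegral12 :
  m1.-integrable D1 (EFin \o (fun x => \int[m2]_(y in D2) F (x, y))).
Proof. exact: integrable_fine iF1. Qed.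

Lemma integrable_Rintegral21 :
  m2.-integrable D2 (EFin \o (fun y => \int[m1]_(x in D1) F (x, y))).
Proof. exact: integrable_fine iF2. Qed.

Lemma Rintegral12 : \int[m1]_(x in D1) (\int[m2]_(y in D2) F (x, y)) =
  \int[(m1 \x m2)%E]_(z in D1 `*` D2) F z.
Proof.
congr fine; rewrite integral_fine// [RHS]integral_mkcond -/Fr.
rewrite -(integral12_prod_meas1 iFr) [LHS]integral_mkcond; apply: eq_integral => x _.
rewrite patchE; case: ifPn => [|xD]; first by rewrite inE => /FrE1.
rewrite /fubini_F integral0_eq// => y _; rewrite /Fr patchE memNset// => -[/= Dx _].
by move: xD; rewrite notin_setE.
Qed.

Lemma Rintegral21 : \int[m2]_(y in D2) (\int[m1]_(x in D1) F (x, y)) =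
  \int[(m1 \x m2)%E]_(z in D1 `*` D2) F z.
Proof.
congr fine; rewrite integral_fine// [RHS]integral_mkcond -/Fr.
rewrite -(integral21_prod_meas1 iFr) [LHS]integral_mkcond; apply: eq_integral => y _.
rewrite patchE; case: ifPn => [|yD]; first by rewrite inE => /FrE2.
rewrite /fubini_G integral0_eq// => x _; rewrite /Fr patchE memNset// => -[/= _ Dy].
by move: yD; rewrite notin_setE.
Qed.

End iterated_integrals.

Section product_sigma_finite.
Local Open Scope ereal_scope.
Context d1 d2 (T1 : measurableType d1) (T2 : measurableType d2) (R : realType).
Variables (m1 : {sigma_finite_measure set T1 -> \bar R}).
Variables (m2 : {sigma_finite_measure set T2 -> \bar R}).

(** The product measure, named so as to carry its sigma-finite structure. *)
Definition sigma_product : set (T1 * T2) -> \bar R := m1 \x m2.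

HB.instance Definition _ := Measure.on sigma_product.

Let sigma_product_sigma_finite : sigma_finite setT sigma_product.
Proof.
have /sigma_finiteP[F [TF ndF Foo]] := sigma_finiteT m1.
have /sigma_finiteP[G [TG ndG Goo]] := sigma_finiteT m2.
exists (fun n => F n `*` G n) => [|n].
  rewrite eqEsubset; split=> // -[x y] _.
  have [n _ Fx] : (\bigcup_n F n) x by rewrite -TF.
  have [k _ Gy] : (\bigcup_n G n) y by rewrite -TG.
  exists (maxn n k) => //; split.
    by move: x Fx; apply/subsetPset/ndF; exact: leq_maxl.
  by move: y Gy; apply/subsetPset/ndG; exact: leq_maxr.
have [[mF Fn] [mG Gn]] := (Foo n, Goo n).
by split; [exact: measurableX | rewrite [ltLHS]product_measure1E// lte_mul_pinfty// ge0_fin_numE].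
Qed.

HB.instance Definition _ := Measure_isSigmaFinite.Build _ _ _ sigma_product
  sigma_product_sigma_finite.

End product_sigma_finite.

Section fourfold_integral.
Local Open Scope ereal_scope.
Context d1 d2 d3 d4 (T1 : measurableType d1) (T2 : measurableType d2)
  (T3 : measurableType d3) (T4 : measurableType d4) (R : realType).
Variables (m1 : {sigma_finite_measure set T1 -> \bar R}).
Variables (m2 : {sigma_finite_measure set T2 -> \bar R}).
Variables (m3 : {sigma_finite_measure set T3 -> \bar R}).
Variables (m4 : {sigma_finite_measure set T4 -> \bar R}).
Implicit Type q : (T1 * T2) * (T3 * T4) -> \bar R.

(** Tonelli's theorem for a product of two products; the directions are
    integrated before the frequencies. *)
Lemma fubini_tonelli4 q : measurable_fun setT q -> (forall z, 0 <= q z) ->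
  \int[(m1 \x m2) \x (m3 \x m4)]_z q z =
  \int[m1]_t \int[m2]_x \int[m4]_u \int[m3]_y q ((t, x), (y, u)).
Proof.
move=> mq q0.
rewrite [LHS](@fubini_tonelli1 _ _ _ _ R (sigma_product m1 m2) (sigma_product m3 m4))//.
set F := fubini_F (sigma_product m3 m4) q.
have mF : measurable_fun setT F.
  exact: (@measurable_fun_fubini_tonelli_F _ _ _ _ R (sigma_product m3 m4)).
have F0 y : 0 <= F y by exact: integral_ge0.
transitivity (\int[m1]_t \int[m2]_x F (t, x)).
  exact: (@fubini_tonelli1 _ _ _ _ R m1 m2 F mF F0).
apply: eq_integral => t _; apply: eq_integral => x _.
rewrite /fubini_F [LHS](@fubini_tonelli2 _ _ _ _ R m3 m4 (fun w => q ((t, x), w)))//.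
exact: measurableT_comp.
Qed.

Lemma integrable4 (D : set ((T1 * T2) * (T3 * T4))) q : measurable D ->
  ((m1 \x m2) \x (m3 \x m4)).-integrable D q ->
  \int[m1]_t \int[m2]_x \int[m4]_u \int[m3]_y
    ((fun z => `|q z|) \_ D) ((t, x), (y, u)) < +oo.
Proof.
move=> mD /integrableP[mq]; rewrite [ltLHS](@integral_mkcond _ _ R
  (sigma_product (sigma_product m1 m2) (sigma_product m3 m4)) D).
rewrite [ltLHS]fubini_tonelli4//.
- by apply/(measurable_restrictT _ mD)/measurableT_comp.
- by move=> z; apply: erestrict_ge0.
Qed.

Lemma integrableB4 (D : set ((T1 * T2) * (T3 * T4)))
    (f g : (T1 * T2) * (T3 * T4) -> R) : measurable D ->
  ((m1 \x m2) \x (m3 \x m4)).-integrable D (EFin \o f) ->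
  ((m1 \x m2) \x (m3 \x m4)).-integrable D (EFin \o g) ->
  ((m1 \x m2) \x (m3 \x m4)).-integrable D (EFin \o (fun z => f z - g z)%R).
Proof.
move=> mD mf mg; rewrite (_ : EFin \o _ = (EFin \o f) \- (EFin \o g)).
  exact: (@integrableB _ _ R
    (sigma_product (sigma_product m1 m2) (sigma_product m3 m4))).
by apply/funext => z; rewrite /= -EFinB.
Qed.

End fourfold_integral.

(** * Lipschitz pairs *)

Section lipschitz_pairs.
Context {R : realType}.
Implicit Types C D x y : R.

(** Two quantities bounded by [C] whose difference is at most [C * D].  One
    constant serves both purposes, so that the notion is stable under sums,
    products and inverses. *)
Definition lip C D x y := [/\ `|x| <= C, `|y| <= C & `|x - y| <= C * D].

Lemma lip_ge0 C D x y : lip C D x y -> 0 <= C.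
Proof. by case=> h _ _; exact: le_trans h. Qed.

Lemma lip_le C C' D x y : 0 <= D -> C <= C' -> lip C D x y -> lip C' D x y.
Proof.
move=> D0 CC' [h1 h2 h3]; split; try exact: le_trans CC'.
by apply: le_trans h3 _; rewrite ler_wpM2r.
Qed.

Lemma lip_leD C D D' x y : D <= D' -> lip C D x y -> lip C D' x y.
Proof.
move=> DD' h; have C0 := lip_ge0 h; case: h => h1 h2 h3; split => //.
by apply: le_trans h3 _; rewrite ler_wpM2l.
Qed.

Lemma lip_cst C D x : 0 <= D -> `|x| <= C -> lip C D x x.
Proof.
move=> D0 xC; split => //; rewrite subrr normr0 mulr_ge0//.
exact: le_trans xC.
Qed.

Lemma lipN C D x y : lip C D x y -> lip C D (- x) (- y).
Proof. by move=> [h1 h2 h3]; split; rewrite ?normrN// -opprD normrN. Qed.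

Lemma lipD C1 C2 D x1 y1 x2 y2 : lip C1 D x1 y1 -> lip C2 D x2 y2 ->
  lip (C1 + C2) D (x1 + x2) (y1 + y2).
Proof.
move=> [h1 h2 h3] [k1 k2 k3]; split.
- by apply: le_trans (ler_normD _ _) _; exact: lerD.
- by apply: le_trans (ler_normD _ _) _; exact: lerD.
- rewrite opprD addrACA mulrDl.
  by apply: le_trans (ler_normD _ _) _; exact: lerD.
Qed.

Lemma lipB C1 C2 D x1 y1 x2 y2 : lip C1 D x1 y1 -> lip C2 D x2 y2 ->
  lip (C1 + C2) D (x1 - x2) (y1 - y2).
Proof. by move=> h1 /lipN; exact: lipD. Qed.

Lemma lipZ C D a x y : lip C D x y -> lip (`|a| * C) D (a * x) (a * y).
Proof.
move=> [h1 h2 h3]; split; rewrite -?mulrBr normrM -?mulrA; exact: ler_wpM2l.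
Qed.

Lemma lipM C1 C2 D x1 y1 x2 y2 : 0 <= D -> lip C1 D x1 y1 -> lip C2 D x2 y2 ->
  lip (2 * (C1 * C2)) D (x1 * x2) (y1 * y2).
Proof.
move=> D0 l1 l2; have C10 := lip_ge0 l1; have C20 := lip_ge0 l2.
case: l1 => h1 h2 h3; case: l2 => k1 k2 k3.
have CC : 0 <= C1 * C2 by exact: mulr_ge0.
have b (a b' : R) : `|a| <= C1 -> `|b'| <= C2 -> `|a * b'| <= 2 * (C1 * C2).
  move=> ha hb; rewrite normrM; apply: (@le_trans _ _ (C1 * C2)); last by lra.
  exact: ler_pM.
split; [exact: b|exact: b|].
have -> : x1 * x2 - y1 * y2 = x1 * (x2 - y2) + (x1 - y1) * y2 by ring.
have -> : 2 * (C1 * C2) * D = C1 * (C2 * D) + (C1 * D) * C2 by ring.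
by apply: le_trans (ler_normD _ _) _; rewrite !normrM; apply: lerD; exact: ler_pM.
Qed.

Lemma lipV C D m x y : 0 <= D -> 0 < m -> m <= x -> m <= y ->
  lip C D x y -> lip (m^-1 + C / m ^+ 2) D x^-1 y^-1.
Proof.
move=> D0 m0 mx my l; have C0 := lip_ge0 l; case: l => _ _ h.
have x0 : 0 < x by exact: lt_le_trans mx.
have y0 : 0 < y by exact: lt_le_trans my.
have Cm : 0 <= C / m ^+ 2 by rewrite divr_ge0// sqr_ge0.
have b z : m <= z -> `|z^-1| <= m^-1 + C / m ^+ 2.
  move=> mz; have z0 : 0 < z by exact: lt_le_trans mz.
  by rewrite gtr0_norm ?invr_gt0// (@le_trans _ _ m^-1) ?lerDl// lef_pV2.
split; [exact: b|exact: b|].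
have -> : x^-1 - y^-1 = (y - x) * (x^-1 * y^-1).
  by field; rewrite !lt0r_neq0.
rewrite normrM distrC (@le_trans _ _ (C * D * (m^-1 * m^-1)))//.
  apply: ler_pM => //; rewrite gtr0_norm ?mulr_gt0 ?invr_gt0//.
  by apply: ler_pM; rewrite ?invr_ge0 ?(ltW x0) ?(ltW y0)// lef_pV2.
rewrite mulrDl.
have -> : C * D * (m^-1 * m^-1) = C / m ^+ 2 * D.
  by field; rewrite lt0r_neq0.
by rewrite lerDr mulr_ge0// invr_ge0 ltW.
Qed.

End lipschitz_pairs.

Section iterated_lipschitz.
Context d1 d2 d3 (T1 : measurableType d1) (T2 : measurableType d2)
  (T3 : measurableType d3) (R : realType).
Variables (m1 : {sigma_finite_measure set T1 -> \bar R}).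
Variables (m2 : {sigma_finite_measure set T2 -> \bar R}).
Variables (m3 : {sigma_finite_measure set T3 -> \bar R}).
Variables (D1 : set T1) (D2 : set T2) (D3 : set T3).
Hypotheses (mD1 : measurable D1) (mD2 : measurable D2) (mD3 : measurable D3).

Lemma integrable_product2 (F : T1 * T2 -> R) (Q : T1 * T2 -> \bar R) :
  measurable_fun (D1 `*` D2) F -> measurable_fun setT Q -> (forall z, 0 <= Q z)%E ->
  (forall x y, D1 x -> D2 y -> (`|F (x, y)|%:E <= Q (x, y))%E) ->
  (\int[m1]_(x in D1) \int[m2]_(y in D2) Q (x, y) < +oo)%E ->
  (m1 \x m2)%E.-integrable (D1 `*` D2) (EFin \o F).
Proof.
move=> mF mQ Q0 FQ Qoo; have mD := measurableX mD1 mD2.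
apply/integrableP; split; first exact/measurable_EFinP.
rewrite (@integral_mkcond _ _ R (sigma_product m1 m2)).
set Fr := _ \_ _.
have Fr0 z : (0 <= Fr z)%E by apply: erestrict_ge0.
have mFr : measurable_fun setT Fr.
  by apply/(measurable_restrictT _ mD)/measurableT_comp => //; exact/measurable_EFinP.
rewrite (@fubini_tonelli1 _ _ _ _ R m1 m2 Fr mFr Fr0).
apply: le_lt_trans Qoo; rewrite [leRHS]integral_mkcond; apply: le_integral_ge0 => x _.
  exact: integral_ge0.
rewrite patchE; case: ifPn => [|xD]; last first.
  rewrite /fubini_F integral0_eq// => y _; rewrite /Fr patchE memNset// => -[/= Dx _].
  by move: xD; rewrite notin_setE.
rewrite inE => Dx; rewrite [leRHS]integral_mkcond; apply: le_integral_ge0 => y _.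
  exact: Fr0.
rewrite /Fr !patchE; case: ifPn => [|_]; last by case: ifPn.
rewrite inE => -[/= _ Dy]; rewrite (@mem_set _ D2)//=; exact: FQ.
Qed.

Lemma integrable_product3 (F : (T1 * T2) * T3 -> R) (Q : (T1 * T2) * T3 -> \bar R) :
  measurable_fun ((D1 `*` D2) `*` D3) F -> measurable_fun setT Q ->
  (forall z, 0 <= Q z)%E ->
  (forall x y z, D1 x -> D2 y -> D3 z -> (`|F ((x, y), z)|%:E <= Q ((x, y), z))%E) ->
  (\int[m1]_(x in D1) \int[m2]_(y in D2) \int[m3]_(z in D3) Q ((x, y), z) < +oo)%E ->
  ((m1 \x m2) \x m3)%E.-integrable ((D1 `*` D2) `*` D3) (EFin \o F).
Proof.
move=> mF mQ Q0 FQ Qoo; have mD12 := measurableX mD1 mD2.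
have mD := measurableX mD12 mD3.
apply/integrableP; split; first exact/measurable_EFinP.
rewrite (@integral_mkcond _ _ R (sigma_product (sigma_product m1 m2) m3)).
set Fr := _ \_ _.
have Fr0 z : (0 <= Fr z)%E by apply: erestrict_ge0.
have mFr : measurable_fun setT Fr.
  by apply/(measurable_restrictT _ mD)/measurableT_comp => //; exact/measurable_EFinP.
rewrite [ltLHS](@fubini_tonelli1 _ _ _ _ R (sigma_product m1 m2) m3 Fr mFr Fr0).
set G := fubini_F m3 Fr.
have G0 y : (0 <= G y)%E by exact: integral_ge0.
have mG : measurable_fun setT G by exact: (@measurable_fun_fubini_tonelli_F _ _ _ _ R m3 Fr mFr Fr0).
rewrite [ltLHS](@fubini_tonelli1 _ _ _ _ R m1 m2 G mG G0).
apply: le_lt_trans Qoo; rewrite [leRHS]integral_mkcond; apply: le_integral_ge0 => x _.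
  exact: integral_ge0.
rewrite patchE; case: ifPn => [|xD]; last first.
  rewrite /fubini_F integral0_eq// => y _; rewrite /G /fubini_F integral0_eq// => z _.
  by rewrite /Fr patchE memNset// => -[[/= Dx _] _]; move: xD; rewrite notin_setE.
rewrite inE => Dx; rewrite [leRHS]integral_mkcond; apply: le_integral_ge0 => y _.
  exact: G0.
rewrite patchE; case: ifPn => [|yD]; last first.
  rewrite /G /fubini_F integral0_eq// => z _.
  by rewrite /Fr patchE memNset// => -[[/= _ Dy] _]; move: yD; rewrite notin_setE.
rewrite inE => Dy; rewrite [leRHS]integral_mkcond; apply: le_integral_ge0 => z _.
  exact: Fr0.
rewrite /Fr !patchE; case: ifPn => [|_]; last by case: ifPn.
rewrite inE => -[[/= _ _] Dz]; rewrite (@mem_set _ D3)//=; exact: FQ.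
Qed.

Lemma Rintegral_iter3 (F : (T1 * T2) * T3 -> R) :
  ((m1 \x m2) \x m3)%E.-integrable ((D1 `*` D2) `*` D3) (EFin \o F) ->
  \int[m1]_(x in D1) (\int[m2]_(y in D2) (\int[m3]_(z in D3) F ((x, y), z))) =
  \int[((m1 \x m2) \x m3)%E]_(z in (D1 `*` D2) `*` D3) F z.
Proof.
move=> iF; have mD12 := measurableX mD1 mD2.
have iG := @integrable_Rintegral12 _ _ _ _ R (sigma_product m1 m2) m3 _ _ mD12 mD3 F iF.
rewrite (@Rintegral12 _ _ _ _ R m1 m2 _ _ mD1 mD2
  (fun y => \int[m3]_(z in D3) F (y, z)) iG).
exact: (@Rintegral12 _ _ _ _ R (sigma_product m1 m2) m3 _ _ mD12 mD3 F iF).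
Qed.

Lemma Rintegral_iter2Z (a : R) (F : T1 * T2 -> R) :
  (m1 \x m2)%E.-integrable (D1 `*` D2) (EFin \o F) ->
  \int[m1]_(x in D1) (a * \int[m2]_(y in D2) F (x, y)) =
  a * \int[m1]_(x in D1) (\int[m2]_(y in D2) F (x, y)).
Proof.
move=> iF; rewrite RintegralZl//.
exact: (@integrable_Rintegral12 _ _ _ _ R m1 m2 _ _ mD1 mD2 F iF).
Qed.

Lemma Rintegral_iter3Z (a : R) (F : (T1 * T2) * T3 -> R) :
  ((m1 \x m2) \x m3)%E.-integrable ((D1 `*` D2) `*` D3) (EFin \o F) ->
  \int[m1]_(x in D1) (\int[m2]_(y in D2) (a * \int[m3]_(z in D3) F ((x, y), z))) =
  a * \int[m1]_(x in D1) (\int[m2]_(y in D2) (\int[m3]_(z in D3) F ((x, y), z))).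
Proof.
move=> iF; have mD12 := measurableX mD1 mD2.
have iG := @integrable_Rintegral12 _ _ _ _ R (sigma_product m1 m2) m3 _ _ mD12 mD3 F iF.
pose G y := \int[m3]_(z in D3) F (y, z); rewrite -/G in iG.
have iaG : (m1 \x m2)%E.-integrable (D1 `*` D2) (EFin \o (fun y => a * G y)).
  rewrite (_ : EFin \o _ = (fun y => a%:E * (G y)%:E)%E).
    exact: (@integrableZl _ _ R (sigma_product m1 m2)).
  by apply/funext => y; rewrite /= EFinM.
rewrite (@Rintegral12 _ _ _ _ R m1 m2 _ _ mD1 mD2 _ iaG).
rewrite (@Rintegral12 _ _ _ _ R m1 m2 _ _ mD1 mD2 G iG).
exact: (@RintegralZl _ _ R (sigma_product m1 m2)).
Qed.

(** Iterated integrals inherit the Lipschitz property from bounds of the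
    integrands by functions with finite integral. *)
Lemma lip_iter2 (a C D : R) (F F' : T1 * T2 -> R) (Q Q' W : T1 * T2 -> \bar R) :
  measurable_fun (D1 `*` D2) F -> measurable_fun (D1 `*` D2) F' ->
  measurable_fun setT Q -> measurable_fun setT Q' ->
  (forall z, 0 <= Q z)%E -> (forall z, 0 <= Q' z)%E ->
  (forall x y, D1 x -> D2 y -> [/\ (`|F' (x, y)|%:E <= Q' (x, y))%E,
     (`|F (x, y)|%:E <= Q (x, y))%E & (`|F' (x, y) - F (x, y)|%:E <= W (x, y))%E]) ->
  let I q := (\int[m1]_(x in D1) \int[m2]_(y in D2) q (x, y))%E in
  (I Q' <= C%:E)%E -> (I Q <= C%:E)%E -> (I W <= (C * D)%:E)%E ->
  lip (`|a| * C) D (\int[m1]_(x in D1) (a * \int[m2]_(y in D2) F' (x, y)))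
                  (\int[m1]_(x in D1) (a * \int[m2]_(y in D2) F (x, y))).
Proof.
move=> mF mF' mQ mQ' Q0 Q0' H I IQ' IQ IW.
have bound (G : T1 * T2 -> R) (P : T1 * T2 -> \bar R) (c : R) :
    (forall x y, D1 x -> D2 y -> (`|G (x, y)|%:E <= P (x, y))%E) -> (I P <= c%:E)%E ->
    `|\int[m1]_(x in D1) (\int[m2]_(y in D2) G (x, y))| <= c.
  move=> GP Pc; rewrite -lee_fin; apply: le_trans Pc; apply: normr_Rintegral_le => x Dx.
  by apply: normr_Rintegral_le => y Dy; exact: GP.
have iF : (m1 \x m2)%E.-integrable (D1 `*` D2) (EFin \o F).
  apply: (@integrable_product2 F Q) => //; first by move=> x y Dx Dy; have [] := H x y Dx Dy.
  by apply: le_lt_trans IQ _; rewrite ltry.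
have iF' : (m1 \x m2)%E.-integrable (D1 `*` D2) (EFin \o F').
  apply: (@integrable_product2 F' Q') => //; first by move=> x y Dx Dy; have [] := H x y Dx Dy.
  by apply: le_lt_trans IQ' _; rewrite ltry.
rewrite (Rintegral_iter2Z a iF) (Rintegral_iter2Z a iF'); apply: lipZ; split.
- by apply: bound IQ' => x y Dx Dy; have [] := H x y Dx Dy.
- by apply: bound IQ => x y Dx Dy; have [] := H x y Dx Dy.
- have mD := measurableX mD1 mD2.
  have iB : (m1 \x m2)%E.-integrable (D1 `*` D2) (EFin \o (fun z => F' z - F z)).
    rewrite (_ : EFin \o _ = (EFin \o F') \- (EFin \o F))%E.
      exact: (@integrableB _ _ R (sigma_product m1 m2)).
    by apply/funext => z; rewrite /= -EFinB.
  rewrite (@Rintegral12 _ _ _ _ R m1 m2 _ _ mD1 mD2 F iF).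
  rewrite (@Rintegral12 _ _ _ _ R m1 m2 _ _ mD1 mD2 F' iF').
  rewrite -(@RintegralB _ _ R (sigma_product m1 m2) _ _ _ mD iF' iF).
  rewrite -(@Rintegral12 _ _ _ _ R m1 m2 _ _ mD1 mD2 _ iB).
  by apply: (bound (fun z => F' z - F z) W _ _ IW) => x y Dx Dy; have [] := H x y Dx Dy.
Qed.

Lemma lip_iter3 (a C D : R) (F F' : (T1 * T2) * T3 -> R)
    (Q Q' W : (T1 * T2) * T3 -> \bar R) :
  measurable_fun ((D1 `*` D2) `*` D3) F -> measurable_fun ((D1 `*` D2) `*` D3) F' ->
  measurable_fun setT Q -> measurable_fun setT Q' ->
  (forall z, 0 <= Q z)%E -> (forall z, 0 <= Q' z)%E ->
  (forall x y z, D1 x -> D2 y -> D3 z -> let u := ((x, y), z) in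
     [/\ (`|F' u|%:E <= Q' u)%E, (`|F u|%:E <= Q u)%E & (`|F' u - F u|%:E <= W u)%E]) ->
  let I q := (\int[m1]_(x in D1) \int[m2]_(y in D2) \int[m3]_(z in D3) q ((x, y), z))%E in
  (I Q' <= C%:E)%E -> (I Q <= C%:E)%E -> (I W <= (C * D)%:E)%E ->
  lip (`|a| * C) D
    (\int[m1]_(x in D1) (\int[m2]_(y in D2) (a * \int[m3]_(z in D3) F' ((x, y), z))))
    (\int[m1]_(x in D1) (\int[m2]_(y in D2) (a * \int[m3]_(z in D3) F ((x, y), z)))).
Proof.
move=> mF mF' mQ mQ' Q0 Q0' H I IQ' IQ IW.
have bound (G : (T1 * T2) * T3 -> R) (P : (T1 * T2) * T3 -> \bar R) (c : R) :
    (forall x y z, D1 x -> D2 y -> D3 z -> (`|G ((x, y), z)|%:E <= P ((x, y), z))%E) ->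
    (I P <= c%:E)%E ->
    `|\int[m1]_(x in D1) (\int[m2]_(y in D2) (\int[m3]_(z in D3) G ((x, y), z)))| <= c.
  move=> GP Pc; rewrite -lee_fin; apply: le_trans Pc; apply: normr_Rintegral_le => x Dx.
  apply: normr_Rintegral_le => y Dy; apply: normr_Rintegral_le => z Dz; exact: GP.
have iF : ((m1 \x m2) \x m3)%E.-integrable ((D1 `*` D2) `*` D3) (EFin \o F).
  apply: (@integrable_product3 F Q) => //.
    by move=> x y z Dx Dy Dz; have [] := H x y z Dx Dy Dz.
  by apply: le_lt_trans IQ _; rewrite ltry.
have iF' : ((m1 \x m2) \x m3)%E.-integrable ((D1 `*` D2) `*` D3) (EFin \o F').
  apply: (@integrable_product3 F' Q') => //.
    by move=> x y z Dx Dy Dz; have [] := H x y z Dx Dy Dz.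
  by apply: le_lt_trans IQ' _; rewrite ltry.
rewrite (Rintegral_iter3Z a iF) (Rintegral_iter3Z a iF'); apply: lipZ; split.
- by apply: bound IQ' => x y z Dx Dy Dz; have [] := H x y z Dx Dy Dz.
- by apply: bound IQ => x y z Dx Dy Dz; have [] := H x y z Dx Dy Dz.
- have mD := measurableX (measurableX mD1 mD2) mD3.
  have iB : ((m1 \x m2) \x m3)%E.-integrable ((D1 `*` D2) `*` D3)
      (EFin \o (fun z => F' z - F z)).
    rewrite (_ : EFin \o _ = (EFin \o F') \- (EFin \o F))%E.
      exact: (@integrableB _ _ R (sigma_product (sigma_product m1 m2) m3)).
    by apply/funext => z; rewrite /= -EFinB.
  rewrite (Rintegral_iter3 iF) (Rintegral_iter3 iF').
  rewrite -(@RintegralB _ _ R (sigma_product (sigma_product m1 m2) m3) _ _ _ mD iF' iF).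
  rewrite -(Rintegral_iter3 iB).
  by apply: (bound (fun z => F' z - F z) W _ _ IW) => x y z Dx Dy Dz; have [] := H x y z Dx Dy Dz.
Qed.

End iterated_lipschitz.

Section transport_difference.
Context {R : realType}.

Lemma transport_eqB (Tf : R) (Om : set R) (v : R -> R)
    (f1 S1 f2 S2 : R -> R -> R -> R -> R) :
  transport_eq Tf Om v f1 S1 -> transport_eq Tf Om v f2 S2 ->
  transport_eq Tf Om v (fun t x mu om => f1 t x mu om - f2 t x mu om)
    (fun t x mu om => S1 t x mu om - S2 t x mu om).
Proof.
move=> tr1 tr2 t1 t2 x mu om t10 t12 t2T mu1 Oom X Xin.
have [i1 e1] := tr1 t1 t2 x mu om t10 t12 t2T mu1 Oom Xin.
have [i2 e2] := tr2 t1 t2 x mu om t10 t12 t2T mu1 Oom Xin.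
split.
  rewrite (_ : (fun s => _) = (fun s => (S1 s (X s) mu om)%:E - (S2 s (X s) mu om)%:E)%E).
    exact: integrableB.
  by apply/funext => s; rewrite EFinB.
by rewrite RintegralB// -e1 -e2; ring.
Qed.

End transport_difference.

(** * Averages over directions and frequencies *)

Section averages_linear.
Context {R : realType}.
Local Notation leb := (@lebesgue_measure R).
Variable Om : set R.
Hypothesis mOm : measurable Om.

Lemma avg_mu_omE (F : R -> R -> R) :
  leb2.-integrable (`[-1, 1] `*` Om) (fun z => (F z.1 z.2)%:E) ->
  avg_mu_om Om F = (fine (leb Om))^-1 * (2^-1 *
    \int[(@leb2 R)]_(z in `[-1, 1] `*` Om) F z.1 z.2).
Proof.
move=> iF; rewrite /avg_mu_om /avg_om; congr (_ * _).
have mI : measurable (`[-1, 1] : set R) by exact: measurable_itv.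
have h := @Rintegral21 _ _ _ _ R leb leb _ _ mI mOm (fun z => F z.1 z.2) iF.
have i := @integrable_Rintegral21 _ _ _ _ R leb leb _ _ mI mOm (fun z => F z.1 z.2) iF.
rewrite [X in _ = _ * X](_ : _ = \int[(leb \x leb)%E]_(z in `[-1, 1] `*` Om) F z.1 z.2)//.
rewrite -h -RintegralZl//.
Qed.

Lemma avg_mu_omB (F G : R -> R -> R) :
  leb2.-integrable (`[-1, 1] `*` Om) (fun z => (F z.1 z.2)%:E) ->
  leb2.-integrable (`[-1, 1] `*` Om) (fun z => (G z.1 z.2)%:E) ->
  avg_mu_om Om (fun m om => F m om - G m om) = avg_mu_om Om F - avg_mu_om Om G.
Proof.
move=> iF iG; rewrite !avg_mu_omE// -?mulrBr.
  congr (_ * (_ * _)); rewrite RintegralB//; exact: measurableX.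
rewrite (_ : (fun z => _) = (fun z => (F z.1 z.2)%:E - (G z.1 z.2)%:E)%E).
  by apply: integrableB => //; exact: measurableX.
by apply/funext => z; rewrite EFinB.
Qed.

Lemma avg_mu_omZ (a : R) (F : R -> R -> R) :
  leb2.-integrable (`[-1, 1] `*` Om) (fun z => (F z.1 z.2)%:E) ->
  avg_mu_om Om (fun m om => F m om * a) = avg_mu_om Om F * a.
Proof.
move=> iF; rewrite !avg_mu_omE//.
  rewrite -!mulrA; congr (_ * (_ * _)); rewrite RintegralZr//; exact: measurableX.
rewrite (_ : (fun z => _) = (fun z => (F z.1 z.2)%:E * a%:E)%E).
  by apply: integrableZr => //; exact: measurableX.
by apply/funext => z; rewrite EFinM.
Qed.

(** Bound of an average by the integral of the modulus. *)
Lemma normr_avg_mu_om_angular_total (q : (R * R) * (R * R) -> \bar R)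
    (F : R -> R -> R) (y : R * R) :
  (leb Om < +oo)%E -> (0 < leb Om)%E -> (forall z, 0 <= q z)%E ->
  (forall m om, -1 <= m <= 1 -> Om om -> (`|F m om|%:E <= q (y, (m, om)))%E) ->
  measurable_fun setT q ->
  (`|avg_mu_om Om F|%:E <=
     ((2 * fine (leb Om))^-1)%:E * angular_total Om q y)%E.
Proof.
move=> Om_lty Om_gt0 q0 Fq mq; have V0 := vol_gt0 Om_gt0 Om_lty.
have inner om : Om om -> (`|avg_mu (F ^~ om)|%:E <=
    (2^-1)%:E * \int[leb]_(m in `[(-1)%R, 1%R]) q (y, (m, om)))%E.
  move=> Oom; rewrite /avg_mu normrM gtr0_norm ?invr_gt0// EFinM.
  apply: lee_wpmul2l; first by rewrite lee_fin.
  by apply: normr_Rintegral_le => m; rewrite /= in_itv/= => m1; exact: Fq.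
have mqy : measurable_fun setT (fun om : R => \int[leb]_(m in `[(-1)%R, 1%R]) q (y, (m, om)))%E.
  apply: (@measurable_integral_param _ _ _ _ R leb _ _ (fun z : R * R => q (y, (z.2, z.1)))) => //.
  by apply: (measurableT_comp mq); apply: measurable_fun_pair; mfun.
rewrite /avg_mu_om /avg_om normrM gtr0_norm ?invr_gt0// EFinM.
apply: (@le_trans _ _ ((fine (leb Om))^-1%:E *
   ((2^-1)%:E * angular_total Om q y))%E); last first.
  by rewrite muleA -EFinM invfM mulrC.
apply: lee_wpmul2l; first by rewrite lee_fin invr_ge0 ltW.
apply: (le_trans (@normr_Rintegral_le _ _ R leb Om _ _ inner)).
rewrite ge0_integralZl//; first exact: measurable_funTS.
by move=> om _; exact: integral_ge0.
Qed.

End averages_linear.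

(** * Dependence on the relaxation time: coefficients *)

Section integrable_bounded.
Context d (T : measurableType d) (R : realType).
Variable mu : {measure set T -> \bar R}.

Lemma integrable_bounded (D : set T) (F : T -> R) (M : R) : measurable D ->
  (mu D < +oo)%E -> measurable_fun D F -> (forall x, D x -> `|F x| <= M) ->
  mu.-integrable D (EFin \o F).
Proof.
move=> mD Doo mF FM; apply/integrableP; split; first exact/measurable_EFinP.
apply: (@le_lt_trans _ _ (\int[mu]_(x in D) M%:E)%E).
  by apply: le_integral_ge0 => // x Dx; rewrite lee_fin; exact: FM.
rewrite integral_cst//.
have : (mu D \is a fin_num)%E by rewrite ge0_fin_numE.
by case: (mu D) => // r _; rewrite -EFinM ltry.
Qed.

End integrable_bounded.

(** The source [phi] and the test function [psi] enter only through bounds and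
    measurability. *)
Section perturbation.
Context {R : realType}.
Local Notation leb := (@lebesgue_measure R).
Variables (Tf : R) (Om : set R) (v g : R -> R).
Variables (phi : R -> R -> R -> R) (psi : R -> R) (d c1 c2 c3 c4 Pphi Ppsi : R).
Hypothesis Tf0 : 0 < Tf.
Hypothesis mOm : measurable Om.
Hypothesis Om_gt0 : (0 < leb Om)%E.
Hypothesis Om_lty : (leb Om < +oo)%E.
Hypothesis v_gt0 : forall om, Om om -> 0 < v om.
Hypothesis mg : measurable_fun Om g.
Hypothesis g_in : forall om, Om om -> c3 < g om < c4.
Hypotheses (c1_gt0 : 0 < c1) (c3_gt0 : 0 < c3).
Hypothesis phi_le : forall t mu om, `|phi t mu om| <= Pphi.
Hypothesis psi_le : forall t, `|psi t| <= Ppsi.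
Hypothesis mpsi : measurable_fun setT psi.
Hypothesis mphi : forall om, measurable_fun setT (fun z : R * R => phi z.1 z.2 om).

Let V := fine (leb Om).
Let V0 : 0 < V. Proof. exact: vol_gt0. Qed.
Let adm := admissible Om c1 c2.
Let hs := hstar g.
Let hsbar tau := avg_om Om (hs tau).

Lemma exists_frequency : exists om, Om om.
Proof.
apply: contrapT => h; move: Om_gt0.
rewrite (_ : Om = set0) ?measure0 ?ltxx//.
by apply/seteqP; split => // om Oom; apply: h; exists om.
Qed.

Lemma c2_gt0 tau : adm tau -> 0 < c2.
Proof.
have [om Oom] := exists_frequency; move=> [_ /(_ _ Oom) /andP[h1 h2]].
by rewrite (lt_trans c1_gt0)// (lt_trans h1).
Qed.

(** [pert] is the perturbation in the [L^1]-norm, and [dist] the quantity in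
    which all differences are measured at a given frequency. *)
Definition pert (tau' tau : R -> R) := \int[leb]_(om in Om) `|tau' om - tau om|.
Definition dist (tau' tau : R -> R) om := `|tau' om - tau om| + pert tau' tau.

Lemma pert_ge0 tau' tau : 0 <= pert tau' tau.
Proof. exact: Rintegral_ge0. Qed.

Lemma dist_ge0 tau' tau om : 0 <= dist tau' tau om.
Proof. by rewrite addr_ge0// pert_ge0. Qed.

Lemma pert_le_dist tau' tau om : pert tau' tau <= dist tau' tau om.
Proof. by rewrite lerDr. Qed.

Lemma integrable_pert tau' tau : adm tau' -> adm tau ->
  leb.-integrable Om (EFin \o (fun om => `|tau' om - tau om|)).
Proof.
move=> [m' b'] [m b]; apply: (@integrable_bounded _ _ R leb Om _ (c2 - c1)) => //.
  by apply: measurableT_comp => //; exact: measurable_funB.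
move=> om Oom; rewrite normr_id ler_norml.
by have /andP[? ?] := b' _ Oom; have /andP[? ?] := b _ Oom; apply/andP; split; lra.
Qed.

Lemma integrable_dist tau' tau : adm tau' -> adm tau ->
  leb.-integrable Om (EFin \o (dist tau' tau)).
Proof.
move=> a' a; rewrite (_ : EFin \o _ =
  ((EFin \o (fun om => `|tau' om - tau om|%R)) \+ (EFin \o (fun=> pert tau' tau)))%E).
  by apply: integrableD => //; [exact: integrable_pert|exact: integrable_cst].
by apply/funext => om; rewrite /= -EFinD.
Qed.

Lemma avg_dist tau' tau : adm tau' -> adm tau ->
  avg_om Om (dist tau' tau) = (V^-1 + 1) * pert tau' tau.
Proof.
move=> a' a; rewrite /dist avg_omD//; last exact: integrable_cst.
  by rewrite avg_om_cst// mulrDl mul1r.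
exact: integrable_pert.
Qed.

Lemma integral_dist tau' tau : adm tau' -> adm tau ->
  \int[leb]_(om in Om) dist tau' tau om = (1 + V) * pert tau' tau.
Proof.
move=> a' a; rewrite /dist RintegralD//.
- by rewrite Rintegral_cst// -/V -/(pert tau' tau); ring.
- exact: integrable_pert.
- exact: integrable_cst.
Qed.

Lemma tau_in tau om : adm tau -> Om om -> [/\ c1 <= tau om, tau om <= c2 & 0 < tau om].
Proof.
move=> [_ b] /b /andP[h1 h2]; split; [exact: ltW|exact: ltW|].
exact: lt_trans h1.
Qed.

Lemma lip_tau tau' tau om : adm tau' -> adm tau -> Om om ->
  lip (c2 + 1) (dist tau' tau om) (tau' om) (tau om).
Proof.
move=> a' a Oom; have [h1' h2' h3'] := tau_in a' Oom; have [h1 h2 h3] := tau_in a Oom.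
split; [by rewrite gtr0_norm//; lra|by rewrite gtr0_norm//; lra|].
have d0 := dist_ge0 tau' tau om.
apply: (@le_trans _ _ (dist tau' tau om)); first by rewrite lerDl pert_ge0.
by rewrite ler_peMl//; have := c2_gt0 a; lra.
Qed.

Lemma lip_tauV : exists C, forall tau' tau om, adm tau' -> adm tau -> Om om ->
  lip C (dist tau' tau om) (tau' om)^-1 (tau om)^-1.
Proof.
eexists => tau' tau om a' a Oom.
have [h1' _ _] := tau_in a' Oom; have [h1 _ _] := tau_in a Oom.
exact: (lipV (dist_ge0 _ _ _) c1_gt0 h1' h1 (lip_tau a' a Oom)).
Qed.

Lemma lip_g tau' tau om : Om om -> lip c4 (dist tau' tau om) (g om) (g om).
Proof.
move=> /g_in /andP[g1 g2]; apply: lip_cst; first exact: dist_ge0.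
by rewrite gtr0_norm ?(lt_trans c3_gt0)// ltW.
Qed.

Lemma lip_hstar : exists C, forall tau' tau om, adm tau' -> adm tau -> Om om ->
  lip C (dist tau' tau om) (hs tau' om) (hs tau om).
Proof.
have [C hC] := lip_tauV.
eexists => tau' tau om a' a Oom.
by apply: (lipM (dist_ge0 _ _ _)); [exact: lip_g|exact: hC].
Qed.

Lemma measurable_hstar tau : adm tau -> measurable_fun Om (hs tau).
Proof.
move=> a; have [m b] := a; apply: measurable_funM => //.
have : measurable_fun Om (fun om => powR (tau om) (-1)).
  exact: (measurableT_comp (@measurable_powR R (-1)) m).
apply: eq_measurable_fun => om; rewrite inE => Oom.
by have [_ _ h] := tau_in a Oom; rewrite powR_inv1// ltW.
Qed.

Lemma hstar_in tau om : adm tau -> Om om ->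
  [/\ c3 / c2 <= hs tau om, hs tau om <= c4 / c1 & 0 < hs tau om].
Proof.
move=> a Oom; have [h1 h2 h3] := tau_in a Oom; have /andP[g1 g2] := g_in Oom.
have g0 : 0 < g om by exact: lt_trans g1.
have c20 := c2_gt0 a; split.
- by apply: ler_pM; rewrite ?invr_ge0 ?(ltW c3_gt0) ?(ltW c20) ?(ltW g1)// lef_pV2.
- by apply: ler_pM; rewrite ?invr_ge0 ?(ltW g0) ?(ltW h3) ?(ltW g2)// lef_pV2.
- by rewrite divr_gt0.
Qed.

Lemma integrable_hstar tau : adm tau -> leb.-integrable Om (EFin \o hs tau).
Proof.
move=> a; apply: (@integrable_bounded _ _ R leb Om _ (c4 / c1)) => //.
  exact: measurable_hstar.
by move=> om Oom; have [_ h1 h2] := hstar_in a Oom; rewrite gtr0_norm.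
Qed.

Lemma hsbar_ge tau : adm tau -> c3 / c2 <= hsbar tau.
Proof.
move=> a; have c0 : 0 <= c3 / c2 by rewrite divr_ge0 ?(ltW c3_gt0) ?(ltW (c2_gt0 a)).
rewrite -[leLHS]gtr0_norm ?divr_gt0 ?(c2_gt0 a)//.
rewrite -[in leLHS](avg_om_cst mOm Om_gt0 Om_lty (c3 / c2)).
apply: normr_avg_om_le => //; first exact: integrable_hstar.
by move=> om Oom; have [h _ _] := hstar_in a Oom; rewrite ger0_norm.
Qed.

Lemma lip_avg_om (C : R) tau' tau (F G : R -> R) : adm tau' -> adm tau ->
  leb.-integrable Om (EFin \o F) -> leb.-integrable Om (EFin \o G) ->
  (forall om, Om om -> lip C (dist tau' tau om) (F om) (G om)) ->
  lip (C * (V^-1 + 1)) (pert tau' tau) (avg_om Om F) (avg_om Om G).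
Proof.
move=> a' a iF iG FG.
have C0 : 0 <= C by have [om Oom] := exists_frequency; exact: lip_ge0 (FG _ Oom).
have CV : C <= C * (V^-1 + 1).
  by rewrite -[leLHS]mulr1 ler_wpM2l// lerDr invr_ge0 ltW.
have iC : leb.-integrable Om (EFin \o (fun=> C)) by exact: integrable_cst.
split.
- apply: le_trans CV; rewrite -[leRHS](avg_om_cst mOm Om_gt0 Om_lty).
  by apply: normr_avg_om_le => // om /FG[].
- apply: le_trans CV; rewrite -[leRHS](avg_om_cst mOm Om_gt0 Om_lty).
  by apply: normr_avg_om_le => // om /FG[].
- have -> : avg_om Om F - avg_om Om G = avg_om Om (fun om => F om - G om).
    by rewrite /avg_om RintegralB// mulrBr.
  rewrite -mulrA -(avg_dist a' a) -avg_omZ//; last exact: integrable_dist.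
  apply: normr_avg_om_le => //; last by move=> om /FG[].
  by apply: integrable_scale => //; exact: integrable_dist.
Qed.

Lemma lip_hsbar : exists C, forall tau' tau, adm tau' -> adm tau ->
  lip C (pert tau' tau) (hsbar tau') (hsbar tau).
Proof.
have [C hC] := lip_hstar; eexists => tau' tau a' a.
by apply: lip_avg_om => //; [exact: integrable_hstar|exact: integrable_hstar|move=> om Oom; exact: hC].
Qed.

Lemma lip_hsbarV : exists C, forall tau' tau, adm tau' -> adm tau ->
  lip C (pert tau' tau) (hsbar tau')^-1 (hsbar tau)^-1.
Proof.
have [C hC] := lip_hsbar; eexists => tau' tau a' a.
apply: (lipV (pert_ge0 _ _) _ (hsbar_ge a') (hsbar_ge a) (hC _ _ a' a)).
by rewrite divr_gt0 ?(c2_gt0 a).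
Qed.

(** The factor of the mean of [f] in [L[f] / tau]. *)
Definition gain tau om := (tau om)^-1 * (hs tau om * (hsbar tau)^-1).

Lemma collisionE tau F mu om : (tau om)^-1 * collision Om g tau F mu om =
  gain tau om * avg_mu_om Om F - (tau om)^-1 * F mu om.
Proof. by rewrite /collision /gain /hs /hsbar; ring. Qed.

Lemma lip_gain : exists C, forall tau' tau om, adm tau' -> adm tau -> Om om ->
  lip C (dist tau' tau om) (gain tau' om) (gain tau om).
Proof.
have [C1 h1] := lip_tauV; have [C2 h2] := lip_hstar; have [C3 h3] := lip_hsbarV.
eexists => tau' tau om a' a Oom; have D0 := dist_ge0 tau' tau om.
apply: (lipM D0); first exact: h1.
apply: (lipM D0); first exact: h2.
by apply: lip_leD (h3 _ _ a' a); exact: pert_le_dist.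
Qed.

(** * Dependence on the relaxation time: forward solution *)

Lemma measurable_extension (f : R -> R -> R -> R -> R) :
  measurable_fun (phase Tf Om) (uncurry4 f) ->
  measurable_fun setT (uncurry4 f \_ (phase Tf Om)).
Proof. by move=> mf; apply/(measurable_restrictT _ _).1 => //; exact: measurable_phase. Qed.

Lemma extensionE (f : R -> R -> R -> R -> R) t x mu om : in_phase Tf Om t x mu om ->
  (uncurry4 f \_ (phase Tf Om)) ((t, x), (mu, om)) = f t x mu om.
Proof. by move=> h; rewrite patchE mem_set. Qed.

(** An angular section of the forward solution is integrable, also on the
    boundary of the slab. *)
Lemma forward_section_integrable tau h t x : forward_solution Tf Om v g phi tau h ->
  0 <= t <= Tf -> 0 <= x <= 1 ->
  leb2.-integrable (`[-1, 1] `*` Om) (fun z => (h t x z.1 z.2)%:E).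
Proof.
move=> sol tT x1; have [M hM] := forward_bounded sol.
have mD : measurable (`[-1, 1] `*` Om : set (R * R)) by exact: measurableX.
have boxoo : ((leb \x leb) (`[(-1)%R, 1%R] `*` Om) < +oo)%E.
  rewrite product_measure1E//; apply: lte_mul_pinfty => //.
  by rewrite /= lebesgue_measure_itv/= lte_fin gtrN.
apply: (@integrable_bounded _ _ R (leb \x leb)%E _ (fun z => h t x z.1 z.2) M mD).
- exact: boxoo.
- have := measurable_extension (forward_measurable sol) => mh.
  have : measurable_fun (`[-1, 1] `*` Om : set (R * R))
      (fun z : R * R => (uncurry4 h \_ (phase Tf Om)) ((t, x), z)).
    by apply: measurable_funTS; apply: (measurableT_comp mh); mfun.
  apply: eq_measurable_fun => -[m om]; rewrite inE => -[/= m1 Oom].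
  by rewrite extensionE//; split => //; rewrite ?in_itv in m1 *.
- move=> [m om] [/= m1 Oom]; apply: hM; split => //.
Qed.

(** The constants [a] and [k] serve for all admissible [tau]. *)
Lemma forward_source_le : exists a k : R, [/\ 0 <= a, 0 <= k &
  forall tau F mu om, adm tau -> Om om ->
    `|(tau om)^-1 * collision Om g tau F mu om| <=
      a * `|F mu om| + k * `|avg_mu_om Om F|].
Proof.
have [a ha] := lip_tauV; have [k hk] := lip_gain.
exists `|a|, `|k|; split => // tau F mu om at_ Oom.
have [ha' _ _] := ha _ _ _ at_ at_ Oom; have [hk' _ _] := hk _ _ _ at_ at_ Oom.
rewrite collisionE; apply: le_trans (ler_normB _ _) _.
rewrite addrC (normrM (gain tau om)) (normrM (tau om)^-1).
apply: lerD; rewrite ler_wpM2r//.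
  exact: le_trans (ler_norm _).
exact: le_trans (ler_norm _).
Qed.

Lemma forward_bound : exists2 H, 0 <= H & forall tau h, adm tau ->
  forward_solution Tf Om v g phi tau h ->
  forall t x mu om, in_phase Tf Om t x mu om -> mu != 0 -> `|h t x mu om| <= H.
Proof.
have [a [k [a0 k0 src]]] := forward_source_le.
have [C C0 est] := forward_estimate Tf0 v_gt0 mOm Om_gt0 Om_lty a0 k0.
have P0 : 0 <= Pphi by exact: le_trans (phi_le 0 0 0).
exists (C * (Pphi / c1 + Pphi / c1)).
  by rewrite mulr_ge0 ?(ltW C0)// addr_ge0// divr_ge0// ltW.
move=> tau h at_ sol t x mu om ph mu0.
rewrite -[X in _ + X](avg_om_cst mOm Om_gt0 Om_lty).
apply: (est h _ (fun=> Pphi / c1) (forward_eq sol)) => //.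
- exact: forward_init sol.
- exact: forward_reflection sol.
- exact: forward_bounded sol.
- move=> t' m o tT m1 Oo; rewrite (forward_inflow sol)// normrM.
  have [h1 _ h3] := tau_in at_ Oo.
  by apply: ler_pM; rewrite // gtr0_norm ?invr_gt0// lef_pV2.
- move=> t' x' m o tT x1 m1 m0 Oo; apply: (le_trans (src _ _ _ _ at_ Oo)).
  by rewrite lerDl divr_ge0// ltW.
- exact: integrable_cst.
- by move=> _ _; rewrite divr_ge0// ltW.
Qed.

(** The forward solution depends on [tau] in a Lipschitz way, uniformly in [t],
    [x], [mu] and pointwise in [omega]. *)
Lemma forward_lip : exists C, forall tau' tau h' h, adm tau' -> adm tau ->
  forward_solution Tf Om v g phi tau' h' -> forward_solution Tf Om v g phi tau h ->
  forall t x mu om, in_phase Tf Om t x mu om -> mu != 0 ->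
    lip C (dist tau' tau om) (h' t x mu om) (h t x mu om).
Proof.
have [a [k [a0 k0 src]]] := forward_source_le.
have [H H0 hH] := forward_bound.
have [Ct ht] := lip_tauV; have [Cg hg] := lip_gain.
have [C C0 est] := forward_estimate Tf0 v_gt0 mOm Om_gt0 Om_lty a0 k0.
pose K := `|Pphi * Ct| + `|Cg * H| + `|Ct * H|.
have K0 : 0 <= K by rewrite !addr_ge0.
exists (H + C * (K * (2 + V^-1))) => tau' tau h' h a' at_ sol' sol t x mu om ph mu0.
have VV : 0 < V^-1 by rewrite invr_gt0.
have CK : 0 <= C * (K * (2 + V^-1)).
  by rewrite !mulr_ge0 ?(ltW C0)// addr_ge0// ltW.
have D0 := dist_ge0 tau' tau om.
split.
- by apply: (le_trans (hH _ _ a' sol' _ _ _ _ ph mu0)); rewrite lerDl.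
- by apply: (le_trans (hH _ _ at_ sol _ _ _ _ ph mu0)); rewrite lerDl.
apply: (@le_trans _ _ (C * (K * (2 + V^-1)) * dist tau' tau om)); last first.
  by rewrite ler_wpM2r// lerDr.
pose rho om := K * dist tau' tau om.
have irho : leb.-integrable Om (EFin \o rho).
  by apply: integrable_scale => //; exact: integrable_dist.
have avg_rho : avg_om Om rho <= K * ((1 + V^-1) * dist tau' tau om).
  rewrite avg_omZ//; last exact: integrable_dist.
  rewrite ler_wpM2l// avg_dist// addrC ler_wpM2l ?pert_le_dist//.
  by rewrite addr_ge0// ltW.
pose w t x mu om := h' t x mu om - h t x mu om.
have := est w _ rho (transport_eqB (forward_eq sol') (forward_eq sol)).
move=> E; apply: (le_trans (E _ _ _ _ _ _ _ _ _ _ _ ph mu0)).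
- by move=> x' m o x1 m1 Oo; rewrite /w (forward_init sol')// (forward_init sol)// subrr.
- by move=> t' m o tT m1 Oo; rewrite /w (forward_reflection sol')// (forward_reflection sol).
- have [M hM] := forward_bounded sol; have [M' hM'] := forward_bounded sol'.
  exists (M' + M) => t' x' m o p'; apply: le_trans (ler_normB _ _) _.
  by apply: lerD; [exact: hM'|exact: hM].
- move=> t' m o tT m1 Oo; rewrite /w (forward_inflow sol')// (forward_inflow sol)//.
  rewrite -mulrBr normrM; have [_ _ h3] := ht _ _ _ a' at_ Oo.
  apply: (@le_trans _ _ (Pphi * (Ct * dist tau' tau o))).
    by apply: ler_pM.
  rewrite mulrA ler_wpM2r ?dist_ge0//; apply: (le_trans (ler_norm _)).
  by rewrite /K -addrA lerDl addr_ge0.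
- move=> t' x' m o tT x1 m1 m0 Oo.
  have t01 : 0 <= t' <= Tf by case/andP: tT => /ltW -> /ltW ->.
  have x01 : 0 <= x' <= 1 by case/andP: x1 => /ltW -> /ltW ->.
  have p' : in_phase Tf Om t' x' m o by [].
  have avgw : avg_mu_om Om (w t' x') = avg_mu_om Om (h' t' x') - avg_mu_om Om (h t' x').
    by apply: avg_mu_omB => //; [exact: (forward_section_integrable sol')|exact: (forward_section_integrable sol)].
  set B' := avg_mu_om Om (h' t' x') in avgw *; set B := avg_mu_om Om (h t' x') in avgw *.
  rewrite !collisionE -/B' -/B avgw.
  have -> : gain tau' o * B' - (tau' o)^-1 * h' t' x' m o -
      (gain tau o * B - (tau o)^-1 * h t' x' m o) =
      (gain tau' o * (B' - B) - (tau' o)^-1 * (h' t' x' m o - h t' x' m o)) +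
      ((gain tau' o - gain tau o) * B - ((tau' o)^-1 - (tau o)^-1) * h t' x' m o).
    by ring.
  apply: le_trans (ler_normD _ _) _; apply: lerD.
    by have := src tau' (w t' x') m o a' Oo; rewrite collisionE avgw.
  have [_ _ h3] := ht _ _ _ a' at_ Oo; have [_ _ h4] := hg _ _ _ a' at_ Oo.
  have hB : `|B| <= H.
    rewrite -[leRHS](avg_om_cst mOm Om_gt0 Om_lty).
    apply: normr_avg_mu_om_le => //; first exact: integrable_cst.
    by move=> m' o' m'1 m'0 Oo'; apply: (hH _ _ at_ sol).
  apply: le_trans (ler_normB _ _) _.
  rewrite (normrM (gain tau' o - gain tau o)) (normrM ((tau' o)^-1 - (tau o)^-1)).
  apply: (@le_trans _ _ (Cg * dist tau' tau o * H + Ct * dist tau' tau o * H)).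
    by apply: lerD; apply: ler_pM => //; exact: (hH _ _ at_ sol).
  rewrite /rho /K -!(mulrAC _ H) -mulrDl ler_wpM2r ?dist_ge0//.
  apply: lerD; last exact: ler_norm.
  by apply: le_trans (ler_norm _) _; rewrite lerDr.
- exact: irho.
- by move=> o Oo; rewrite mulr_ge0// dist_ge0.
- rewrite -mulrA ler_wpM2l ?(ltW C0)// -mulrA.
  apply: (le_trans (lerD (lexx _) avg_rho)); rewrite /rho -mulrDr ler_wpM2l//.
  by rewrite le_eqVlt; apply/orP; left; apply/eqP; ring.
Qed.

Lemma lip_avg_mu_om (C : R) tau' tau (F G : R -> R -> R) : adm tau' -> adm tau ->
  leb2.-integrable (`[-1, 1] `*` Om) (fun z => (F z.1 z.2)%:E) ->
  leb2.-integrable (`[-1, 1] `*` Om) (fun z => (G z.1 z.2)%:E) ->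
  (forall mu om, -1 <= mu <= 1 -> mu != 0 -> Om om ->
     lip C (dist tau' tau om) (F mu om) (G mu om)) ->
  lip (C * (V^-1 + 1)) (pert tau' tau) (avg_mu_om Om F) (avg_mu_om Om G).
Proof.
move=> a' a iF iG FG.
have C0 : 0 <= C.
  have [om Oom] := exists_frequency; apply: lip_ge0 (FG 1 om _ _ Oom) => //.
  by rewrite lexx andbT; lra.
have CV : C <= C * (V^-1 + 1).
  by rewrite -[leLHS]mulr1 ler_wpM2l// lerDr invr_ge0 ltW.
have iC : leb.-integrable Om (EFin \o (fun=> C)) by exact: integrable_cst.
split.
- apply: le_trans CV; rewrite -[leRHS](avg_om_cst mOm Om_gt0 Om_lty).
  by apply: normr_avg_mu_om_le => // mu om m1 m0 Oom; have [] := FG mu om m1 m0 Oom.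
- apply: le_trans CV; rewrite -[leRHS](avg_om_cst mOm Om_gt0 Om_lty).
  by apply: normr_avg_mu_om_le => // mu om m1 m0 Oom; have [] := FG mu om m1 m0 Oom.
- rewrite -avg_mu_omB// -mulrA -(avg_dist a' a) -avg_omZ//; last exact: integrable_dist.
  apply: normr_avg_mu_om_le => //.
  + by apply: integrable_scale => //; exact: integrable_dist.
  + by move=> om Oom; rewrite mulr_ge0// dist_ge0.
  + by move=> mu om m1 m0 Oom; have [] := FG mu om m1 m0 Oom.
Qed.

Lemma lip_avg_t (C D : R) (F G : R -> R) : 0 <= C -> 0 <= D ->
  measurable_fun `]0, Tf[ F -> measurable_fun `]0, Tf[ G ->
  (forall t, 0 < t < Tf -> lip C D (F t) (G t)) ->
  lip (C * Tf) D (avg_t Tf F) (avg_t Tf G).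
Proof.
move=> C0 D0 mF mG FG.
have vol : leb `]0, Tf[ = Tf%:E.
  by rewrite lebesgue_measure_itv/= lte_fin Tf0 -EFinD subr0.
have bound (H : R -> R) (M : R) : (forall t, 0 < t < Tf -> `|H t| <= M) ->
    `|avg_t Tf H| <= M * Tf.
  move=> HM; rewrite -lee_fin.
  apply: (le_trans (@normr_Rintegral_le _ _ R leb _ _ (cst M%:E) _)).
    by move=> t; rewrite /= in_itv/= lee_fin; exact: HM.
  by rewrite integral_cst//= vol.
have int (H : R -> R) : measurable_fun `]0, Tf[ H ->
    (forall t, 0 < t < Tf -> `|H t| <= C) -> leb.-integrable `]0, Tf[ (EFin \o H).
  move=> mH HC; apply: (@integrable_bounded _ _ R leb _ _ C) => //.
  by have := ltry Tf; rewrite -vol.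
split.
- by apply: bound => t /FG[].
- by apply: bound => t /FG[].
- rewrite /avg_t -RintegralB//; last 2 first.
  + by apply: int => // t /FG[].
  + by apply: int => // t /FG[].
  by rewrite mulrAC; apply: bound => t /FG[].
Qed.

Lemma measurable_avg_extension (f : R -> R -> R -> R -> R) :
  measurable_fun (phase Tf Om) (uncurry4 f) ->
  measurable_fun setT (fun y : R * R => avg_mu_om Om (fun mu om =>
     (uncurry4 f \_ (phase Tf Om)) (y, (mu, om)))).
Proof.
move=> /measurable_extension mf.
apply: measurable_funM => //.
apply: (@measurable_Rintegral_param _ _ _ _ R leb Om mOm (fun z : (R * R) * R =>
  avg_mu (fun mu => (uncurry4 f \_ (phase Tf Om)) (z.1, (mu, z.2))))).
apply: measurable_funM => //.
apply: (@measurable_Rintegral_param _ _ _ _ R leb _ _ (fun z : ((R * R) * R) * R =>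
  (uncurry4 f \_ (phase Tf Om)) (z.1.1, (z.2, z.1.2)))) => //.
apply: (measurableT_comp mf); apply: measurable_fun_pair; first exact: measurableT_comp.
by apply: measurable_fun_pair; [mfun|exact: measurableT_comp].
Qed.

Lemma avg_extensionE (f : R -> R -> R -> R -> R) t x :
  0 <= t <= Tf -> 0 <= x <= 1 ->
  avg_mu_om Om (fun mu om => (uncurry4 f \_ (phase Tf Om)) ((t, x), (mu, om))) =
  avg_mu_om Om (f t x).
Proof.
move=> tT x1; congr (_ * _); apply: eq_Rintegral => om; rewrite inE => Oom.
congr (_ * _); apply: eq_Rintegral => mu; rewrite inE/= in_itv/= => mu1.
exact: extensionE.
Qed.

Lemma measurable_avg_face (f : R -> R -> R -> R -> R) x : 0 <= x <= 1 ->
  measurable_fun (phase Tf Om) (uncurry4 f) ->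
  measurable_fun `]0, Tf[ (fun t => avg_mu_om Om (f t x)).
Proof.
move=> x1 /measurable_avg_extension mf.
have : measurable_fun `]0, Tf[ (fun t => avg_mu_om Om (fun mu om =>
     (uncurry4 f \_ (phase Tf Om)) ((t, x), (mu, om)))).
  by apply: measurable_funTS; apply: (measurableT_comp mf); mfun.
apply: eq_measurable_fun => t; rewrite inE/= in_itv/= => /andP[t0 tT].
by rewrite avg_extensionE// !ltW.
Qed.

Lemma forward_avg_lip : exists2 C, 0 <= C & forall tau' tau h' h, adm tau' -> adm tau ->
  forward_solution Tf Om v g phi tau' h' -> forward_solution Tf Om v g phi tau h ->
  forall t x, 0 <= t <= Tf -> 0 <= x <= 1 ->
    lip C (pert tau' tau) (avg_mu_om Om (h' t x)) (avg_mu_om Om (h t x)).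
Proof.
have [C hC] := forward_lip; exists (`|C| * (V^-1 + 1)).
  by rewrite mulr_ge0// addr_ge0// invr_ge0 ltW.
move=> tau' tau h' h a' a sol' sol t x tT x1; apply: lip_avg_mu_om => //.
- exact: forward_section_integrable sol' tT x1.
- exact: forward_section_integrable sol tT x1.
- move=> mu om m1 m0 Oom; apply: lip_le (ler_norm C) _; first exact: dist_ge0.
  exact: (hC _ _ _ _ a' a sol' sol).
Qed.

Lemma psi_bound_ge0 : 0 <= Ppsi.
Proof. exact: le_trans (psi_le 0). Qed.

Lemma mismatch_lip : exists C, forall tau' tau h' h, adm tau' -> adm tau ->
  forward_solution Tf Om v g phi tau' h' -> forward_solution Tf Om v g phi tau h ->
  lip C (pert tau' tau) (mismatch Tf Om g psi d tau' h') (mismatch Tf Om g psi d tau h).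
Proof.
have [Ca Ca0 ha] := forward_avg_lip; have [Cb hb] := lip_hsbarV.
have P0 := psi_bound_ge0.
exists (2 * (2 * (Ca * `|Cb|) * Ppsi) * Tf + `|d|) => tau' tau h' h a' a sol' sol.
have N0 := pert_ge0 tau' tau.
have x0 : 0 <= (0 : R) <= 1 by rewrite lexx ler01.
have ma tau0 h0 : forward_solution Tf Om v g phi tau0 h0 ->
    measurable_fun `]0, Tf[ (fun t => avg_mu_om Om (h0 t 0) / avg_om Om (hstar g tau0) * psi t).
  move=> sol0; apply: measurable_funM; last exact: measurable_funTS.
  apply: measurable_funM => //.
  by apply: measurable_avg_face => //; exact: forward_measurable sol0.
apply: lipB; last exact: lip_cst.
apply: lip_avg_t => //; [by rewrite !mulr_ge0|exact: ma|exact: ma|].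
move=> t /andP[t0 tT]; have t01 : 0 <= t <= Tf by rewrite !ltW.
apply: lipM => //; last exact: lip_cst.
apply: lipM => //; first exact: (ha _ _ _ _ a' a sol' sol).
by apply: lip_le (ler_norm _) (hb _ _ a' a).
Qed.

Lemma boundary_avg_lip : exists C, forall tau' tau h' h, adm tau' -> adm tau ->
  forward_solution Tf Om v g phi tau' h' -> forward_solution Tf Om v g phi tau h ->
  lip C (pert tau' tau)
    (avg_t Tf (fun t => avg_mu_om Om (fun mu om => h' t 0 mu om * psi t)))
    (avg_t Tf (fun t => avg_mu_om Om (fun mu om => h t 0 mu om * psi t))).
Proof.
have [Ca Ca0 ha] := forward_avg_lip.
have P0 := psi_bound_ge0.
exists (2 * (Ca * Ppsi) * Tf) => tau' tau h' h a' a sol' sol.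
have N0 := pert_ge0 tau' tau.
have x0 : 0 <= (0 : R) <= 1 by rewrite lexx ler01.
have E tau0 h0 t : forward_solution Tf Om v g phi tau0 h0 -> 0 < t < Tf ->
    avg_mu_om Om (fun mu om => h0 t 0 mu om * psi t) = avg_mu_om Om (h0 t 0) * psi t.
  move=> sol0 /andP[t0 tT]; apply: avg_mu_omZ => //.
  by apply: (forward_section_integrable sol0); rewrite // !ltW.
have ma tau0 h0 : forward_solution Tf Om v g phi tau0 h0 -> measurable_fun `]0, Tf[
    (fun t => avg_mu_om Om (fun mu om => h0 t 0 mu om * psi t)).
  move=> sol0.
  have : measurable_fun `]0, Tf[ (fun t => avg_mu_om Om (h0 t 0) * psi t).
    apply: measurable_funM; last exact: measurable_funTS.
    by apply: measurable_avg_face => //; exact: forward_measurable sol0.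
  by apply: eq_measurable_fun => t; rewrite inE/= in_itv/= => tT; rewrite (E _ _ _ sol0).
apply: (lip_avg_t _ N0 (ma _ _ sol') (ma _ _ sol)); first by rewrite !mulr_ge0.
move=> t tT; rewrite (E _ _ _ sol' tT) (E _ _ _ sol tT).
apply: lipM => //; last exact: lip_cst.
by apply: (ha _ _ _ _ a' a sol' sol) => //; case/andP: tT => /ltW -> /ltW ->.
Qed.

(** * Dependence on the relaxation time: adjoint solution *)

Lemma measurable_adjoint tau l p : adjoint_solution Tf Om v g psi tau l p ->
  measurable_fun (phase Tf Om) (uncurry4 p).
Proof. by move=> sol; apply/measurable_EFinP; exact: measurable_int (adjoint_integrable sol). Qed.

Lemma integral_mass_lty (lam : R) (q : (R * R) * (R * R) -> \bar R) : 0 < lam ->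
  measurable_fun setT q -> (forall z, 0 <= q z)%E ->
  (\int[leb]_t \int[leb]_x \int[leb]_om \int[leb]_m q ((t, x), (m, om)) < +oo)%E ->
  (\int[leb]_(om in Om) mass Tf lam q om < +oo)%E.
Proof.
move=> lam0 mq q0; set Q := (\int[leb]_t _)%E => Qoo.
pose Tq := angular_total Om q.
have Tq0 y : (0 <= Tq y)%E by exact: angular_total_ge0.
have mTq : measurable_fun setT Tq by exact: measurable_angular_total.
have total_le y : (Tq y <= \int[leb]_om \int[leb]_m q (y, (m, om)))%E.
  rewrite /Tq /angular_total [leLHS]integral_mkcond; apply: le_integral_ge0 => om _.
    by apply: erestrict_ge0 => o _; exact: integral_ge0.
  rewrite patchE; case: ifPn => _; last exact: integral_ge0.
  rewrite [leLHS]integral_mkcond; apply: le_integral_ge0 => m _.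
    by apply: erestrict_ge0.
  by rewrite patchE; case: ifPn.
pose E := expR (lam * Tf).
rewrite -slab_int_angular_total// -/Tq; clearbody Tq.
have E0 : (0 <= E%:E)%E by rewrite lee_fin expR_ge0.
pose I t := (\int[leb]_(x in `]0%R, 1%R[) Tq (t, x))%E.
have mI : measurable_fun setT I.
  exact: (@measurable_integral_param _ _ _ _ R leb _ _ Tq).
have I0 t : (0 <= I t)%E by apply: integral_ge0 => x _; exact: Tq0.
have Q0 : (0 <= Q)%E.
  by apply: integral_ge0 => t _; apply: integral_ge0 => x _; apply: integral_ge0 => om _; exact: integral_ge0.
have wE t : t < Tf -> (weight lam t <= E%:E)%E.
  by move=> tT; apply: weight_le; exact: ltW.
have -> : slab_int Tf lam Tq = (\int[leb]_(t in `]0%R, Tf[) (weight lam t * I t))%E by [].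
have IQ : (\int[leb]_(t in `]0%R, Tf[) I t <= Q)%E.
  rewrite [leLHS]integral_mkcond; apply: le_integral_ge0 => t _.
    by apply: erestrict_ge0 => t' _; exact: I0.
  rewrite patchE; case: ifPn => _; last first.
    by apply: integral_ge0 => x _; apply: integral_ge0 => om _; exact: integral_ge0.
  rewrite /I [leLHS]integral_mkcond; apply: le_integral_ge0 => x _.
    by apply: erestrict_ge0 => x' _; exact: Tq0.
  rewrite patchE; case: ifPn => _; first exact: total_le.
  by apply: integral_ge0 => om _; exact: integral_ge0.
clearbody I Q E.
apply: (@le_lt_trans _ _ (\int[leb]_(t in `]0%R, Tf[) (E%:E * I t))%E).
  apply: le_integral_ge0 => t; first by move=> _; apply: mule_ge0; rewrite ?lee_fin ?weight_ge0.
  rewrite /= in_itv/= => /andP[_ tT]; apply: lee_wpmul2r; first exact: I0.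
  exact: wE.
have mI' : measurable_fun (`]0, Tf[ : set R) I by exact: measurable_funTS.
have -> : (\int[leb]_(t in `]0%R, Tf[) (E%:E * I t) = E%:E * \int[leb]_(t in `]0%R, Tf[) I t)%E.
  by apply: ge0_integralZl.
apply: (@le_lt_trans _ _ (E%:E * Q)%E); first exact: lee_wpmul2l.
by move: Qoo Q0; case: (Q) => // r _ _; rewrite -EFinM ltry.
Qed.

Lemma mass_finite (lam : R) (f : R -> R -> R -> R -> R) : 0 < lam ->
  (leb2 \x leb2)%E.-integrable (phase Tf Om) (EFin \o uncurry4 f) ->
  (\int[leb]_(om in Om) mass Tf lam (modulus Tf Om f) om < +oo)%E.
Proof.
move=> lam0 int_f; have mf := measurable_int _ int_f.
apply: (@integral_mass_lty lam _ lam0).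
- by apply: (measurable_modulus mOm); exact/measurable_EFinP.
- exact: modulus_ge0.
- exact: (@integrable4 _ _ _ _ _ _ _ _ R leb leb leb leb (phase Tf Om)
    (EFin \o uncurry4 f) (measurable_phase Tf mOm) int_f).
Qed.

(** The inflow flux is bounded although the inflow datum is not. *)
Lemma adjoint_inflowE tau l p t mu om :
  adjoint_solution Tf Om v g psi tau l p -> 0 <= t < Tf -> -1 <= mu < 0 -> Om om ->
  p t 0 mu om * (mu * v om) = l * gain tau om * psi t.
Proof.
move=> sol tT m1 Oom; rewrite (adjoint_inflow sol)// /gain /hs /hsbar.
set b := avg_om _ _; set c := hstar _ _ _.
have v0 : v om != 0 by rewrite gt_eqF// v_gt0.
have m0 : mu != 0 by case/andP: m1 => _ /lt_eqF ->.
clearbody b c; rewrite !invfM.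
transitivity (l * (c * ((mu^-1 * mu) * ((v om)^-1 * v om) *
    (tau om)^-1 * b^-1)) * psi t); first by ring.
by rewrite !mulVf//; ring.
Qed.

Lemma normr_avg_modulus (f : R -> R -> R -> R -> R) t x :
  measurable_fun (phase Tf Om) (uncurry4 f) -> 0 <= t <= Tf -> 0 <= x <= 1 ->
  (`|avg_mu_om Om (f t x)|%:E <=
    ((2 * V)^-1)%:E * angular_total Om (modulus Tf Om f) (t, x))%E.
Proof.
move=> mf tT x1; apply: (normr_avg_mu_om_angular_total mOm) => //.
- by move=> m om m1 Oom; rewrite modulusE.
- exact: measurable_modulus.
Qed.

(** The modulus of [f] plus a bound of the modulus of its angular mean. *)
Definition modulus_mean (f : R -> R -> R -> R -> R) (z : (R * R) * (R * R)) : \bar R :=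
  (modulus Tf Om f z + ((2 * V)^-1)%:E * angular_total Om (modulus Tf Om f) z.1)%E.

Lemma half_volV_ge0 : 0 <= (2 * V)^-1.
Proof. by rewrite invr_ge0; have := V0; lra. Qed.

Lemma modulus_mean_ge0 f z : (0 <= modulus_mean f z)%E.
Proof.
apply: adde_ge0; first exact: modulus_ge0.
apply: mule_ge0; first by rewrite lee_fin half_volV_ge0.
by apply: angular_total_ge0; exact: modulus_ge0.
Qed.

Lemma measurable_modulus_mean f : measurable_fun (phase Tf Om) (uncurry4 f) ->
  measurable_fun setT (modulus_mean f).
Proof.
move=> mf; have mq := measurable_modulus mOm mf.
apply: emeasurable_funD; first exact: mq.
apply: emeasurable_funM; first exact: measurable_cst.
apply: measurableT_comp; last exact: measurable_fst.
by apply: (measurable_angular_total mOm mq); exact: modulus_ge0.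
Qed.

Lemma mass_modulus_mean lam f om : measurable_fun (phase Tf Om) (uncurry4 f) ->
  mass Tf lam (modulus_mean f) om = (mass Tf lam (modulus Tf Om f) om +
    (V^-1)%:E * \int[leb]_(o in Om) mass Tf lam (modulus Tf Om f) o)%E.
Proof.
move=> mf; have mq := measurable_modulus mOm mf.
have q0 := @modulus_ge0 R Tf Om f.
have mT := measurable_angular_total mOm mq q0.
set q := modulus Tf Om f in mq q0 mT *.
have T0 z : (0 <= angular_total Om q z)%E by exact: angular_total_ge0.
have mTz : measurable_fun setT (fun z : (R * R) * (R * R) => angular_total Om q z.1).
  by apply: (measurableT_comp mT); exact: measurable_fst.
have iV := half_volV_ge0.
rewrite /modulus_mean -/q massD//; last 2 first.
- by apply: emeasurable_funM => //; exact: measurable_cst.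
- by move=> z; apply: mule_ge0.
rewrite (massZ Tf lam om iV mTz (fun z => T0 z.1)) (mass_angular_total Tf lam mOm om mq q0).
congr (_ + _)%E.
by rewrite muleA -EFinM invfM mulrAC mulVf ?mul1r.
Qed.

Lemma normr_modulus_mean f t x mu om : measurable_fun (phase Tf Om) (uncurry4 f) ->
  in_phase Tf Om t x mu om ->
  ((`|f t x mu om| + `|avg_mu_om Om (f t x)|)%:E <= modulus_mean f ((t, x), (mu, om)))%E.
Proof.
move=> mf ph; rewrite EFinD; apply: leeD; first by rewrite modulusE.
by case: ph => tT x1 _ _; exact: normr_avg_modulus.
Qed.

(** The difference of two adjoint solutions solves an adjoint problem whose
    inflow flux and exterior source are bounded by multiples of [dist]; hence so
    are its mass and its outgoing flux. *)
Lemma adjoint_stability : exists lam C : R, [/\ 0 < lam, 0 <= C &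
  forall tau' tau h' h p' p, adm tau' -> adm tau ->
  forward_solution Tf Om v g phi tau' h' -> forward_solution Tf Om v g phi tau h ->
  adjoint_solution Tf Om v g psi tau' (mismatch Tf Om g psi d tau' h') p' ->
  adjoint_solution Tf Om v g psi tau (mismatch Tf Om g psi d tau h) p ->
  let q' := modulus Tf Om p' in
  let q := modulus Tf Om p in
  let w := modulus Tf Om (fun t x mu om => p' t x mu om - p t x mu om) in
  let N r := (\int[leb]_(om in Om) mass Tf lam r om)%E in
  [/\ (N q' <= C%:E)%E, (N q <= C%:E)%E, (N w <= (C * pert tau' tau)%:E)%E &
    {ae leb, forall om, Om om -> [/\
      (mass Tf lam q' om <= C%:E)%E /\ (flux Tf lam v q' om <= C%:E)%E,
      (mass Tf lam q om <= C%:E)%E /\ (flux Tf lam v q om <= C%:E)%E &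
      (mass Tf lam w om <= (C * dist tau' tau om)%:E)%E /\
      (flux Tf lam v w om <= (C * dist tau' tau om)%:E)%E]}]].
Proof.
have [a [k [a0 k0 src]]] := forward_source_le.
have [Cl hl] := mismatch_lip; have [Cg hg] := lip_gain; have [Ct ht] := lip_tauV.
have VV := V0; have iV0 : 0 <= (2 * V)^-1 by rewrite invr_ge0; lra.
have kV0 : 0 <= k * (2 * V)^-1 by rewrite mulr_ge0.
have [lam [C [lam0 C0 est]]] := adjoint_estimate Tf0 mOm Om_lty v_gt0 a0 kV0.
have P0 := psi_bound_ge0.
have srcE (tau : R -> R) f t x mu om : adm tau -> measurable_fun (phase Tf Om) (uncurry4 f) ->
    0 <= t <= Tf -> 0 <= x <= 1 -> -1 <= mu <= 1 -> Om om ->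
    (`|(tau om)^-1 * collision Om g tau (f t x) mu om|%:E <=
     a%:E * modulus Tf Om f ((t, x), (mu, om)) +
     (k * (2 * V)^-1)%:E * angular_total Om (modulus Tf Om f) (t, x))%E.
  move=> at_ mf tT x1 m1 Oom; rewrite modulusE//.
  apply: (@le_trans _ _ (a * `|f t x mu om| + k * `|avg_mu_om Om (f t x)|)%:E).
    by rewrite lee_fin; exact: src.
  rewrite EFinD !EFinM -muleA; apply: leeD => //.
  by apply: lee_wpmul2l; [rewrite lee_fin|exact: normr_avg_modulus].
(* the solutions themselves *)
pose B := `|Cl| * `|Cg| * Ppsi.
have B0 : 0 <= B by rewrite !mulr_ge0.
pose P := C * (B + V * B).
have P_ge0 : 0 <= P by rewrite mulr_ge0 ?(ltW C0)// addr_ge0// mulr_ge0// ltW.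
have CVB : C * (V * B) <= P by rewrite ler_wpM2l ?(ltW C0)// lerDr.
have inflow_le (tau : R -> R) l p t mu om :
    adjoint_solution Tf Om v g psi tau l p -> 0 <= t < Tf -> -1 <= mu < 0 -> Om om ->
    `|p t 0 mu om| * (`|mu| * v om) = `|l * gain tau om * psi t|.
  move=> adj tT m1 Oom; rewrite -(adjoint_inflowE adj tT m1 Oom) !normrM.
  by rewrite (gtr0_norm (v_gt0 Oom)).
have bound tau h p : adm tau -> forward_solution Tf Om v g phi tau h ->
    adjoint_solution Tf Om v g psi tau (mismatch Tf Om g psi d tau h) p ->
    let q := modulus Tf Om p in
    (\int[leb]_(om in Om) mass Tf lam q om <= P%:E)%E /\
    {ae leb, forall om, Om om -> (mass Tf lam q om <= P%:E)%E /\
      (flux Tf lam v q om <= P%:E)%E}.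
  move=> at_ sol adj q; have mp := measurable_adjoint adj.
  have [e1 e2] : (\int[leb]_(om in Om) mass Tf lam q om <= (C * (V * B))%:E)%E /\
    {ae leb, forall om, Om om -> (mass Tf lam q om <= P%:E)%E /\
      (flux Tf lam v q om <= P%:E)%E}.
    have -> : V * B = \int[leb]_(om in Om) B by rewrite Rintegral_cst// mulrC.
    have -> : P = C * (B + \int[leb]_(om in Om) B) by rewrite Rintegral_cst// (mulrC B).
    apply: (est p _ (fun=> 0%E) (fun=> B) (adjoint_eq adj) (adjoint_final adj)
      (adjoint_reflection adj) (measurable_modulus mOm mp)
      (mass_finite lam0 (adjoint_integrable adj))) => //.
    - move=> t mu om tT m1 Oom; rewrite (inflow_le _ _ _ _ _ _ adj)// normrM
        (normrM (mismatch _ _ _ _ _ _ _)).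
      have [_ lb _] := hl _ _ _ _ at_ at_ sol sol.
      have [_ gb _] := hg _ _ _ at_ at_ Oom.
      apply: ler_pM => //; apply: ler_pM => //.
        exact: le_trans (ler_norm _).
      exact: le_trans (ler_norm _).
    - move=> t x mu om /andP[t0 tT] /andP[x0 x1] m1 _ Oom; rewrite normrN adde0.
      by apply: srcE; rewrite // !ltW.
    - exact: integrable_cst.
    - apply: aeW => om _.
      by rewrite /mass integral0_eq// => m _; rewrite /slab_int integral0_eq// => t _; rewrite integral0_eq// mule0.
  split => //; apply: (le_trans e1); by rewrite lee_fin.
(* their difference, whose exterior source comes from the difference of the
   coefficients and is bounded by [r] below *)
pose K := `|Cg| + `|Ct|; have K0 : 0 <= K by rewrite addr_ge0.
pose Kin := 2 * (`|Cl| * `|Cg|) * Ppsi.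
have Kin0 : 0 <= Kin by rewrite !mulr_ge0.
have V1 : 0 <= V^-1 by rewrite invr_ge0 ltW.
have iVP : 0 <= V^-1 * P by rewrite mulr_ge0.
pose K2 := Kin + K * (P + V^-1 * P).
have K20 : 0 <= K2 by rewrite addr_ge0// mulr_ge0// addr_ge0.
have CK0 : 0 <= C * (K2 * (2 + V)).
  by rewrite mulr_ge0 ?(ltW C0)// mulr_ge0//; lra.
exists lam, (P + C * (K2 * (2 + V))); split => //; first exact: addr_ge0.
move=> tau' tau h' h p' p a' at_ sol' sol adj' adj q' q w N.
have [B1' B2'] := bound _ _ _ a' sol' adj'.
have [B1 B2] := bound _ _ _ at_ sol adj.
have mp := measurable_adjoint adj; have mp' := measurable_adjoint adj'.
pose D om := dist tau' tau om.
have D0 om : 0 <= D om by exact: dist_ge0.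
have pert0 := pert_ge0 tau' tau.
pose KD := (EFin \o (fun om => K * D om)) \_ Om.
have KD0 : forall om, (0 <= KD om)%E.
  by move=> om; apply: erestrict_ge0 => o _; rewrite lee_fin mulr_ge0.
have mKD : measurable_fun setT KD.
  apply/(measurable_restrictT _ mOm).
  by apply/measurable_EFinP; apply: measurable_funM => //; apply/measurable_EFinP;
    exact: measurable_int (integrable_dist a' at_).
have KDE om : Om om -> KD om = (K * D om)%:E by move=> Oom; rewrite /KD patchE mem_set.
have mq2 := measurable_modulus_mean mp; have q20 := modulus_mean_ge0 p.
pose r z := (KD z.2.2 * modulus_mean p z)%E.
have mr : measurable_fun setT r.
  apply: emeasurable_funM => //; apply: (measurableT_comp mKD).
  by apply: measurableT_comp; [exact: measurable_snd|exact: measurable_snd].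
have r0 : forall z, (0 <= r z)%E by move=> z; apply: mule_ge0.
have massr om : Om om -> (mass Tf lam q om <= P%:E)%E ->
    (mass Tf lam r om <= (K * (P + V^-1 * P) * D om)%:E)%E.
  move=> Oom mqP.
  have -> : mass Tf lam r om = mass Tf lam (fun z => (K * D om)%:E * modulus_mean p z)%E om.
    by apply: eq_integral => m _; congr slab_int; apply/funext => z; rewrite /r /= KDE.
  have KD0' : 0 <= K * D om by rewrite mulr_ge0.
  rewrite (massZ Tf lam om KD0' mq2 q20) (mass_modulus_mean lam om mp) mulrAC.
  rewrite (EFinM (K * D om)); apply: lee_wpmul2l; first by rewrite lee_fin.
  rewrite (EFinD P); apply: leeD; first exact: mqP.
  by rewrite (EFinM V^-1); apply: (lee_wpmul2l _ B1); rewrite lee_fin.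
pose f := fun t x mu om => p' t x mu om - p t x mu om.
have mf : measurable_fun (phase Tf Om) (uncurry4 f) by exact: measurable_funB.
have intf : (leb2 \x leb2)%E.-integrable (phase Tf Om) (EFin \o uncurry4 f).
  exact: (@integrableB4 _ _ _ _ _ _ _ _ R leb leb leb leb _ (uncurry4 p')
    (uncurry4 p) (measurable_phase Tf mOm) (adjoint_integrable adj')
    (adjoint_integrable adj)).
have [e1 e2] : (\int[leb]_(om in Om) mass Tf lam w om <= (C * (K2 * ((1 + V) * pert tau' tau)))%:E)%E /\
    {ae leb, forall om, Om om ->
      (mass Tf lam w om <= (C * (K2 * D om + K2 * ((1 + V) * pert tau' tau)))%:E)%E /\
      (flux Tf lam v w om <= (C * (K2 * D om + K2 * ((1 + V) * pert tau' tau)))%:E)%E}.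
  have iD := integrable_dist a' at_.
  have -> : K2 * ((1 + V) * pert tau' tau) = \int[leb]_(om in Om) (K2 * D om).
    by rewrite RintegralZl// integral_dist.
  apply: (est f _ r (fun om => K2 * D om) (transport_eqB (adjoint_eq adj') (adjoint_eq adj))
    _ _ (measurable_modulus mOm mf) (mass_finite lam0 intf)) => //.
  - by move=> x mu om x1 m1 Oom; rewrite /f (adjoint_final adj')// (adjoint_final adj)// subrr.
  - by move=> t mu om tT m1 Oom; rewrite /f (adjoint_reflection adj')// (adjoint_reflection adj).
  - move=> t mu om tT m1 Oom.
    have -> : `|f t 0 mu om| * (`|mu| * v om) = `|f t 0 mu om * (mu * v om)|.
      by rewrite (normrM (f _ _ _ _)) (normrM mu) (gtr0_norm (v_gt0 Oom)).
    rewrite /f mulrBl (adjoint_inflowE adj' tT m1 Oom) (adjoint_inflowE adj tT m1 Oom).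
    rewrite -mulrBl normrM.
    have lb := hl _ _ _ _ a' at_ sol' sol.
    have gb := hg _ _ _ a' at_ Oom.
    have lb' := lip_le pert0 (ler_norm _) lb.
    have gb' := lip_le (D0 om) (ler_norm _) gb.
    have [_ _ lg] := lipM (D0 om) (lip_leD (pert_le_dist _ _ om) lb') gb'.
    apply: (@le_trans _ _ (2 * (`|Cl| * `|Cg|) * D om * Ppsi)).
      by apply: ler_pM.
    rewrite (_ : _ * Ppsi = Kin * D om); last by rewrite /Kin; ring.
    by apply: ler_wpM2r => //; rewrite lerDl mulr_ge0// addr_ge0.
  - move=> t x mu om tT x1 m1 mu0 Oom; rewrite -/w.
    case/andP: tT => t0 tT; case/andP: (x1) => x0 x11.
    have tT' : 0 <= t <= Tf by rewrite !ltW.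
    have x1' : 0 <= x <= 1 by rewrite !ltW.
    set A := avg_mu_om Om (p t x).
    have avgf : avg_mu_om Om (f t x) = avg_mu_om Om (p' t x) - A.
      by apply: avg_mu_omB => //; [exact: adjoint_averageable adj' _ _ tT' x1|
        exact: adjoint_averageable adj _ _ tT' x1].
    have -> : - ((tau' om)^-1 * collision Om g tau' (p' t x) mu om) -
        - ((tau om)^-1 * collision Om g tau (p t x) mu om) =
      - ((tau' om)^-1 * collision Om g tau' (f t x) mu om) -
        ((gain tau' om - gain tau om) * A - ((tau' om)^-1 - (tau om)^-1) * p t x mu om).
      rewrite !collisionE avgf /f -/A; ring.
    apply: (@le_trans _ _ (`|(tau' om)^-1 * collision Om g tau' (f t x) mu om|%:E +
        (K * D om * (`|p t x mu om| + `|A|))%:E)%E).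
      rewrite -EFinD lee_fin; apply: le_trans (ler_normB _ _) _; rewrite normrN lerD2l.
      apply: le_trans (ler_normB _ _) _.
      have [_ _ gb] := hg _ _ _ a' at_ Oom; have [_ _ tb] := ht _ _ _ a' at_ Oom.
      rewrite (normrM (_ - _) A) (normrM (_ - _) (p _ _ _ _)).
      have gb' : `|gain tau' om - gain tau om| <= K * D om.
        apply: (@le_trans _ _ (Cg * D om)); [exact: gb|apply: ler_wpM2r; first exact: D0].
        by rewrite (le_trans (ler_norm _))// lerDl.
      have tb' : `|(tau' om)^-1 - (tau om)^-1| <= K * D om.
        apply: (@le_trans _ _ (Ct * D om)); [exact: tb|apply: ler_wpM2r; first exact: D0].
        by rewrite (le_trans (ler_norm _))// lerDr.
      by rewrite mulrDr addrC; apply: lerD; apply: ler_wpM2r.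
    apply: leeD; first exact: srcE.
    rewrite /r /= KDE// (EFinM (K * D om)); apply: lee_wpmul2l.
      by rewrite lee_fin mulr_ge0.
    by apply: normr_modulus_mean.
  - rewrite (_ : EFin \o _ = fun om => K2%:E * (dist tau' tau om)%:E)%E.
      exact: integrableZl.
    by apply/funext => om; rewrite /= -EFinM.
  - by move=> om _; rewrite mulr_ge0.
  - apply: (ae_mono B2) => om hq Oom; have [hm _] := hq Oom.
    apply: (le_trans (massr om Oom hm)); rewrite lee_fin; apply: ler_wpM2r => //.
    by rewrite /K2 lerDr.
have le1 : K2 * ((1 + V) * pert tau' tau) <= K2 * (2 + V) * pert tau' tau.
  rewrite -mulrA; apply: ler_wpM2l; [exact: K20|apply: ler_wpM2r; first exact: pert0].
  by rewrite lerD2r ler1n.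
have le2 om : K2 * D om + K2 * ((1 + V) * pert tau' tau) <= K2 * (2 + V) * D om.
  have -> : K2 * (2 + V) * D om = K2 * D om + K2 * ((1 + V) * D om) by ring.
  rewrite lerD2l; apply: ler_wpM2l; [exact: K20|apply: ler_wpM2l; first exact: (addr_ge0 ler01 (ltW V0))].
  exact: pert_le_dist.
have fin (y : \bar R) (b : R) e : 0 <= e -> b <= C * (K2 * (2 + V) * e) ->
    (y <= b%:E)%E -> (y <= ((P + C * (K2 * (2 + V))) * e)%:E)%E.
  move=> e0' be yb; apply: (le_trans yb); rewrite lee_fin; apply: (le_trans be).
  have -> : (P + C * (K2 * (2 + V))) * e = P * e + C * (K2 * (2 + V) * e) by clear; ring.
  by rewrite lerDr; exact: mulr_ge0.
have finP (y : \bar R) : (y <= P%:E)%E -> (y <= (P + C * (K2 * (2 + V)))%:E)%E.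
  by move=> yP; apply: (le_trans yP); rewrite lee_fin lerDl.
have Cle1 := ler_wpM2l (ltW C0) le1.
split; [exact: finP B1'|exact: finP B1|exact: fin pert0 Cle1 e1|].
have B3 : {ae leb, forall om, Om om -> [/\ (mass Tf lam q' om <= P%:E)%E,
    (flux Tf lam v q' om <= P%:E)%E, (mass Tf lam q om <= P%:E)%E &
    (flux Tf lam v q om <= P%:E)%E]}.
  apply: (ae_mono2 B2' B2) => om h1 h2 Oom.
  have [m1 f1] := h1 Oom; have [m3 f3] := h2 Oom.
  exact: And4 m1 f1 m3 f3.
apply: (ae_mono2 B3 e2) => om h1 h2 Oom.
have [m1 f1 m2' f2] := h1 Oom; have [m3 f3] := h2 Oom.
have Cle := ler_wpM2l (ltW C0) (le2 om).
split; split.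
- exact: finP m1.
- exact: finP f1.
- exact: finP m2'.
- exact: finP f2.
- exact: fin (D0 om) Cle m3.
- exact: fin (D0 om) Cle f3.
Qed.

(** * Terms of the gradient *)

(** The directions with [mu <> 0], where forward solutions are controlled. *)
Definition oblique : set R := `[-1, 1] `\ 0.

Lemma measurable_oblique : measurable oblique.
Proof. by apply: measurableD. Qed.

Lemma iterated_le_mass (lam om : R) (q : (R * R) * (R * R) -> \bar R) : 0 < lam ->
  measurable_fun setT q -> (forall z, 0 <= q z)%E ->
  (\int[leb]_(t in `]0%R, Tf[) \int[leb]_(x in `]0%R, 1%R[)
     \int[leb]_(m in oblique) q ((t, x), (m, om)) <= mass Tf lam q om)%E.
Proof.
move=> lam0 mq q0.
pose g3 := fun z : (R * R) * R => q (z.1, (z.2, om)).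
have mg3 : measurable_fun setT g3.
  by apply: (measurableT_comp mq); apply: measurable_fun_pair; mfun.
have mI1 : measurable (`[(-1), 1] : set R) by exact: measurable_itv.
have E := @slab_int_integral R Tf lam _ _ leb _ g3 mI1 mg3 (fun z => q0 _).
have -> : mass Tf lam q om =
  slab_int Tf lam (fun z => \int[leb]_(m in `[(-1)%R, 1%R]) q (z, (m, om)))%E by rewrite /mass -E.
pose J (y : R * R) := (\int[leb]_(m in `[(-1)%R, 1%R]) q (y, (m, om)))%E.
have J0 y : (0 <= J y)%E by exact: integral_ge0.
apply: (@le_trans _ _ (\int[leb]_(t in `]0%R, Tf[) \int[leb]_(x in `]0%R, 1%R[) J (t, x))%E).
  apply: le_integral_ge0 => t; first by move=> _; apply: integral_ge0 => x _; exact: integral_ge0.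
  move=> _; apply: le_integral_ge0 => x; first by move=> _; exact: integral_ge0.
  move=> _; rewrite /J [leLHS]integral_mkcond [leRHS]integral_mkcond.
  apply: le_integral_ge0 => m _; first exact: erestrict_ge0.
  rewrite !patchE; case: ifPn => [|_]; last by case: ifPn.
  by rewrite inE => -[m1 _]; rewrite (mem_set m1).
apply: le_integral_ge0 => t; first by move=> _; apply: integral_ge0 => x _; exact: J0.
rewrite /= in_itv/= => /andP[t0 _].
have I0 : (0 <= \int[leb]_(x in `]0%R, 1%R[) J (t, x))%E.
  by apply: integral_ge0 => x _; exact: J0.
rewrite -[leLHS]mul1e; apply: lee_wpmul2r => //.
by apply: weight_ge1; exact: ltW.
Qed.

Lemma slab_integralE (f : R -> R -> R -> R) (F : (R * R) * R -> R) :
  measurable_fun setT F ->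
  (forall t x m, 0 < t < Tf -> 0 < x < 1 -> -1 <= m <= 1 -> f t x m = F ((t, x), m)) ->
  avg_t Tf (fun t => avg_x (fun x => avg_mu (f t x))) =
  \int[leb]_(t in `]0, Tf[) (\int[leb]_(x in `]0, 1[)
     (2^-1 * \int[leb]_(m in oblique) F ((t, x), m))).
Proof.
move=> mF fF; apply: eq_Rintegral => t; rewrite inE/= in_itv/= => tT.
apply: eq_Rintegral => x; rewrite inE/= in_itv/= => x1; congr (_ * _).
transitivity (\int[leb]_(m in `[-1, 1]) F ((t, x), m)).
  by apply: eq_Rintegral => m; rewrite inE/= in_itv/= => m1; exact: fF.
rewrite /Rintegral -(@integral_setD1 R (fun m => (F ((t, x), m))%:E) 0)//.
  exact: measurable_oblique.
by apply/measurable_EFinP; apply: measurable_funTS; exact: measurableT_comp.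
Qed.

(** Pairings of an adjoint solution with two coefficients, one for its mean and
    one for itself, are Lipschitz when the coefficients are. *)
Lemma pairing_lip (lam P K D om : R) (p' p : R -> R -> R -> R -> R)
    (b' b : R * R -> R) (c' c : (R * R) * R -> R) :
  0 < lam -> 0 <= P -> 0 <= K -> 0 <= D -> Om om ->
  measurable_fun (phase Tf Om) (uncurry4 p') -> measurable_fun (phase Tf Om) (uncurry4 p) ->
  averageable Tf Om p' -> averageable Tf Om p ->
  measurable_fun setT b' -> measurable_fun setT b ->
  measurable_fun setT c' -> measurable_fun setT c ->
  (forall t x, 0 < t < Tf -> 0 < x < 1 -> lip K D (b' (t, x)) (b (t, x))) ->
  (forall t x m, 0 < t < Tf -> 0 < x < 1 -> -1 <= m <= 1 -> m != 0 ->
    lip K D (c' ((t, x), m)) (c ((t, x), m))) ->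
  let M f := mass Tf lam (modulus_mean f) om in
  (M p' <= P%:E)%E -> (M p <= P%:E)%E ->
  (M (fun t x mu om => p' t x mu om - p t x mu om)%R <= (P * D)%:E)%E ->
  let I b c p := avg_t Tf (fun t => avg_x (fun x => avg_mu (fun mu =>
    b (t, x) * avg_mu_om Om (p t x) + c ((t, x), mu) * p t x mu om))) in
  lip (`|2^-1| * (2 * K * P)) D (I b' c' p') (I b c p).
Proof.
move=> lam0 P0 K0 D0 Oom mp' mp ap' ap mb' mb mc' mc lb lc M Mp' Mp Mw I.
pose w t x mu om := p' t x mu om - p t x mu om.
have mw : measurable_fun (phase Tf Om) (uncurry4 w) by exact: measurable_funB.
pose F (b : R * R -> R) (c : (R * R) * R -> R) (p : R -> R -> R -> R -> R) (z : (R * R) * R) :=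
  b z.1 * avg_mu_om Om (fun mu o => (uncurry4 p \_ (phase Tf Om)) (z.1, (mu, o))) +
  c z * (uncurry4 p \_ (phase Tf Om)) (z.1, (z.2, om)).
have mF b0 c0 p0 : measurable_fun setT b0 -> measurable_fun setT c0 ->
    measurable_fun (phase Tf Om) (uncurry4 p0) -> measurable_fun setT (F b0 c0 p0).
  move=> mb0 mc0 mp0; apply: measurable_funD; apply: measurable_funM.
  - by apply: (measurableT_comp mb0); exact: measurable_fst.
  - by apply: (measurableT_comp (measurable_avg_extension mp0)); exact: measurable_fst.
  - exact: mc0.
  - by apply: (measurableT_comp (measurable_extension mp0)); apply: measurable_fun_pair; mfun.
have ph t x m : 0 < t < Tf -> 0 < x < 1 -> -1 <= m <= 1 -> in_phase Tf Om t x m om.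
  by move=> /andP[? ?] /andP[? ?] m1; split; rewrite // !ltW.
have FE b0 c0 p0 t x m : 0 < t < Tf -> 0 < x < 1 -> -1 <= m <= 1 ->
    F b0 c0 p0 ((t, x), m) = b0 (t, x) * avg_mu_om Om (p0 t x) + c0 ((t, x), m) * p0 t x m om.
  move=> tT x1 m1; have h := ph t x m tT x1 m1; case: (h) => h1 h2 _ _.
  by rewrite /F (extensionE p0 h) (avg_extensionE p0 h1 h2).
have IE b0 c0 p0 : measurable_fun setT b0 -> measurable_fun setT c0 ->
    measurable_fun (phase Tf Om) (uncurry4 p0) -> I b0 c0 p0 =
    \int[leb]_(t in `]0, Tf[) (\int[leb]_(x in `]0, 1[)
      (2^-1 * \int[leb]_(m in oblique) F b0 c0 p0 ((t, x), m))).
  move=> mb0 mc0 mp0; apply: slab_integralE; first exact: mF.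
  by move=> t x m tT x1 m1; rewrite FE.
rewrite (IE b' c' p')// (IE b c p)//.
pose pt (z : (R * R) * R) : (R * R) * (R * R) := (z.1, (z.2, om)).
have mpt : measurable_fun setT pt by apply: measurable_fun_pair; mfun.
have mm f : measurable_fun (phase Tf Om) (uncurry4 f) ->
    measurable_fun setT (fun z => K%:E * modulus_mean f z)%E.
  by move=> mf; apply: emeasurable_funM; [exact: measurable_cst|exact: measurable_modulus_mean].
have mm0 f z : (0 <= K%:E * modulus_mean f z)%E.
  by apply: mule_ge0; [rewrite lee_fin|exact: modulus_mean_ge0].
pose Q f := (fun z => K%:E * modulus_mean f (pt z))%E.
have KP : K * P <= 2 * K * P by rewrite -mulrA ler_peMl ?mulr_ge0// ler1n.
have QP f : measurable_fun (phase Tf Om) (uncurry4 f) -> (M f <= P%:E)%E ->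
    (\int[leb]_(t in `]0%R, Tf[) \int[leb]_(x in `]0%R, 1%R[)
       \int[leb]_(m in oblique) Q f ((t, x), m) <= (2 * K * P)%:E)%E.
  move=> mf MP; apply: (le_trans (iterated_le_mass om lam0 (mm f mf) (mm0 f))).
  rewrite (massZ Tf lam om K0 (measurable_modulus_mean mf) (modulus_mean_ge0 f)).
  apply: (@le_trans _ _ (K * P)%:E); last by rewrite lee_fin.
  by rewrite EFinM; apply: lee_wpmul2l; rewrite ?lee_fin.
pose W z := ((K * D)%:E * modulus_mean p' (pt z) + K%:E * modulus_mean w (pt z))%E.
have KD0 : 0 <= K * D by exact: mulr_ge0.
apply: (@lip_iter3 _ _ _ _ _ _ R leb leb leb `]0, Tf[%classic `]0, 1[%classic oblique
  _ _ _ _ _ _ _ _ (Q p) (Q p') W) => //.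
- exact: measurable_oblique.
- by apply: measurable_funTS; exact: mF.
- by apply: measurable_funTS; exact: mF.
- by apply: (measurableT_comp (mm p mp)).
- by apply: (measurableT_comp (mm p' mp')).
- by move=> z; exact: mm0.
- by move=> z; exact: mm0.
- move=> t x m; rewrite /= !in_itv/= => tT x1 [] /=; rewrite in_itv/= => m1 m0'.
  have m0 : m != 0 by apply/eqP.
  have h := ph t x m tT x1 m1; case: (h) => hT h1 _ _.
  rewrite (FE b' c' p')// (FE b c p)//.
  have avgw : avg_mu_om Om (w t x) = avg_mu_om Om (p' t x) - avg_mu_om Om (p t x).
    by apply: (avg_mu_omB mOm); [exact: ap'|exact: ap].
  have b1 f : measurable_fun (phase Tf Om) (uncurry4 f) -> forall k, 0 <= k ->
      forall B C0, `|B| <= k -> `|C0| <= k ->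
      (`|B * avg_mu_om Om (f t x) + C0 * f t x m om|%:E <=
        k%:E * modulus_mean f (pt ((t, x), m)))%E.
    move=> mf k k0 B C0 Bk Ck.
    apply: (@le_trans _ _ (k%:E * (`|f t x m om| + `|avg_mu_om Om (f t x)|)%:E)%E).
      rewrite -EFinM lee_fin mulrDr addrC; apply: (le_trans (ler_normD _ _)).
      by rewrite !normrM; apply: lerD; exact: ler_wpM2r.
    by apply: lee_wpmul2l; [rewrite lee_fin|exact: normr_modulus_mean].
  have [lb1 lb2 lb3] := lb t x tT x1; have [lc1 lc2 lc3] := lc t x m tT x1 m1 m0.
  split; [exact: b1|exact: b1|].
  have -> : b' (t, x) * avg_mu_om Om (p' t x) + c' (t, x, m) * p' t x m om -
      (b (t, x) * avg_mu_om Om (p t x) + c (t, x, m) * p t x m om) =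
    ((b' (t, x) - b (t, x)) * avg_mu_om Om (p' t x) +
     (c' (t, x, m) - c (t, x, m)) * p' t x m om) +
    (b (t, x) * avg_mu_om Om (w t x) + c (t, x, m) * w t x m om).
    rewrite avgw /w; move: (avg_mu_om Om (p' t x)) (avg_mu_om Om (p t x)) => A' A; ring.
  apply: (@le_trans _ _ (`|(b' (t, x) - b (t, x)) * avg_mu_om Om (p' t x) +
     (c' (t, x, m) - c (t, x, m)) * p' t x m om|%:E +
    `|b (t, x) * avg_mu_om Om (w t x) + c (t, x, m) * w t x m om|%:E)%E).
    by rewrite -EFinD lee_fin ler_normD.
  by apply: leeD; exact: b1.
- exact: QP.
- exact: QP.
- have mW' : measurable_fun setT (fun z => (K * D)%:E * modulus_mean p' z)%E.
    by apply: emeasurable_funM; [exact: measurable_cst|exact: measurable_modulus_mean].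
  have W0' z : (0 <= (K * D)%:E * modulus_mean p' z)%E.
    by apply: mule_ge0; [rewrite lee_fin|exact: modulus_mean_ge0].
  have mWz := emeasurable_funD mW' (mm w mw).
  have W0 z : (0 <= (K * D)%:E * modulus_mean p' z + K%:E * modulus_mean w z)%E.
    by apply: adde_ge0; [exact: W0'|exact: mm0].
  apply: (le_trans (iterated_le_mass om lam0 mWz W0)).
  rewrite (massD Tf lam om mW' W0' (mm w mw) (mm0 w)).
  have E1 := massZ Tf lam om K0 (measurable_modulus_mean mw) (modulus_mean_ge0 w).
  have E2 := massZ Tf lam om KD0 (measurable_modulus_mean mp') (modulus_mean_ge0 p').
  have le1 : (K%:E * M w <= (K * (P * D))%:E)%E.
    by rewrite EFinM; apply: (lee_wpmul2l _ Mw); rewrite lee_fin.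
  have le2 : ((K * D)%:E * M p' <= (K * D * P)%:E)%E.
    by rewrite (EFinM (K * D)); apply: (lee_wpmul2l _ Mp'); rewrite lee_fin.
  have -> : 2 * K * P * D = K * D * P + K * (P * D) by ring.
  rewrite (EFinD (K * D * P)); apply: leeD.
    exact: (eq_ind_r (fun y => y <= _)%E le2 E2).
  exact: (eq_ind_r (fun y => y <= _)%E le1 E1).
Qed.

Lemma iterated_le_flux (lam K om : R) (q : (R * R) * (R * R) -> \bar R) :
  0 < lam -> 0 <= K -> Om om -> measurable_fun setT q -> (forall z, 0 <= q z)%E ->
  (\int[leb]_(t in `]0%R, Tf[) \int[leb]_(m in `]0%R, 1%R])
     ((K * `|m * v om|)%:E * q ((t, 0%R), (m, om))) <= K%:E * flux Tf lam v q om)%E.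
Proof.
move=> lam0 K0 Oom mq q0; have v0 := ltW (v_gt0 Oom).
have mpt : measurable_fun setT (fun z : R * R => ((z.1, 0 : R), (z.2, om))).
  by apply: measurable_fun_pair; mfun.
have mqz : measurable_fun setT (fun z : R * R => q ((z.1, 0), (z.2, om))).
  exact: (measurableT_comp mq mpt).
have mc : measurable_fun setT (fun m : R => `|m * v om|).
  by apply: measurableT_comp => //; exact: measurable_funM.
have mG : measurable_fun setT (fun z : R * R =>
    (K * `|z.2 * v om|)%:E * q ((z.1, 0%R), (z.2, om)))%E.
  apply: emeasurable_funM; last exact: mqz.
  apply/measurable_EFinP; apply: measurable_funM; first exact: measurable_cst.
  by apply: (measurableT_comp mc); exact: measurable_snd.
have KmE m : (0 <= (K * `|m * v om|)%:E)%E by rewrite lee_fin mulr_ge0.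
rewrite (@tonelli_in _ _ _ _ R leb leb `]0, Tf[%classic `]0, 1]%classic (fun z : R * R =>
    (K * `|z.2 * v om|)%:E * q ((z.1, 0%R), (z.2, om)))%E)//; last first.
  by move=> z; apply: mule_ge0.
pose J m := (\int[leb]_(t in `]0%R, Tf[) (weight lam t * q ((t, 0%R), (m, om))))%E.
have J0 m : (0 <= J m)%E by apply: integral_ge0 => t _; apply: mule_ge0.
have mJ : measurable_fun setT J.
  apply: (@measurable_integral_param _ _ _ _ R leb _ _ (fun z : R * R =>
    weight lam z.2 * q ((z.2, 0%R), (z.1, om)))%E) => //; last first.
    by move=> z; apply: mule_ge0.
  apply: emeasurable_funM; first by apply: measurableT_comp; [exact: measurable_weight|exact: measurable_snd].
  by apply: (measurableT_comp mq); apply: measurable_fun_pair; mfun.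
have -> : (K%:E * flux Tf lam v q om = \int[leb]_(m in `]0%R, 1%R]) (K%:E * ((m * v om)%:E * J m)))%E.
  apply/esym/ge0_integralZl => //.
    apply: measurable_funTS; apply: emeasurable_funM; last exact: mJ.
    by apply/measurable_EFinP; exact: measurable_funM.
  by move=> m; rewrite /= in_itv/= => /andP[m0 _]; rewrite mule_ge0// lee_fin mulr_ge0// ltW.
apply: le_integral_ge0 => m.
  by move=> _; apply: integral_ge0 => t _; apply: mule_ge0.
rewrite /= in_itv/= => /andP[m0 _].
have mv0 : 0 <= m * v om by rewrite mulr_ge0// ltW.
rewrite (ger0_norm mv0) muleA -EFinM.
have Kmv : 0 <= K * (m * v om) by rewrite mulr_ge0.
rewrite ge0_integralZl//; last first.
  apply: measurable_funTS; apply: (measurableT_comp mq).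
  by apply: measurable_fun_pair; mfun.
apply: lee_wpmul2l; first by rewrite lee_fin.
apply: le_integral_ge0 => t //.
rewrite /= in_itv/= => /andP[t0 _]; rewrite -[leLHS]mul1e; apply: lee_wpmul2r => //.
by apply: weight_ge1; exact: ltW.
Qed.

(** The pairing of [phi] with the trace of an adjoint solution on [x = 0]. *)
Lemma flux_pairing_lip (lam P D om : R) (p' p : R -> R -> R -> R -> R) :
  0 < lam -> 0 <= P -> 0 <= D -> Om om ->
  measurable_fun (phase Tf Om) (uncurry4 p') -> measurable_fun (phase Tf Om) (uncurry4 p) ->
  let fl f := flux Tf lam v (modulus Tf Om f) om in
  (fl p' <= P%:E)%E -> (fl p <= P%:E)%E ->
  (fl (fun t x mu om => p' t x mu om - p t x mu om)%R <= (P * D)%:E)%E ->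
  let I p := avg_t Tf (fun t => avg_mu_pos (fun mu =>
    mu * v om * p t 0 mu om * phi t mu om)) in
  lip (`|2^-1| * (Pphi * P)) D (I p') (I p).
Proof.
move=> lam0 P0 D0 Oom mp' mp fl Fp' Fp Fw I.
have Pphi0 : 0 <= Pphi by exact: le_trans (phi_le 0 0 0).
pose w t x mu om := p' t x mu om - p t x mu om.
have mw : measurable_fun (phase Tf Om) (uncurry4 w) by exact: measurable_funB.
pose pt (z : R * R) : (R * R) * (R * R) := ((z.1, 0), (z.2, om)).
have mpt : measurable_fun setT pt by apply: measurable_fun_pair; mfun.
pose F (p : R -> R -> R -> R -> R) (z : R * R) :=
  z.2 * v om * (uncurry4 p \_ (phase Tf Om)) (pt z) * phi z.1 z.2 om.
have mF f : measurable_fun (phase Tf Om) (uncurry4 f) -> measurable_fun setT (F f).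
  move=> mf; apply: measurable_funM; last exact: mphi.
  apply: measurable_funM; first by apply: measurable_funM.
  exact: (measurableT_comp (measurable_extension mf) mpt).
have ph t m : 0 < t < Tf -> 0 < m <= 1 -> in_phase Tf Om t 0 m om.
  move=> /andP[t0 tT] /andP[m0 m1]; split; rewrite // ?lexx ?ler01 ?(ltW t0) ?(ltW tT)//.
  by apply/andP; split; [lra|exact: m1].
have FE f t m : 0 < t < Tf -> 0 < m <= 1 ->
    F f (t, m) = m * v om * f t 0 m om * phi t m om.
  by move=> tT m1; rewrite /F (extensionE f (ph t m tT m1)).
have IE f : I f = \int[leb]_(t in `]0, Tf[) (2^-1 * \int[leb]_(m in `]0, 1]) F f (t, m)).
  apply: eq_Rintegral => t; rewrite inE/= in_itv/= => tT; congr (_ * _).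
  by apply: eq_Rintegral => m; rewrite inE/= in_itv/= => m1; rewrite FE.
rewrite !IE.
pose Q f (z : R * R) := ((Pphi * `|z.2 * v om|)%:E * modulus Tf Om f (pt z))%E.
have Q0 f z : (0 <= Q f z)%E.
  by apply: mule_ge0; [rewrite lee_fin mulr_ge0|exact: modulus_ge0].
have mQ f : measurable_fun (phase Tf Om) (uncurry4 f) -> measurable_fun setT (Q f).
  move=> mf; apply: emeasurable_funM.
    apply/measurable_EFinP; apply: measurable_funM; first exact: measurable_cst.
    by apply: measurableT_comp => //; exact: measurable_funM.
  exact: (measurableT_comp (measurable_modulus mOm mf) mpt).
have QP f (b : R) : measurable_fun (phase Tf Om) (uncurry4 f) -> (fl f <= b%:E)%E ->
    (\int[leb]_(t in `]0%R, Tf[) \int[leb]_(m in `]0%R, 1%R]) Q f (t, m) <= (Pphi * b)%:E)%E.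
  move=> mf fb.
  apply: (le_trans (iterated_le_flux lam0 Pphi0 Oom (measurable_modulus mOm mf) (@modulus_ge0 R Tf Om f))).
  by rewrite EFinM; apply: (lee_wpmul2l _ fb); rewrite lee_fin.
have FQ f t m : 0 < t < Tf -> 0 < m <= 1 -> (`|F f (t, m)|%:E <= Q f (t, m))%E.
  move=> tT m1; rewrite FE// /Q /pt/= (modulusE f (ph t m tT m1)) -EFinM lee_fin.
  rewrite (normrM _ (phi _ _ _)) (normrM _ (f _ _ _ _)) mulrC -mulrA.
  by apply: ler_wpM2r; rewrite ?mulr_ge0.
apply: (@lip_iter2 _ _ _ _ R leb leb `]0, Tf[%classic `]0, 1]%classic
  _ _ _ _ _ _ _ (Q p) (Q p') (Q w)) => //.
- by apply: measurable_funTS; exact: mF.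
- by apply: measurable_funTS; exact: mF.
- exact: mQ.
- exact: mQ.
- move=> t m; rewrite /= !in_itv/= => tT m1; split; [exact: FQ|exact: FQ|].
  have -> : F p' (t, m) - F p (t, m) = F w (t, m) by rewrite !FE// /w; ring.
  exact: FQ.
- exact: QP.
- exact: QP.
- by rewrite -mulrA; exact: (QP w).
Qed.

Lemma normr_Rintegral_le_cst (D : set R) (F : R -> R) (M : R) : measurable D ->
  (leb D < +oo)%E -> (forall x, D x -> `|F x| <= M) ->
  `|\int[leb]_(x in D) F x| <= M * fine (leb D).
Proof.
move=> mD Doo FM; rewrite -lee_fin.
apply: (@le_trans _ _ (\int[leb]_(x in D) M%:E)%E).
  by apply: normr_Rintegral_le => x Dx; rewrite lee_fin; exact: FM.
by rewrite integral_cst// EFinM fineK// ge0_fin_numE.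
Qed.

Lemma source_avg_le om : `|avg_t Tf (fun t => avg_mu_pos (fun mu => phi t mu om * psi t))| <=
  2^-1 * (Pphi * Ppsi) * Tf.
Proof.
have {2}-> : Tf = fine (leb `]0, Tf[) by rewrite lebesgue_measure_itv/= lte_fin Tf0 -EFinD subr0.
apply: normr_Rintegral_le_cst => //.
  by rewrite lebesgue_measure_itv/= lte_fin Tf0 -EFinD ltry.
move=> t _; rewrite /avg_mu_pos normrM gtr0_norm ?invr_gt0//; apply: ler_wpM2l => //.
rewrite -[leRHS]mulr1.
have {2}-> : 1 = fine (leb (`]0, 1] : set R)).
  by rewrite lebesgue_measure_itv/= lte_fin ltr01 -EFinD subr0.
apply: normr_Rintegral_le_cst => //.
  by rewrite lebesgue_measure_itv/= lte_fin ltr01 -EFinD ltry.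
by move=> m _; rewrite normrM; exact: ler_pM.
Qed.

Lemma lip_source_term : exists C, forall tau' tau h' h om, adm tau' -> adm tau ->
  forward_solution Tf Om v g phi tau' h' -> forward_solution Tf Om v g phi tau h -> Om om ->
  let T tau h := - (mismatch Tf Om g psi d tau h / (tau om ^+ 2 * avg_om Om (hstar g tau))
    * avg_t Tf (fun t => avg_mu_pos (fun mu => phi t mu om * psi t))) in
  lip C (dist tau' tau om) (T tau' h') (T tau h).
Proof.
have [Cl hl] := mismatch_lip; have [Ct ht] := lip_tauV; have [Cb hb] := lip_hsbarV.
eexists => tau' tau h' h om a' a sol' sol Oom T; have D0 := dist_ge0 tau' tau om.
have pD := pert_le_dist tau' tau om.
have E (tau0 : R -> R) : (tau0 om ^+ 2 * avg_om Om (hstar g tau0))^-1 =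
    (tau0 om)^-1 * (tau0 om)^-1 * (avg_om Om (hstar g tau0))^-1.
  by rewrite invfM expr2 invfM.
rewrite /T !E; apply: lipN; apply: (lipM D0); last exact: (lip_cst D0 (source_avg_le om)).
apply: (lipM D0); first exact: (lip_leD pD (hl _ _ _ _ a' a sol' sol)).
apply: (lipM D0); last exact: (lip_leD pD (hb _ _ a' a)).
by apply: (lipM D0); exact: (ht _ _ _ a' a Oom).
Qed.

Lemma lip_boundary_term : exists C, forall tau' tau h' h om, adm tau' -> adm tau ->
  forward_solution Tf Om v g phi tau' h' -> forward_solution Tf Om v g phi tau h -> Om om ->
  let T tau h := mismatch Tf Om g psi d tau h / avg_om Om (hstar g tau) ^+ 2 *
      (hstar g tau om / tau om) *
    avg_t Tf (fun t => avg_mu_om Om (fun mu om' => h t 0 mu om' * psi t)) in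
  lip C (dist tau' tau om) (T tau' h') (T tau h).
Proof.
have [Cl hl] := mismatch_lip; have [Ct ht] := lip_tauV; have [Cb hb] := lip_hsbarV.
have [Ch hh] := lip_hstar; have [Ca ha] := boundary_avg_lip.
eexists => tau' tau h' h om a' a sol' sol Oom T; have D0 := dist_ge0 tau' tau om.
have pD := pert_le_dist tau' tau om.
have E (tau0 : R -> R) : (avg_om Om (hstar g tau0) ^+ 2)^-1 =
    (avg_om Om (hstar g tau0))^-1 * (avg_om Om (hstar g tau0))^-1.
  by rewrite expr2 invfM.
rewrite /T !E; apply: (lipM D0); last exact: (lip_leD pD (ha _ _ _ _ a' a sol' sol)).
apply: (lipM D0).
  apply: (lipM D0); first exact: (lip_leD pD (hl _ _ _ _ a' a sol' sol)).
  by apply: (lipM D0); exact: (lip_leD pD (hb _ _ a' a)).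
by apply: (lipM D0); [exact: (hh _ _ _ a' a Oom)|exact: (ht _ _ _ a' a Oom)].
Qed.

(** In fact [tau h*] is the function [g], which is the same for all [tau]. *)
Lemma lip_tau_hstarV tau' tau om : adm tau' -> adm tau -> Om om ->
  lip c3^-1 (dist tau' tau om) (tau' om * hstar g tau' om)^-1 (tau om * hstar g tau om)^-1.
Proof.
move=> a' a Oom.
have E tau0 : adm tau0 -> tau0 om * hstar g tau0 om = g om.
  by move=> a0; have [_ _ t0] := tau_in a0 Oom; rewrite mulrC divfK// gt_eqF.
rewrite !E//; apply: (lip_cst (dist_ge0 _ _ _)).
have /andP[g1 _] := g_in Oom; have g0 := lt_trans c3_gt0 g1.
by rewrite gtr0_norm ?invr_gt0// lef_pV2 ?posrE// ltW.
Qed.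

Lemma lip_inflow_term (lam P : R) : 0 < lam -> 0 <= P ->
  exists C, forall tau' tau p' p om, adm tau' -> adm tau -> Om om ->
  measurable_fun (phase Tf Om) (uncurry4 p') -> measurable_fun (phase Tf Om) (uncurry4 p) ->
  let fl f := flux Tf lam v (modulus Tf Om f) om in
  (fl p' <= P%:E)%E -> (fl p <= P%:E)%E ->
  (fl (fun t x mu om => p' t x mu om - p t x mu om)%R <= (P * dist tau' tau om)%:E)%E ->
  let T tau p := (tau om * hstar g tau om)^-1 * avg_t Tf (fun t => avg_mu_pos (fun mu =>
    mu * v om * p t 0 mu om * phi t mu om)) in
  lip C (dist tau' tau om) (T tau' p') (T tau p).
Proof.
move=> lam0 P0; eexists => tau' tau p' p om a' a Oom mp' mp fl F' F Fw T.
have D0 := dist_ge0 tau' tau om.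
apply: (lipM D0); first exact: lip_tau_hstarV.
exact: (flux_pairing_lip lam0 P0 D0 Oom mp' mp F' F Fw).
Qed.

(** The mean of [h] over directions and frequencies, computed from the extension
    of [h] by zero so as to be measurable as a function of all [(t, x)]. *)
Definition mean_ext (h : R -> R -> R -> R -> R) (y : R * R) :=
  avg_mu_om Om (fun mu om => (uncurry4 h \_ (phase Tf Om)) (y, (mu, om))).

(** Likewise the collision term of [h] at the frequency [om], as a function of
    [((t, x), mu)]. *)
Definition collision_ext (tau : R -> R) (h : R -> R -> R -> R -> R) om (z : (R * R) * R) :=
  hs tau om * (hsbar tau)^-1 * mean_ext h z.1 - (uncurry4 h \_ (phase Tf Om)) (z.1, (z.2, om)).

Lemma lip_collision_terms (lam P : R) : 0 < lam -> 0 <= P ->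
  exists C, forall tau' tau h' h p' p om, adm tau' -> adm tau ->
  forward_solution Tf Om v g phi tau' h' -> forward_solution Tf Om v g phi tau h -> Om om ->
  measurable_fun (phase Tf Om) (uncurry4 p') -> measurable_fun (phase Tf Om) (uncurry4 p) ->
  averageable Tf Om p' -> averageable Tf Om p ->
  let M f := mass Tf lam (modulus_mean f) om in
  (M p' <= P%:E)%E -> (M p <= P%:E)%E ->
  (M (fun t x mu om => p' t x mu om - p t x mu om)%R <= (P * dist tau' tau om)%:E)%E ->
  let T tau h p := (tau om * hstar g tau om)^-1 *
    avg_t Tf (fun t => avg_x (fun x => avg_mu (fun mu =>
      collision Om g tau (h t x) mu om * p t x mu om))) in
  let U tau h p := (tau om * avg_om Om (hstar g tau))^-1 *
    avg_t Tf (fun t => avg_x (fun x => avg_mu (fun mu =>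
      hstar g tau om / avg_om Om (hstar g tau) * avg_mu_om Om (h t x) * avg_mu_om Om (p t x)
      - avg_mu_om Om (h t x) * p t x mu om))) in
  lip C (dist tau' tau om) (T tau' h' p') (T tau h p) /\
  lip C (dist tau' tau om) (U tau' h' p') (U tau h p).
Proof.
move=> lam0 P0.
have [Ct ht] := lip_tauV; have [Cb hb] := lip_hsbarV; have [Ch hh] := lip_hstar.
have [Ca Ca0 ha] := forward_avg_lip; have [Cf hf] := forward_lip.
pose Kr := 2 * (`|Ch| * `|Cb|); have Kr0 : 0 <= Kr by rewrite !mulr_ge0.
pose Km := 2 * (Kr * Ca); have Km0 : 0 <= Km by rewrite !mulr_ge0.
pose K := Km + `|Cf| + Ca.
have K0 : 0 <= K by rewrite !addr_ge0.
have [KmK CaK KmfK] : [/\ Km <= K, Ca <= K & Km + `|Cf| <= K].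
  have := normr_ge0 Cf; move: Km0 Ca0; rewrite /K; clearbody Km.
  by move=> ? ? ?; split; lra.
pose B := `|2^-1| * (2 * K * P).
have B0 : 0 <= B by rewrite !mulr_ge0.
exists (2 * (`|c3^-1| * B) + 2 * (2 * (`|Ct| * `|Cb|) * B)).
move=> tau' tau h' h p' p om a' a sol' sol Oom mp' mp ap' ap M M' Mp Mw T U.
have D0 := dist_ge0 tau' tau om; have pD := pert_le_dist tau' tau om.
have lb := lip_le D0 (ler_norm _) (lip_leD pD (hb _ _ a' a)).
have lh := lip_le D0 (ler_norm _) (hh _ _ _ a' a Oom).
have lt := lip_le D0 (ler_norm _) (ht _ _ _ a' a Oom).
have lg := lip_le D0 (ler_norm _) (lip_tau_hstarV a' a Oom).
have mm (f : R -> R -> R -> R -> R) tau0 : forward_solution Tf Om v g phi tau0 f ->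
    measurable_fun setT (mean_ext f).
  by move=> s; exact: measurable_avg_extension (forward_measurable s).
have mc (f : R -> R -> R -> R -> R) tau0 : forward_solution Tf Om v g phi tau0 f ->
    measurable_fun setT (collision_ext tau0 f om).
  move=> s; apply: measurable_funB.
    apply: measurable_funM; first exact: measurable_cst.
    by apply: (measurableT_comp (mm _ _ s)); exact: measurable_fst.
  apply: (measurableT_comp (measurable_extension (forward_measurable s))).
  by apply: measurable_fun_pair; mfun.
have meanE f t x : 0 < t < Tf -> 0 < x < 1 -> mean_ext f (t, x) = avg_mu_om Om (f t x).
  by move=> /andP[t0 tT] /andP[x0 x1]; apply: avg_extensionE; rewrite !ltW.
have lm t x : 0 < t < Tf -> 0 < x < 1 ->
    lip Ca (dist tau' tau om) (mean_ext h' (t, x)) (mean_ext h (t, x)).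
  move=> tT x1; rewrite (meanE h')// (meanE h)//; apply: (lip_leD pD).
  by case/andP: tT => ? ?; case/andP: x1 => ? ?; apply: (ha _ _ _ _ a' a sol' sol); rewrite !ltW.
have lr := lipM D0 lh lb.
have lrm t x : 0 < t < Tf -> 0 < x < 1 -> lip Km (dist tau' tau om)
    (hs tau' om * (hsbar tau')^-1 * mean_ext h' (t, x))
    (hs tau om * (hsbar tau)^-1 * mean_ext h (t, x)).
  by move=> tT x1; exact: (lipM D0 lr (lm t x tT x1)).
have ph t x m : 0 < t < Tf -> 0 < x < 1 -> -1 <= m <= 1 -> in_phase Tf Om t x m om.
  by move=> /andP[? ?] /andP[? ?] m1; split; rewrite // !ltW.
have lc t x m : 0 < t < Tf -> 0 < x < 1 -> -1 <= m <= 1 -> m != 0 ->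
    lip K (dist tau' tau om) (collision_ext tau' h' om ((t, x), m))
      (collision_ext tau h om ((t, x), m)).
  move=> tT x1 m1 m0; have hph := ph t x m tT x1 m1.
  apply: (lip_le D0 KmfK); rewrite /collision_ext (extensionE h' hph) (extensionE h hph).
  apply: lipB; first exact: lrm.
  exact: (lip_le D0 (ler_norm _) (hf _ _ _ _ a' a sol' sol _ _ _ _ hph m0)).
have TE tau0 h0 p0 : avg_t Tf (fun t => avg_x (fun x => avg_mu (fun mu =>
      collision Om g tau0 (h0 t x) mu om * p0 t x mu om))) =
    avg_t Tf (fun t => avg_x (fun x => avg_mu (fun mu =>
      (fun=> 0) (t, x) * avg_mu_om Om (p0 t x) +
      collision_ext tau0 h0 om ((t, x), mu) * p0 t x mu om))).
  apply: eq_Rintegral => t; rewrite inE/= in_itv/= => tT.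
  apply: eq_Rintegral => x; rewrite inE/= in_itv/= => x1; congr (_ * _).
  apply: eq_Rintegral => m; rewrite inE/= in_itv/= => m1.
  rewrite mul0r add0r /collision_ext (extensionE h0 (ph t x m tT x1 m1)) meanE//.
  by congr (_ * _); rewrite /collision /hs /hsbar mulrC mulrA mulrAC.
have {}TE tau0 h0 p0 : T tau0 h0 p0 = _ :=
  congr1 (fun y => (tau0 om * hstar g tau0 om)^-1 * y) (TE tau0 h0 p0).
have UE tau0 h0 p0 : avg_t Tf (fun t => avg_x (fun x => avg_mu (fun mu =>
      hstar g tau0 om / avg_om Om (hstar g tau0) * avg_mu_om Om (h0 t x) * avg_mu_om Om (p0 t x)
      - avg_mu_om Om (h0 t x) * p0 t x mu om))) =
    avg_t Tf (fun t => avg_x (fun x => avg_mu (fun mu =>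
      (fun y => hs tau0 om * (hsbar tau0)^-1 * mean_ext h0 y) (t, x) * avg_mu_om Om (p0 t x) +
      (fun z : (R * R) * R => - mean_ext h0 z.1) ((t, x), mu) * p0 t x mu om))).
  apply: eq_Rintegral => t; rewrite inE/= in_itv/= => tT.
  apply: eq_Rintegral => x; rewrite inE/= in_itv/= => x1; congr (_ * _).
  by apply: eq_Rintegral => m _; rewrite /= meanE// mulNr.
have {}UE tau0 h0 p0 : U tau0 h0 p0 = _ :=
  congr1 (fun y => (tau0 om * avg_om Om (hstar g tau0))^-1 * y) (UE tau0 h0 p0).
have ltb : lip (2 * (`|Ct| * `|Cb|)) (dist tau' tau om)
    (tau' om * avg_om Om (hstar g tau'))^-1 (tau om * avg_om Om (hstar g tau))^-1.
  by rewrite (invfM (tau' om)) (invfM (tau om)); exact: (lipM D0 lt lb).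
have C1 : 2 * (`|c3^-1| * B) <= 2 * (`|c3^-1| * B) + 2 * (2 * (`|Ct| * `|Cb|) * B).
  by rewrite lerDl !mulr_ge0.
have C2 : 2 * (2 * (`|Ct| * `|Cb|) * B) <= 2 * (`|c3^-1| * B) + 2 * (2 * (`|Ct| * `|Cb|) * B).
  by rewrite lerDr !mulr_ge0.
split.
- apply: (lip_le D0 C1); rewrite (TE tau' h' p') (TE tau h p).
  apply: (lipM D0 lg).
  apply: (pairing_lip (b' := fun=> 0) (b := fun=> 0)
    lam0 P0 K0 D0 Oom mp' mp ap' ap _ _ (mc _ _ sol') (mc _ _ sol) _ lc M' Mp Mw).
  + exact: measurable_cst.
  + exact: measurable_cst.
  + by move=> t x _ _; apply: lip_cst; rewrite ?normr0.
- apply: (lip_le D0 C2); rewrite (UE tau' h' p') (UE tau h p).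
  apply: (lipM D0 ltb).
  apply: (pairing_lip
    (b' := fun y => hs tau' om * (hsbar tau')^-1 * mean_ext h' y)
    (b := fun y => hs tau om * (hsbar tau)^-1 * mean_ext h y)
    (c' := fun z => - mean_ext h' z.1) (c := fun z => - mean_ext h z.1)
    lam0 P0 K0 D0 Oom mp' mp ap' ap _ _ _ _ _ _ M' Mp Mw).
  + by apply: measurable_funM; [exact: measurable_cst|exact: (mm _ _ sol')].
  + by apply: measurable_funM; [exact: measurable_cst|exact: (mm _ _ sol)].
  + apply: measurableT_comp => //.
    by apply: (measurableT_comp (mm _ _ sol')); exact: measurable_fst.
  + apply: measurableT_comp => //.
    by apply: (measurableT_comp (mm _ _ sol)); exact: measurable_fst.
  + by move=> t x tT x1; exact: (lip_le D0 KmK (lrm t x tT x1)).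
  + by move=> t x m tT x1 _ _; exact: (lipN (lip_le D0 CaK (lm t x tT x1))).
Qed.

(** At almost every frequency the gradient is Lipschitz with respect to [dist]. *)
Lemma gradient_lip : exists2 C, 0 <= C & forall tau' tau h' h p' p,
  adm tau' -> adm tau ->
  forward_solution Tf Om v g phi tau' h' -> forward_solution Tf Om v g phi tau h ->
  adjoint_solution Tf Om v g psi tau' (mismatch Tf Om g psi d tau' h') p' ->
  adjoint_solution Tf Om v g psi tau (mismatch Tf Om g psi d tau h) p ->
  {ae leb, forall om, Om om ->
    `|gradient Tf Om v g phi psi d tau' h' p' om - gradient Tf Om v g phi psi d tau h p om| <=
      C * dist tau' tau om}.
Proof.
have [lam [Cs [lam0 Cs0 stab]]] := adjoint_stability.
have iV0 : 0 <= V^-1 by rewrite invr_ge0 ltW// V0.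
pose P := Cs + V^-1 * Cs.
have iVC : 0 <= V^-1 * Cs by exact: mulr_ge0.
have P0 : 0 <= P by exact: addr_ge0.
have CsP : Cs <= P by rewrite lerDl.
have [C1 h1] := lip_source_term; have [C2 h2] := lip_boundary_term.
have [C3 h3] := lip_inflow_term lam0 P0; have [C4 h4] := lip_collision_terms lam0 P0.
exists `|C1 + C2 + C3 + C4 + C4| => // tau' tau h' h p' p a' a sol' sol adj' adj.
have [N1 N2 N3 ae1] := stab _ _ _ _ _ _ a' a sol' sol adj' adj.
have mp' := measurable_adjoint adj'; have mp := measurable_adjoint adj.
apply: (ae_mono ae1) => om hom Oom; have [[m1 f1] [m2 f2] [m3 f3]] := hom Oom.
have D0 := dist_ge0 tau' tau om.
have mean_le f (c e : R) : measurable_fun (phase Tf Om) (uncurry4 f) ->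
    (mass Tf lam (modulus Tf Om f) om <= c%:E)%E ->
    (\int[leb]_(o in Om) mass Tf lam (modulus Tf Om f) o <= e%:E)%E ->
    (mass Tf lam (modulus_mean f) om <= (c + V^-1 * e)%:E)%E.
  move=> mf fc fe; rewrite mass_modulus_mean// EFinD; apply: leeD; first exact: fc.
  by rewrite EFinM; apply: (lee_wpmul2l _ fe); rewrite lee_fin.
have M1 := mean_le _ _ _ mp' m1 N1; have M2 := mean_le _ _ _ mp m2 N2.
have mw : measurable_fun (phase Tf Om) (uncurry4 (fun t x mu om => p' t x mu om - p t x mu om)).
  exact: measurable_funB.
have M3 : (mass Tf lam (modulus_mean (fun t x mu om => p' t x mu om - p t x mu om)%R) om <=
    (P * dist tau' tau om)%:E)%E.
  apply: (le_trans (mean_le _ _ _ mw m3 N3)); rewrite lee_fin /P mulrDl lerD2l -mulrA.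
  by do 2 (apply: ler_wpM2l => //); exact: pert_le_dist.
have F1 : (flux Tf lam v (modulus Tf Om p') om <= P%:E)%E.
  by apply: (le_trans f1); rewrite lee_fin.
have F2 : (flux Tf lam v (modulus Tf Om p) om <= P%:E)%E.
  by apply: (le_trans f2); rewrite lee_fin.
have F3 : (flux Tf lam v (modulus Tf Om (fun t x mu om => p' t x mu om - p t x mu om)%R) om <=
    (P * dist tau' tau om)%:E)%E.
  by apply: (le_trans f3); rewrite lee_fin; exact: ler_wpM2r.
have L1 := h1 _ _ _ _ _ a' a sol' sol Oom.
have L2 := h2 _ _ _ _ _ a' a sol' sol Oom.
have L3 := h3 _ _ _ _ _ a' a Oom mp' mp F1 F2 F3.
have [L4 L5] := h4 _ _ _ _ _ _ _ a' a sol' sol Oom mp' mp (adjoint_averageable adj')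
  (adjoint_averageable adj) M1 M2 M3.
have [_ _ L] := lipB (lipD (lipD (lipD L1 L2) L3) L4) L5.
apply: le_trans L _.
by apply: ler_wpM2r => //; exact: ler_norm.
Qed.

End perturbation.

(** * Square norm and conclusion *)

Section square_norm.
Context {R : realType}.
Local Notation leb := (@lebesgue_measure R).
Implicit Types (Om : set R) (F G : R -> R).

Lemma norm2E Om F : norm2 Om F = sqrte (\int[leb]_(om in Om) (F om ^+ 2)%:E)%E.
Proof.
have I0 : (0 <= \int[leb]_(om in Om) (F om ^+ 2)%:E)%E.
  by apply: integral_ge0 => om _; rewrite lee_fin sqr_ge0.
rewrite /norm2 unlock -(poweR12_sqrt I0) [in RHS]integral_mkcond.
congr (_ `^ _)%E; apply: eq_integral => om _ /=.
rewrite powR_mulrn// real_normK ?num_real// !patchE.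
by case: ifPn => // _; rewrite expr0n.
Qed.

(** Stated with extended-real integrals, so that [F] need not be measurable. *)
Lemma norm2_le Om F G (K : R) : 0 <= K ->
  (\int[leb]_(om in Om) (F om ^+ 2)%:E <=
    (K ^+ 2)%:E * \int[leb]_(om in Om) (G om ^+ 2)%:E)%E ->
  (norm2 Om F <= K%:E * norm2 Om G)%E.
Proof.
move=> K0 FG; rewrite !norm2E.
have -> : K%:E = sqrte (K ^+ 2)%:E by rewrite /= sqrtr_sqr ger0_norm.
rewrite -sqrteM; last by rewrite lee_fin sqr_ge0.
by rewrite lee_sqrt//; apply: le_trans FG; apply: integral_ge0 => om _; rewrite lee_fin sqr_ge0.
Qed.

(** The Cauchy--Schwarz inequality against the constant function. *)
Lemma sqr_Rintegral_le Om F : measurable Om -> (0 < leb Om)%E -> (leb Om < +oo)%E ->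
  leb.-integrable Om (EFin \o F) -> leb.-integrable Om (EFin \o (fun om => F om ^+ 2)) ->
  (\int[leb]_(om in Om) F om) ^+ 2 <= fine (leb Om) * \int[leb]_(om in Om) F om ^+ 2.
Proof.
move=> mOm Om_gt0 Om_lty iF iF2; have V0 := vol_gt0 Om_gt0 Om_lty.
set V := fine (leb Om) in V0 *; set N := \int[leb]_(om in Om) F om.
have iZ : leb.-integrable Om (EFin \o (fun om => 2 * (N / V) * F om)).
  rewrite (_ : EFin \o _ = (fun om => (2 * (N / V))%:E * (F om)%:E)%E).
    exact: integrableZl.
  by apply/funext => om; rewrite /= EFinM.
have iC : leb.-integrable Om (EFin \o (fun=> (N / V) ^+ 2)) by exact: integrable_cst.
have iB : leb.-integrable Om (EFin \o (fun om => F om ^+ 2 - 2 * (N / V) * F om)).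
  rewrite (_ : EFin \o _ = (fun om => (F om ^+ 2)%:E - (2 * (N / V) * F om)%:E)%E).
    exact: integrableB.
  by apply/funext => om; rewrite /= EFinB.
(* the integral of the square of [F - N / V] is nonnegative *)
have : 0 <= \int[leb]_(om in Om) (F om ^+ 2 - 2 * (N / V) * F om + (N / V) ^+ 2).
  apply: Rintegral_ge0 => om _.
  by rewrite (_ : _ + _ = (F om - N / V) ^+ 2) ?sqr_ge0//; ring.
rewrite RintegralD// RintegralB// RintegralZl// Rintegral_cst// -/V -/N.
set S := Rintegral _ _ _; clearbody S N => h.
have : 0 <= V * (S - 2 * (N / V) * N + (N / V) ^+ 2 * V) by rewrite mulr_ge0// ltW.
have -> : V * (S - 2 * (N / V) * N + (N / V) ^+ 2 * V) = V * S - N ^+ 2.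
  by field; rewrite gt_eqF.
by rewrite subr_ge0.
Qed.

End square_norm.

Theorem mainTheorem2 (R : realType) (Tf : R) (Om : set R) (v g : R -> R)
    (eps1 eps2 eps3 eps4 t0 mu0 om0 tR d c1 c2 c3 c4 : R)
    (phi := source eps1 eps2 eps3 t0 mu0 om0) (psi := test eps4 tR) :
  0 < Tf ->
  is_interval Om -> bounded_set Om -> Om `<=` `[0, +oo[ ->
  (0 < lebesgue_measure Om)%E ->
  measurable_fun Om v -> (forall om, Om om -> 0 < v om) ->
  measurable_fun Om g -> (forall om, Om om -> c3 < g om < c4) ->
  0 < eps1 -> 0 < eps2 -> 0 < eps3 -> 0 < eps4 ->
  0 < c1 -> c1 < c2 -> 0 < c3 -> c3 < c4 ->
  forall (tau : R -> R) (h p : R -> R -> R -> R -> R),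
  admissible Om c1 c2 tau ->
  forward_solution Tf Om v g phi tau h ->
  adjoint_solution Tf Om v g psi tau (mismatch Tf Om g psi d tau h) p ->
  exists C delta : R, [/\ 0 < C, 0 < delta &
    forall (dtau : R -> R) (h' p' : R -> R -> R -> R -> R),
      let tau' := fun om => tau om + dtau om in
      measurable_fun Om dtau ->
      (norm2 Om dtau < delta%:E)%E ->
      admissible Om c1 c2 tau' ->
      forward_solution Tf Om v g phi tau' h' ->
      adjoint_solution Tf Om v g psi tau' (mismatch Tf Om g psi d tau' h') p' ->
      (norm2 Om (gradient Tf Om v g phi psi d tau' h' p'
                 \- gradient Tf Om v g phi psi d tau h p)%R
         <= C%:E * norm2 Om dtau)%E].
Proof.
move=> Tf0 itvOm bndOm Om0 Om_gt0 mv v_gt0 mg g_in e1 e2 e3 e4 c10 c12 c30 c34.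
move=> tau h p a sol adj.
have mOm : measurable Om by exact: is_interval_measurable.
have Om_lty : (lebesgue_measure Om < +oo)%E.
  case: bndOm => M [_ hM]; have M1 : M < M + 1 by rewrite ltrDl.
  apply: (@le_lt_trans _ _ (lebesgue_measure (`[- (M + 1), M + 1] : set R))).
    apply: le_measure; rewrite ?inE//.
    by move=> om Oom; rewrite /= in_itv/= -ler_norml; exact: (hM _ M1).
  by rewrite lebesgue_measure_itv/=; case: ifP => _; rewrite -?EFinB ltry.
have sqrt_neq0 (e : R) : 0 < e -> Num.sqrt e != 0 by move=> e0; rewrite sqrtr_eq0 -ltNge.
have gauss_le (e x : R) : 0 < e -> `|gauss e x| <= normal_peak (Num.sqrt e).
  by move=> e0; rewrite ger0_norm ?normal_pdf_ge0// normal_pdf_ub// sqrt_neq0.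
have mgauss (e : R) : measurable_fun setT (gauss e) by exact: measurable_normal_pdf.
pose Pphi := normal_peak (Num.sqrt eps1) * normal_peak (Num.sqrt eps2) *
  normal_peak (Num.sqrt eps3).
have phi_le t mu om : `|phi t mu om| <= Pphi.
  by rewrite /phi /source !normrM; apply: ler_pM => //; [apply: ler_pM => //|];
    exact: gauss_le.
have psi_le t : `|psi t| <= normal_peak (Num.sqrt eps4) by exact: gauss_le.
have mpsi : measurable_fun setT psi.
  by apply: (measurableT_comp (mgauss eps4)); exact: measurable_funB.
have mphi om : measurable_fun setT (fun z : R * R => phi z.1 z.2 om).
  apply: measurable_funM; last exact: measurable_cst.
  apply: measurable_funM.
    by apply: (measurableT_comp (mgauss eps1)); apply: measurable_funB.
  by apply: (measurableT_comp (mgauss eps2)); apply: measurable_funB.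
have [C C0 grad_le] := gradient_lip d c2 Tf0 mOm Om_gt0 Om_lty v_gt0 mg g_in c10 c30
  phi_le psi_le mpsi mphi.
pose V := fine (lebesgue_measure Om).
have V0 : 0 < V by exact: vol_gt0.
pose K := C * (1 + V) * 2; have K0 : 0 <= K by rewrite !mulr_ge0// addr_ge0// ltW.
(* no smallness of the perturbation is needed: [1] is an arbitrary choice *)
exists (K + 1), 1; split => //; first by rewrite ltr_wpDl.
move=> dtau h' p' tau' mdtau _ a' sol' adj'.
have dtauE om : tau' om - tau om = dtau om by rewrite /tau' addrC addKr.
have K1 : 0 <= K + 1 by rewrite addr_ge0.
apply: norm2_le => //.
have dtau_le om : Om om -> `|dtau om| <= c2 - c1.
  move=> Oom; rewrite -dtauE ler_norml; have /andP[? ?] := (a'.2 om Oom).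
  by have /andP[? ?] := (a.2 om Oom); apply/andP; split; lra.
pose N := pert Om tau' tau.
have i1 : lebesgue_measure.-integrable Om (EFin \o (fun om => `|dtau om|)).
  apply: (@integrable_bounded _ _ R lebesgue_measure Om _ (c2 - c1)) => //.
    exact: measurableT_comp.
  by move=> om Oom; rewrite normr_id; exact: dtau_le.
have i2 : lebesgue_measure.-integrable Om (EFin \o (fun om => `|dtau om| ^+ 2)).
  apply: (@integrable_bounded _ _ R lebesgue_measure Om _ ((c2 - c1) ^+ 2)) => //.
    by apply: measurable_funX; exact: measurableT_comp.
  move=> om Oom; rewrite normrX normr_id lerXn2r ?nnegrE//; last exact: dtau_le.
  by apply: le_trans (dtau_le om Oom).
have N2 : N ^+ 2 <= V * \int[lebesgue_measure]_(om in Om) `|dtau om| ^+ 2.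
  rewrite /N /pert; under eq_Rintegral do rewrite dtauE.
  exact: sqr_Rintegral_le.
set S := Rintegral _ _ _ in N2.
have S0 : 0 <= S by apply: Rintegral_ge0 => om _; exact: sqr_ge0.
have SE : (\int[lebesgue_measure]_(om in Om) (dtau om ^+ 2)%:E = S%:E)%E.
  rewrite -[RHS]/((fine _)%:E) fineK; last exact: integrable_fin_num.
  by apply: eq_integral => om _ /=; rewrite real_normK// num_real.
rewrite SE -EFinM.
pose G om := 2 * C ^+ 2 * (`|dtau om| ^+ 2 + N ^+ 2).
have iN : lebesgue_measure.-integrable Om (EFin \o (fun=> N ^+ 2)) by exact: integrable_cst.
have iD : lebesgue_measure.-integrable Om (EFin \o (fun om => `|dtau om| ^+ 2 + N ^+ 2)).
  rewrite (_ : EFin \o _ = (fun om => (`|dtau om| ^+ 2)%:E + (N ^+ 2)%:E)%E).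
    exact: integrableD.
  by apply/funext => om; rewrite /= EFinD.
have iG : lebesgue_measure.-integrable Om (EFin \o G).
  rewrite (_ : EFin \o _ = (fun om => (2 * C ^+ 2)%:E * (`|dtau om| ^+ 2 + N ^+ 2)%:E)%E).
    exact: integrableZl.
  by apply/funext => om; rewrite /= EFinM.
have G0 om : 0 <= G om by rewrite mulr_ge0 ?mulr_ge0 ?addr_ge0 ?sqr_ge0.
apply: (@le_trans _ _ (\int[lebesgue_measure]_(om in Om) (G om)%:E)%E).
  apply: le_integral_ge0_ae => //.
  - exact: measurable_int iG.
  - by move=> om _; rewrite lee_fin sqr_ge0.
  - by move=> om _; rewrite lee_fin.
  apply: (ae_mono (grad_le _ _ _ _ _ _ a' a sol' sol adj' adj)) => om grad_om Oom.
  have := grad_om Oom; rewrite /dist -/N dtauE lee_fin => le1.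
  rewrite -(@real_normK _ (_ om)) ?num_real//.
  apply: (@le_trans _ _ ((C * (`|dtau om| + N)) ^+ 2)).
    by rewrite lerXn2r ?nnegrE//; apply: le_trans le1.
  have := sqr_ge0 (C * (`|dtau om| - N)).
  have -> : G om = (C * (`|dtau om| + N)) ^+ 2 + (C * (`|dtau om| - N)) ^+ 2.
    by rewrite /G; ring.
  by rewrite lerDl.
have -> : (\int[lebesgue_measure]_(om in Om) (G om)%:E =
    (2 * C ^+ 2 * (S + N ^+ 2 * V))%:E)%E.
  rewrite -[LHS]fineK; last exact: integrable_fin_num.
  congr EFin; rewrite -[LHS]/(\int[lebesgue_measure]_(om in Om) G om).
  by rewrite RintegralZl// RintegralD// Rintegral_cst.
rewrite lee_fin; clearbody S N; clear -N2 S0 C0 V0 K0.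
apply: (@le_trans _ _ (2 * C ^+ 2 * (S + V * S * V))).
  by rewrite ler_wpM2l ?mulr_ge0 ?sqr_ge0// lerD2l ler_wpM2r// ltW.
apply: (@le_trans _ _ (K ^+ 2 * S)).
  have -> : K ^+ 2 * S = 2 * C ^+ 2 * (S + V * S * V) +
      2 * C ^+ 2 * S * (1 + 4 * V + V ^+ 2) by rewrite /K; ring.
  by rewrite lerDl !mulr_ge0// ?sqr_ge0// !addr_ge0 ?mulr_ge0 ?sqr_ge0 ?(ltW V0).
apply: ler_wpM2r => //; rewrite lerXn2r ?nnegrE ?addr_ge0//.
by rewrite lerDl.
Qed.
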